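(* Suppose the initial degrees are fixed, $m_t=m$ for all $t\ge 1$, for some deterministic $m\in\mathbb{N}$, $m\ge1$. Let $\delta_0\in(-a,b)$ (i.e. $\delta_0$ is interior to the parameter set $[-a,b]$), and suppose the network is generated with true parameter $\delta_0$. Then the maximum likelihood estimator $\hat\delta_n$ satisfies, as $n\to\infty$, $$\sqrt n\,(\hat\delta_n-\delta_0)\rightsquigarrow N(0,\nu_0^{-1}),\qquad \nu_0=\sum_{k=1}^\infty\frac{m\,q_k^{(0)}}{(k+\delta_0)^2}-\frac{m}{(2m+\delta_0)^2},$$ where $\rightsquigarrow$ denotes convergence in distribution.
   Context: Model (affine preferential attachment with fixed initial degree $m$, parameter $\delta>-1$). $\mathrm{PA}_1(\delta)$ has two vertices $v_0,v_1$ joined by $m$ edges. For $t\ge2$, given $\mathrm{PA}_{t-1}(\delta)=:\mathrm{PA}_{t,0}(\delta)$ with vertex set $V_{t-1}=\{v_0,\dots,v_{t-1}\}$, a new vertex $v_t$ is added, and sequentially for $i=1,\dots,m$ the network $\mathrm{PA}_{t,i}(\delta)$ is obtained from $\mathrm{PA}_{t,i-1}(\delta)$ by adding an edge between $v_t$ and a random vertex of $V_{t-1}$, where, conditionally on the past, $v_j\in V_{t-1}$ is chosen with probability $(\mathrm{Deg}_{t,i-1}(v_j)+\delta)/S_{t,i-1}(\delta)$. Here $\mathrm{Deg}_{t,i-1}(v)$ is the degree of $v$ in $\mathrm{PA}_{t,i-1}(\delta)$ and $S_{t,i-1}(\delta)=\sum_{v\in V_{t-1}}(\mathrm{Deg}_{t,i-1}(v)+\delta)=t\delta+2m(t-1)+(i-1)$.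 Finally $\mathrm{PA}_t(\delta)=\mathrm{PA}_{t,m}(\delta)$. MLE. $N_k(n)$ is the number of vertices of degree $k$ in the network at time $n$, $N_{>k}(n)=\sum_{j>k}N_j(n)$ and $p_{>k}(n)=N_{>k}(n)/(n+1)$. For $\delta>-1$, the normalized log-likelihood (up to a term not depending on $\delta$) is $$\iota_n(\delta)=\sum_{k=1}^\infty\log(k+\delta)\bigl(p_{>k}(n)-1_{\{k<m\}}\bigr)-\frac1{n+1}\sum_{t=2}^n\sum_{i=1}^{m}\log S_{t,i-1}(\delta),$$ with derivative $$\iota_n'(\delta)=\sum_{k=1}^\infty\frac{p_{>k}(n)-1_{\{k<m\}}}{k+\delta}-\frac1{n+1}\sum_{t=2}^n\sum_{i=1}^m\frac{t}{S_{t,i-1}(\delta)}.$$ The parameter set is $[-a,b]$ with given numbers $-1<-a<b<\infty$. The MLE is $\hat\delta_n=\arg\max_{\delta\in[-a,b]}\iota_n(\delta)$; if the maximum is attained in the interior, it is a root of $\iota_n'$. Limits. For $\delta>-1$ let $\theta=2+\delta/m$ and let $(p_k(\delta))_{k\ge1}$ be defined by $p_0=0$ and $p_k=\frac{k-1+\delta}{\theta}p_{k-1}-\frac{k+\delta}{\theta}p_k+1_{\{k=m\}}$, $k\ge1$. Put $q_k(\delta)=(k+\delta)p_k(\delta)/(2m+\delta)$ and $q_k^{(0)}=q_k(\delta_0)$. *)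

(* Defs.v *)
From HB Require Import structures.
From mathcomp Require Import all_boot all_order all_algebra.
From mathcomp Require Import all_classical all_reals all_analysis.
From mathcomp Require Import zify.

Set Implicit Arguments.
Unset Strict Implicit.
Unset Printing Implicit Defensive.

Import Order.TTheory GRing.Theory Num.Theory.
Import numFieldNormedType.Exports.

Local Open Scope classical_set_scope.
Local Open Scope ring_scope.

(* A network is the chronological list of its edges; the edge [(v, u)] was
   created together with the vertex [v].  Because the list is ordered, the
   value of PA_{t,i} determines all the choices made so far. *)
Definition network := seq (nat * nat).

Definition degree (g : network) (v : nat) : nat :=
  (count (fun e => e.1 == v) g + count (fun e => e.2 == v) g)%N.

(* [c t i] is the index of the vertex to which [v_t] attaches its [i]-th edge,
   for [2 <= t] and [1 <= i <= m]. *)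
Definition new_edges (c : nat -> nat -> nat) (t i : nat) : network :=
  [seq (t, c t l) | l <- iota 1 i].

(* PA_t for [1 <= t]; the value at 0 is irrelevant. *)
Fixpoint PA (m : nat) (c : nat -> nat -> nat) (t : nat) : network :=
  match t with
  | 0 => [::]
  | 1 => nseq m (1, 0)
  | t'.+1 => PA m c t' ++ new_edges c t'.+1 m
  end%N.

(* PA_{t,i} for [2 <= t] and [i <= m]. *)
Definition PA_step (m : nat) (c : nat -> nat -> nat) (t i : nat) : network :=
  PA m c t.-1 ++ new_edges c t i.

Section random_network.
Context {d : measure_display} {T : measurableType d} {R : realType}.
Variable P : probability T R.

(* The conditional law of the choice [J t i] given the past is expressed by
   conditioning on each possible value [g] of PA_{t,i-1} (a discrete variable),
   multiplied out so that values [g] of probability 0 are allowed. *)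
Definition pref_attachment (m : nat) (delta : R)
    (J : nat -> nat -> {RV P >-> nat}) : Prop :=
  let past t i w := PA_step m (fun s l => J s l w) t i.-1 in
  (forall t i w, (2 <= t)%N -> (1 <= i <= m)%N -> (J t i w < t)%N) /\
  (forall t i (g : network) j,
     (2 <= t)%N -> (1 <= i <= m)%N -> (j < t)%N ->
     P [set w | past t i w = g /\ J t i w = j] =
     (P [set w | past t i w = g] *
      (((degree g j)%:R + delta) /
         \sum_(v < t) ((degree g v)%:R + delta))%:E)%E).

Definition cvg_in_distribution (X : nat -> T -> R)
    (mu : probability (measurableTypeR R) R) : Prop :=
  forall x : R, {for x, continuous (fun y : R => mu `]-oo, y]%classic)} ->
    P [set w | X n w <= x] @[n --> \oo] --> mu `]-oo, x]%classic.

End random_network.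

Section likelihood.
Context {R : realType}.

(* S_{t,i}(delta); equal to the normalizing sum in [pref_attachment],
   see [sum_degreeD]. *)
Definition total_weight (m t i : nat) (delta : R) : R :=
  t%:R * delta + (2 * m * t.-1 + i)%:R.

Definition num_deg (g : network) (n k : nat) : nat :=
  #|[pred v : 'I_n.+1 | degree g v == k]|.

Definition num_deg_gt (g : network) (n k : nat) : R :=
  \big[+%R/0]_(k.+1 <= j <oo) ((num_deg g n j)%:R : R).

Definition frac_deg_gt (g : network) (n k : nat) : R :=
  num_deg_gt g n k / n.+1%:R.

Definition log_likelihood (m n : nat) (g : network) (delta : R) : R :=
  \big[+%R/0]_(1 <= k <oo)
     (ln (k%:R + delta) * (frac_deg_gt g n k - (k < m)%N%:R))
  - n.+1%:R^-1 *
    \sum_(2 <= t < n.+1) \sum_(1 <= i < m.+1) ln (total_weight m t i.-1 delta).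

Definition is_argmax (f : R -> R) (D : set R) (x : R) : Prop :=
  D x /\ forall y, D y -> f y <= f x.

End likelihood.

Section limits.
Context {R : realType}.

(* The implicit recursion has a unique solution, since
   theta + k + delta > 0. *)
Definition limit_degree_law (m : nat) (delta : R) (p : nat -> R) : Prop :=
  let theta := 2 + delta / m%:R in
  p 0%N = 0 /\
  forall k, (1 <= k)%N ->
    p k = (k%:R - 1 + delta) / theta * p k.-1
          - (k%:R + delta) / theta * p k + (k == m)%:R.

Definition size_biased (m : nat) (delta : R) (p : nat -> R) (k : nat) : R :=
  (k%:R + delta) * p k / (2 * m%:R + delta).

Definition nu_term (m : nat) (delta : R) (p : nat -> R) (k : nat) : R :=
  m%:R * size_biased m delta p k / (k%:R + delta) ^+ 2.

Definition nu (m : nat) (delta : R) (p : nat -> R) : R :=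
  \big[+%R/0]_(1 <= k <oo) nu_term m delta p k
  - m%:R / (2 * m%:R + delta) ^+ 2.

End limits.

Lemma sum_degree_edges (N : nat) (g : network) :
  all (fun e => (e.2 < N)%N) g ->
  (\sum_(v < N) degree g v = count (fun e => (e.1 < N)%N) g + size g)%N.
Proof.
rewrite /degree big_split /=; elim: g => [|[x y] g IH] /=.
  by rewrite !big1.
case/andP => yN /IH; rewrite !big_split /= => E.
have H z : (\sum_(v < N) (z == v :> nat) = (z < N))%N.
  case: ltnP => zN.
    rewrite (bigD1 (Ordinal zN)) //= eqxx big1 // => v /negP vz.
    by case: eqP => // e; case: vz; apply/eqP/val_inj.
  by rewrite big1 // => v _; case: eqP => // e; move: (ltn_ord v); lia.
rewrite !H yN; lia.
Qed.

Lemma PA_edges (m : nat) (c : nat -> nat -> nat) (t : nat) :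
  (forall s l, (2 <= s <= t)%N -> (1 <= l <= m)%N -> (c s l < s)%N) ->
  (1 <= t)%N ->
  all (fun e => (e.1 < t.+1)%N && (e.2 < t.+1)%N) (PA m c t)
  /\ size (PA m c t) = (m * t)%N.
Proof.
elim: t => // -[|t] IH hc _.
  by rewrite /= all_nseq /= orbT size_nseq muln1.
have [|//|IH1 IH2] := IH _.
  by move=> s l hs hl; apply: hc => //; lia.
rewrite [PA _ _ _]/= -/(PA m c t.+1) size_cat IH2 size_map size_iota; split; last lia.
rewrite all_cat; apply/andP; split.
  by apply: sub_all IH1 => e /=; lia.
apply/allP => e /mapP[l]; rewrite mem_iota => hl -> /=.
by have := hc t.+2 l; lia.
Qed.

Lemma sum_degreeD (R : realType) (m : nat) (c : nat -> nat -> nat) (delta : R)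
    (t i : nat) :
  (forall s l, (2 <= s <= t)%N -> (1 <= l <= m)%N -> (c s l < s)%N) ->
  (2 <= t)%N -> (i <= m)%N ->
  \sum_(v < t) ((degree (PA_step m c t i) v)%:R + delta)
  = total_weight m t i delta.
Proof.
case: t => // -[//|t] hc _ him.
have [|//|h1 h2] := @PA_edges m c t.+1.
  by move=> s l hs hl; apply: hc => //; lia.
have hn l : (1 <= l <= i)%N -> (c t.+2 l < t.+2)%N.
  by move=> hl; apply: hc; lia.
rewrite big_split /= sumr_const card_ord -natr_sum sum_degree_edges.
  rewrite /total_weight /PA_step count_cat size_cat h2 addrC -[_ *+ _]mulr_natl [_.+2.-1]/=.
  congr (_ + _%:R).
  rewrite size_map size_iota (_ : count _ (PA _ _ _) = (m * t.+1)%N).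
    rewrite (_ : count _ (new_edges _ _ _) = 0%N); first lia.
    rewrite count_map (eq_count (a2 := pred0)) ?count_pred0 // => l /=.
    by rewrite ltnn.
  by rewrite -h2; apply/eqP; rewrite -all_count; apply: sub_all h1 => e /andP[].
rewrite all_cat; apply/andP; split.
  by apply: sub_all h1 => e /andP[].
apply/allP => e /mapP[l]; rewrite mem_iota => hl -> /=; apply: hn; lia.
Qed.

(* Main.v *)
(* Write [D_s] for the degree of the vertex chosen at step [s] and [S_s(delta)]
   for the total weight at that step.  A vertex reaches degree [k + 1] by being
   chosen at degree [k], so [n + 1] times the log-likelihood is the sum over the
   steps of [ln (D_s + delta) - ln S_s(delta)].  Its slope at [delta0], the
   score [Z], is a martingale with bounded increments, whose conditional
   variances are degree statistics.

   The number of vertices of degree [> k] satisfies a law of large numbers in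
   [L^2], by induction on [k] using its one-step drift.  As [1 / (k + delta)]
   tends to [0], finitely many [k] determine all degree statistics involved up
   to a small error; in particular the conditional variances converge to
   [nu / m] in [L^1].  The central limit theorem for [Z] then follows from
   Lindeberg's telescoping argument: with a Gaussian distribution function as
   test function, the interpolation between [Z] and its limit is explicit and
   solves the heat equation.

   The slope at [delta] equals exactly [Z - (delta - delta0) * curvature], and
   the curvature is at least a positive multiple of the number of steps,
   uniformly in [delta], because its limit is the gap in Jensen's inequality for
   [1 / x].  At a maximizer this forces [delta - delta0 = O(|Z| / s)] after [s]
   steps; the maximizer is then interior, and
   [Z = (delta - delta0) * curvature] transfers the limit law of [Z]. *)

Require Import Defs.
From HB Require Import structures.
From mathcomp Require Import all_boot all_order all_algebra.
From mathcomp Require Import all_classical all_reals all_analysis.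
From mathcomp Require Import zify ring lra.

Set Implicit Arguments.
Unset Strict Implicit.
Unset Printing Implicit Defensive.

Import Order.TTheory GRing.Theory Num.Theory.
Import numFieldNormedType.Exports.

Local Open Scope classical_set_scope.
Local Open Scope ring_scope.

(** At each step the network takes finitely many values, so expectations are finite sums over
    [nets], conditional expectations given the network are explicit weighted sums, and the
    martingale arguments rest on the tower identity [expectS]. Time is counted in single edges
    because degrees change between the [m] edges of one vertex; the vertex being built is not a
    candidate for attachment, and its partial degree has to be tracked. The main obstacle is that
    the log-likelihood is a difference of two concave functions of the parameter: a critical point
    is not known in advance to be unique, and a maximizer could sit at an endpoint. The estimates on
    the slope are therefore uniform over the parameter interval and apply to any maximizer. The
    scales fit as follows: over [s = n * m] edges both the variance of the score and the curvature
    at [delta0] are close to [s * nu / m = n * nu], so their quotient has variance about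
    [1 / (n * nu)]. *)

(** * The network as a process indexed by single edges *)

(* The edges [s = 0, 1, ...] added after time 1 are numbered consecutively:
   edge [s] is the [(s %% m).+1]-st edge of the vertex [new_vertex m s]. *)
Definition new_vertex (m s : nat) : nat := (s %/ m).+2.

Definition net (m : nat) (c : nat -> nat -> nat) (s : nat) : network :=
  nseq m (1, 0)%N ++
  [seq (new_vertex m l, c (new_vertex m l) (l %% m).+1) | l <- iota 0 s].

Lemma netS m c s : net m c s.+1 =
  rcons (net m c s) (new_vertex m s, c (new_vertex m s) (s %% m).+1).
Proof. by rewrite /net -[in LHS](addn1 s) iotaD map_cat /= add0n catA cats1. Qed.

Lemma net_block m c n i : (0 < m)%N -> (i <= m)%N ->
  net m c (n * m + i) = net m c (n * m) ++ new_edges c n.+2 i.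
Proof.
move=> m0 im; rewrite /net iotaD map_cat catA; congr (_ ++ _).
rewrite /new_edges (iotaDl 1 0) add0n -[X in iota X _]addn0 iotaDl -!map_comp.
apply/eq_in_map => l; rewrite mem_iota add0n => /= li.
have lm : (l < m)%N by lia.
rewrite /new_vertex divnMDl// divn_small// addn0.
by rewrite modnMDl modn_small// add1n.
Qed.

Lemma PA_net m c n : (0 < m)%N -> PA m c n.+1 = net m c (n * m).
Proof.
move=> m0; elim: n => [|n IH]; first by rewrite mul0n /net /= cats0.
by rewrite [PA _ _ _]/= -/(PA m c n.+1) IH mulSnr net_block.
Qed.

Lemma PA_step_net m c s : (0 < m)%N ->
  PA_step m c (new_vertex m s) (s %% m) = net m c s.
Proof.
move=> m0; rewrite /PA_step /new_vertex [_.+2.-1]/= PA_net//.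
by rewrite -net_block ?(ltnW (ltn_pmod _ _))// -divn_eq.
Qed.

Lemma degree_rcons g x y v :
  degree (rcons g (x, y)) v = (degree g v + (x == v) + (y == v))%N.
Proof. by rewrite /degree -cats1 !count_cat /=; lia. Qed.

(** The vertex under construction is not yet eligible, so its [s %% m] half-edges are left out of
    the degree sum. The lower bound [m] makes the attachment weights positive and lets [choice_sum]
    start at [m]. *)
Definition valid_net (m s : nat) (g : network) : Prop :=
  [/\ forall v, (v < new_vertex m s)%N -> (m <= degree g v)%N,
      degree g (new_vertex m s) = (s %% m)%N,
      forall v, (new_vertex m s < v)%N -> degree g v = 0%N
    & (\sum_(v < new_vertex m s) degree g v = s + m * new_vertex m s)%N].

Lemma valid_net0 m : valid_net m 0 (nseq m (1, 0)%N).
Proof.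
have degE v : degree (nseq m (1, 0)%N) v = (m * (v < 2))%N.
  by rewrite /degree !count_nseq; case: v => [|[|v]] /=; lia.
rewrite /valid_net /new_vertex div0n mod0n.
split => [v hv||v hv|].
- by rewrite degE hv muln1.
- by rewrite degE muln0.
- by rewrite degE ltnNge (ltnW hv) muln0.
- by rewrite !big_ord_recr big_ord0 /= !degE /= !muln1; lia.
Qed.

Lemma new_vertexS m s : (0 < m)%N ->
  new_vertex m s.+1 = (new_vertex m s + (s.+1 %% m == 0))%N.
Proof.
by move=> m0; rewrite /new_vertex divnS// /dvdn; lia.
Qed.

Lemma sum_ord_eqn n j : (j < n)%N -> (\sum_(v < n) (j == v :> nat) = 1)%N.
Proof.
move=> jn; rewrite (bigD1 (Ordinal jn)) //= eqxx big1 // => v /negP vz.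
by case: eqP => // e; case: vz; apply/eqP/val_inj.
Qed.

Lemma sum_degree_rcons m s g j : (j < new_vertex m s)%N ->
  (\sum_(v < new_vertex m s) degree (rcons g (new_vertex m s, j)) v =
   (\sum_(v < new_vertex m s) degree g v).+1)%N.
Proof.
move=> hj; under eq_bigr do rewrite degree_rcons.
rewrite !big_split /= [X in (_ + X + _)%N]big1 ?sum_ord_eqn//; first lia.
by move=> i _; rewrite gtn_eqF.
Qed.

Lemma valid_net_rcons m s g j : (0 < m)%N -> valid_net m s g ->
  (j < new_vertex m s)%N -> valid_net m s.+1 (rcons g (new_vertex m s, j)).
Proof.
move=> m0 [h1 h2 h3 h4] hj; rewrite /valid_net new_vertexS//.
have smE : (s.+1 %% m = if s.+1 %% m == 0 then 0 else (s %% m).+1)%N.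
  by rewrite modnS /dvdn; case: ifP.
have smE' : (s.+1 %% m == 0)%N -> (s %% m).+1 = m.
  move/eqP; rewrite -addn1 -modnDml addn1; have := ltn_pmod s m0.
  by rewrite leq_eqVlt => /predU1P[//|h]; rewrite modn_small.
have hs := sum_degree_rcons g hj.
(* Either this edge is the [m]-th of the current vertex, which then becomes eligible with degree
   exactly [m], or the set of eligible vertices is unchanged. *)
case: (eqVneq (s.+1 %% m) 0)%N smE smE' => e /= smE smE'.
- rewrite addn1; split => [v|||].
  + rewrite ltnS leq_eqVlt degree_rcons => /orP[/eqP ->|hv].
      by rewrite h2 eqxx; have := smE' isT; lia.
    by have := h1 v hv; lia.
  + by rewrite degree_rcons h3//; lia.
  + by move=> v hv; rewrite degree_rcons h3; lia.
  + rewrite big_ord_recr /= hs h4 degree_rcons h2 eqxx.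
    by have := smE' isT; nia.
- rewrite addn0; split => [v hv|||].
  + by rewrite degree_rcons; have := h1 v hv; lia.
  + by rewrite degree_rcons h2 eqxx; lia.
  + by move=> v hv; rewrite degree_rcons h3; lia.
  + by rewrite hs h4; lia.
Qed.

Section choice_sum.
Context {R : realType}.

(* Every vertex attains the degrees [m, ..., deg - 1] before being chosen once
   more, so this is the sum of [f (degree of the chosen vertex)] over the first
   [s] choices, see [choice_sum_rcons]. *)
Definition choice_sum (m s : nat) (f : nat -> R) (g : network) : R :=
  \sum_(v < new_vertex m s) \sum_(m <= k < degree g v) f k.

Lemma choice_sum0 m f : choice_sum m 0 f (nseq m (1, 0)%N) = 0.
Proof.
rewrite /choice_sum big1// => v _; rewrite big_geq//.
by rewrite /degree !count_nseq /=; case: v => -[|[|]] //=; lia.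
Qed.

Lemma choice_sum_rcons m s f g j : (0 < m)%N -> valid_net m s g ->
  (j < new_vertex m s)%N ->
  choice_sum m s.+1 f (rcons g (new_vertex m s, j)) =
  choice_sum m s f g + f (degree g j).
Proof.
move=> m0 hg hj; rewrite /choice_sum.
(* A vertex completed by this edge has degree [m], so its inner sum is empty. *)
have -> : \sum_(v < new_vertex m s.+1)
    \sum_(m <= k < degree (rcons g (new_vertex m s, j)) v) f k =
    \sum_(v < new_vertex m s)
    \sum_(m <= k < degree (rcons g (new_vertex m s, j)) v) f k.
  rewrite new_vertexS//; case: eqP => e; last by rewrite addn0.
  rewrite addn1 big_ord_recr /= [X in _ + X]big_geq ?addr0// degree_rcons.
  case: hg => _ -> _ _; rewrite eqxx; have := ltn_pmod s m0; lia.
rewrite (bigD1 (Ordinal hj))//= [in RHS](bigD1 (Ordinal hj))//= degree_rcons.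
rewrite eqxx gtn_eqF// addn0 addn1 big_nat_recr /=; last by case: hg => + _ _ _;
  apply.
rewrite -!addrA; congr (_ + _); rewrite addrC; congr (_ + _).
apply: eq_bigr => v vj; rewrite degree_rcons gtn_eqF// addn0.
have -> : (j == v :> nat) = false.
  by apply/eqP => jv; case/eqP: vj; apply/val_inj.
by rewrite addn0.
Qed.

End choice_sum.

(** * The log-likelihood as a sum over choices *)

Section likelihood_of_net.
Context {R : realType}.
Implicit Types (m n s : nat) (g : network) (delta : R).

Lemma limn_sum_finite a B (F : nat -> R) : (forall j, (B <= j)%N -> F j = 0) ->
  limn (fun n => \sum_(a <= j < n) F j) = \sum_(a <= j < maxn a B) F j.
Proof.
move=> F0; apply: lim_near_cst => //; near=> n.
have nB : (maxn a B <= n)%N by near: n; exists (maxn a B).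
rewrite (big_cat_nat (leq_maxl a B) nB) /=.
rewrite [X in _ + X]big1_seq ?addr0// => j /=; rewrite mem_index_iota => /andP[hj _].
by apply: F0; rewrite (leq_trans _ hj)// leq_maxr.
Unshelve. all: by end_near. Qed.

Lemma degree_le_size g v : (degree g v <= 2 * size g)%N.
Proof.
by rewrite /degree mul2n -addnn leq_add// count_size.
Qed.

Lemma num_deg_gtE g n k :
  num_deg_gt g n k = (\sum_(v < n.+1) (k < degree g v)%N)%:R :> R.
Proof.
rewrite /num_deg_gt (@limn_sum_finite _ (2 * size g).+1); last first.
  move=> j hj; rewrite /num_deg eq_card0// => v; rewrite !inE.
  by apply/negbTE/eqP => h; have := degree_le_size g v; lia.
rewrite -natr_sum; congr (_%:R).
under eq_bigr do rewrite /num_deg -sum1_card big_mkcond /=.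
rewrite exchange_big /=; apply: eq_bigr => v _.
under eq_bigr do rewrite inE.
have := degree_le_size g v; move: (degree g v) (2 * size g)%N => D B DB.
case: ltnP => kD.
  rewrite (big_cat_nat (n := D)) //=; last by lia.
  rewrite [X in (_ + X)%N]big_ltn ?eqxx; last by lia.
  rewrite !big1_seq//= => j; rewrite mem_index_iota => hj; rewrite ifF//; lia.
by rewrite big1_seq// => j /=; rewrite mem_index_iota => hj; rewrite ifF//; lia.
Qed.

(** Subtracting the indicator of [k < m] cancels the degrees that a vertex passes by emitting its
    own edges; one term per choice of that vertex remains. *)
Lemma sum_ltn_diff (f : nat -> R) m D B : (1 <= m)%N -> (m <= D)%N ->
  (D <= B)%N ->
  \sum_(1 <= k < B) f k * ((k < D)%N%:R - (k < m)%N%:R) = \sum_(m <= k < D) f k.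
Proof.
move=> m1 mD DB.
rewrite (big_cat_nat m1 (leq_trans mD DB)) (big_cat_nat mD DB) /=.
rewrite [X in X + _]big1_seq ?add0r; last first.
  by move=> k /=; rewrite mem_index_iota => /andP[_ km];
    rewrite km (leq_trans km mD) subrr mulr0.
rewrite addrC [X in X + _]big1_seq ?add0r; last first.
  move=> k /=; rewrite mem_index_iota => /andP[Dk _];
    rewrite ltnNge Dk/= ltnNge (leq_trans mD Dk)/=.
  by rewrite subrr mulr0.
rewrite !big_nat; apply: eq_bigr => k /andP[mk kD].
by rewrite kD ltnNge mk/= subr0 mulr1.
Qed.

Definition net_log_likelihood m s g delta : R :=
  choice_sum m s (fun k => ln (k%:R + delta)) g -
  \sum_(l < s) ln (total_weight m (new_vertex m l) (l %% m) delta).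

Lemma sum_edges m n (F : nat -> nat -> R) : (0 < m)%N ->
  \sum_(2 <= t < n.+2) \sum_(1 <= i < m.+1) F t i.-1 =
  \sum_(l < n * m) F (new_vertex m l) (l %% m)%N.
Proof.
move=> m0; elim: n => [|n IH]; first by rewrite mul0n big_geq// big_ord0.
rewrite big_nat_recr//= IH mulSnr -[in RHS](big_mkord xpredT
  (fun l => F (new_vertex m l) (l %% m)%N)).
rewrite [in RHS](big_cat_nat (n := n * m)) ?leq_addr//= big_mkord; congr (_ + _).
rewrite big_add1 /= big_mkord -[X in index_iota X _]add0n big_addn addKn big_mkord.
apply: eq_bigr => i _; rewrite /new_vertex addnC divnMDl// divn_small// addn0.
by rewrite modnMDl modn_small.
Qed.

Lemma log_likelihood_net m n g delta : (0 < m)%N -> valid_net m (n * m) g ->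
  log_likelihood m n.+1 g delta =
  n.+2%:R^-1 * net_log_likelihood m (n * m) g delta.
Proof.
move=> m0 [h1 _ _ _].
have nvE : new_vertex m (n * m) = n.+2 by rewrite /new_vertex mulnK.
rewrite /log_likelihood.
rewrite (@sum_edges _ _ (fun t i => ln (total_weight m t i delta)))// mulrBr;
  congr (_ - _).
rewrite (@limn_sum_finite _ (maxn m (2 * size g).+1)); last first.
  move=> j hj; rewrite /frac_deg_gt num_deg_gtE big1 ?mul0r.
    by rewrite ltnNge (leq_trans _ hj) ?leq_maxl// subrr mulr0.
  move=> v _; have := degree_le_size g v; move: hj; case: ltnP => //; lia.
rewrite /choice_sum nvE mulr_sumr.
set B := maxn _ _.
(* The indicator of [k < m] is written as an average over the [n.+2] vertices, so that the whole
   expression becomes a sum over vertices. *)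
under eq_bigr => k _.
  rewrite /frac_deg_gt num_deg_gtE.
  rewrite (_ : (k < m)%N%:R = n.+2%:R^-1 * (\sum_(v < n.+2) (k < m)%N)%:R :> R);
    last by rewrite sum_nat_const card_ord natrM mulKf ?pnatr_eq0.
  rewrite [X in X - _]mulrC -mulrBr !natr_sum -sumrB mulrCA !mulr_sumr.
over.
rewrite exchange_big /=; apply: eq_bigr => v _.
rewrite -mulr_sumr; congr (_ * _); apply: sum_ltn_diff => //.
  by apply: h1; rewrite nvE.
by have := degree_le_size g v; rewrite /B; lia.
Qed.

End likelihood_of_net.

(** * The law of the network *)

Section weight.
Context {R : realType}.

(** This form shows the two properties used later: the weight is affine in [delta] with slope the
    number of eligible vertices, and it is at least [m + delta] times that number. *)
Definition edge_weight (m s : nat) (delta : R) : R :=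
  s%:R + (m%:R + delta) * (new_vertex m s)%:R.

Lemma total_weightE m s (delta : R) :
  total_weight m (new_vertex m s) (s %% m) delta = edge_weight m s delta.
Proof.
have sE : s%:R = (s %/ m)%:R * m%:R + (s %% m)%:R :> R.
  by rewrite -natrM -natrD -divn_eq.
rewrite /total_weight /edge_weight sE /new_vertex /= !natrD !natrM -!natr1; ring.
Qed.

Lemma sum_weight_valid m s g (delta : R) : valid_net m s g ->
  \sum_(v < new_vertex m s) ((degree g v)%:R + delta) = edge_weight m s delta.
Proof.
case=> _ _ _ h; rewrite big_split /= -natr_sum h sumr_const card_ord.
by rewrite /edge_weight natrD natrM -mulr_natl; ring.
Qed.

Lemma degreeD_gt0 m s g (delta : R) v : (0 < m)%N -> -1 < delta ->
  valid_net m s g -> (v < new_vertex m s)%N -> 0 < (degree g v)%:R + delta.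
Proof.
move=> m0 d1 [h _ _ _] /h mv.
have : 1 <= (degree g v)%:R :> R by rewrite ler1n (leq_trans m0).
lra.
Qed.

Lemma edge_weight_gt0 m s (delta : R) : (0 < m)%N -> -1 < delta ->
  0 < edge_weight m s delta.
Proof.
move=> m0 d1; rewrite /edge_weight ltr_wpDl//.
have : 1 <= m%:R :> R by rewrite ler1n.
move=> h; apply: mulr_gt0; first lra.
by rewrite ltr0n.
Qed.

End weight.

Fixpoint nets (m s : nat) : seq network :=
  if s is s'.+1 then
    [seq rcons g (new_vertex m s', j) | g <- nets m s',
                                        j <- iota 0 (new_vertex m s')]
  else [:: nseq m (1, 0)%N].

Lemma netsS m s : nets m s.+1 =
  [seq rcons g (new_vertex m s, j) | g <- nets m s, j <- iota 0 (new_vertex m s)].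
Proof. by []. Qed.

Lemma nets_valid m s g : (0 < m)%N -> g \in nets m s -> valid_net m s g.
Proof.
move=> m0; elim: s g => [|s IH] g.
  by rewrite inE => /eqP ->; exact: valid_net0.
rewrite netsS; case/allpairsPdep => g' [j [/IH hg']]; rewrite mem_iota => hj ->.
exact: valid_net_rcons.
Qed.

Lemma net_nets m s c :
  (forall l, (c (new_vertex m l) (l %% m).+1 < new_vertex m l)%N) ->
  net m c s \in nets m s.
Proof.
move=> hc; elim: s => [|s IH]; first by rewrite /net /= cats0 inE.
rewrite netS netsS; apply/allpairsPdep.
exists (net m c s), (c (new_vertex m s) (s %% m).+1).
by split => //; rewrite mem_iota; exact: hc.
Qed.

Lemma nets_uniq m s : uniq (nets m s).
Proof.
elim: s => [//|s IH]; rewrite netsS; apply: allpairs_uniq => //;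
  first exact: iota_uniq.
by move=> [g j] [g' j'] _ _ /= /rcons_inj[-> ->].
Qed.

Section network_law.
Context {d : measure_display} {T : measurableType d} {R : realType}.
Variable P : probability T R.
Variables (m : nat) (delta0 : R) (J : nat -> nat -> {RV P >-> nat}).
Hypothesis hm : (0 < m)%N.
Hypothesis hdelta0 : -1 < delta0.
Hypothesis hJ : pref_attachment m delta0 J.

Definition random_net s w : network := net m (fun t i => J t i w) s.

Lemma J_lt s w :
  (J (new_vertex m s) (s %% m).+1 w < new_vertex m s)%N.
Proof. by case: hJ => h _; apply: h => //=; rewrite ltn_pmod. Qed.

Lemma random_net_nets s w : random_net s w \in nets m s.
Proof. by apply: net_nets => l; exact: J_lt. Qed.

(** Any set [A] is allowed: the network depends only on finitely many [nat]-valued choices, and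
    splitting on the last one reduces to the previous step. *)
Lemma measurable_random_net s (A : set network) :
  measurable [set w | A (random_net s w)].
Proof.
elim: s A => [|s IH] A.
  have [a|a] := pselect (A (net m (fun=> fun=> 0%N) 0)).
    rewrite (_ : [set _ | _] = setT)//; apply/seteqP; split => // w _.
  rewrite (_ : [set _ | _] = set0)//; apply/seteqP; split => // w.
pose t := new_vertex m s; pose X := J t (s %% m).+1.
rewrite (_ : [set _ | _] = \bigcup_j (X @^-1` [set j] `&`
    [set w | A (rcons (random_net s w) (t, j))])).
  apply: bigcup_measurable => j _; apply: measurableI.
    exact: measurable_funPTI.
  exact: (IH (fun g => A (rcons g (t, j)))).
apply/seteqP; split => w /=; rewrite /random_net netS.
  by move=> h; exists (X w).
by case=> j _ [/= <-].
Qed.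

Definition net_prob s g : R := fine (P [set w | random_net s w = g]).

Definition expect s (F : network -> R) : R :=
  \sum_(g <- nets m s) net_prob s g * F g.

Lemma net_prob_ge0 s g : 0 <= net_prob s g.
Proof. exact: fine_ge0. Qed.

Lemma net_prob_rcons s g j : g \in nets m s -> (j < new_vertex m s)%N ->
  net_prob s.+1 (rcons g (new_vertex m s, j)) =
  net_prob s g * (((degree g j)%:R + delta0) / edge_weight m s delta0).
Proof.
move=> hg hj; rewrite /net_prob.
have := hJ.2 (new_vertex m s) (s %% m).+1 g j isT _ hj.
rewrite /= ltn_pmod// => /(_ isT) h.
rewrite (_ : [set w | random_net s.+1 w = _] =
  [set w | PA_step m (fun s l => J s l w) (new_vertex m s) (s %% m) = g /\
           J (new_vertex m s) (s %% m).+1 w = j]); last first.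
  apply/seteqP; split => w /=; rewrite /random_net netS PA_step_net//.
    by move/rcons_inj => -[-> ->].
  by move=> [-> ->].
rewrite h (sum_weight_valid _ (nets_valid hm hg)).
under eq_set do rewrite PA_step_net//.
rewrite fineM//; apply: fin_num_measure.
exact: (measurable_random_net s (eq^~ g)).
Qed.

(** Given by a formula, so it makes sense also for networks of probability zero. The denominator is
    the sum of the weights only under [valid_net], whence that hypothesis in the lemmas below. *)
Definition cond_expect s g (h : nat -> R) : R :=
  \sum_(j < new_vertex m s)
    ((degree g j)%:R + delta0) / edge_weight m s delta0 * h j.

Lemma expectS s F : expect s.+1 F =
  expect s (fun g => cond_expect s g (fun j => F (rcons g (new_vertex m s, j)))).
Proof.
rewrite /expect netsS big_allpairs_dep !big_seq; apply: eq_bigr => g hg.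
rewrite /cond_expect mulr_sumr -(big_mkord xpredT (fun j => net_prob s g *
  (((degree g j)%:R + delta0) / edge_weight m s delta0 *
   F (rcons g (new_vertex m s, j))))) /index_iota subn0 !big_seq.
apply: eq_bigr => j; rewrite mem_iota => hj.
by rewrite net_prob_rcons// -!mulrA.
Qed.

Lemma prob_random_net s (A : pred network) :
  fine (P [set w | A (random_net s w)]) = expect s (fun g => (A g)%:R).
Proof.
have hfin l : P [set w | A (random_net s w) && (random_net s w \in l)] \is a fin_num.
  by apply: fin_num_measure; exact: (measurable_random_net s
    (fun g => A g && (g \in l))).
(* Generalized to duplicate-free lists, so that additivity of [P] is used one network at a time. *)
have key l : uniq l ->
    fine (P [set w | A (random_net s w) && (random_net s w \in l)]) =
    \sum_(g <- l) net_prob s g * (A g)%:R.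
  elim: l => [_|g l IH /= /andP[gl ul]].
    rewrite big_nil (_ : [set _ | _] = set0) ?measure0//.
    by apply/seteqP; split => // w /=; rewrite in_nil andbF.
  rewrite big_cons -IH//.
  rewrite [in LHS](_ : [set _ | _] =
    [set w | A (random_net s w) && (random_net s w == g)] `|`
    [set w | A (random_net s w) && (random_net s w \in l)]); last first.
    apply/seteqP; split => w; rewrite /mkset /setU in_cons.
      by case/andP => Aw /orP[wg|wl]; [left|right]; rewrite /= Aw.
    by case => /= /andP[-> ->]; rewrite ?orbT.
  rewrite measureU//=.
  - rewrite fineD//; last first.
      by apply: fin_num_measure; exact: (measurable_random_net s
        (fun h => A h && (h == g))).
    congr (_ + _); rewrite /net_prob.
    have [Ag|Ag] := boolP (A g).
      rewrite mulr1; congr (fine (P _)); apply/seteqP; split => w /=.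
        by case/andP => _ /eqP.
      by move=> ->; rewrite Ag eqxx.
    rewrite mulr0 (_ : [set _ | _] = set0) ?measure0//.
    apply/seteqP; split => // w /= /andP[+ /eqP e].
    by rewrite e (negbTE Ag).
  - exact: (measurable_random_net s (fun h => A h && (h == g))).
  - exact: (measurable_random_net s (fun h => A h && (h \in l))).
  - apply/seteqP; split => // w /= -[/andP[_ /eqP e] /andP[_]].
    by rewrite e (negbTE gl).
rewrite /expect -key ?nets_uniq//; congr (fine (P _)).
apply/seteqP; split => w /=; last by case/andP.
by move=> ->; exact: random_net_nets.
Qed.

Lemma cond_expectD s g h1 h2 :
  cond_expect s g (fun j => h1 j + h2 j) = cond_expect s g h1 + cond_expect s g h2.
Proof. by rewrite /cond_expect -big_split/=; apply: eq_bigr => j _;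
  rewrite mulrDr. Qed.

Lemma cond_expectZ s g c h :
  cond_expect s g (fun j => c * h j) = c * cond_expect s g h.
Proof.
by rewrite /cond_expect mulr_sumr; apply: eq_bigr => j _; rewrite mulrCA.
Qed.

Lemma cond_expect_cst s g c : valid_net m s g -> cond_expect s g (fun=> c) = c.
Proof.
move=> hg; rewrite /cond_expect -mulr_suml -mulr_suml (sum_weight_valid _ hg).
by rewrite divff ?mul1r// gt_eqF// edge_weight_gt0.
Qed.

Lemma cond_expect_le s g h1 h2 : valid_net m s g ->
  (forall j, (j < new_vertex m s)%N -> h1 j <= h2 j) ->
  cond_expect s g h1 <= cond_expect s g h2.
Proof.
move=> hg h; apply: ler_sum => j _; apply: ler_wpM2l; last exact: h.
by rewrite divr_ge0// ltW// ?edge_weight_gt0// (degreeD_gt0 _ _ hg).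
Qed.

Lemma eq_cond_expect s g h1 h2 :
  (forall j, (j < new_vertex m s)%N -> h1 j = h2 j) ->
  cond_expect s g h1 = cond_expect s g h2.
Proof. by move=> h; apply: eq_bigr => j _; rewrite h. Qed.

Lemma norm_cond_expect_le s g h M : valid_net m s g ->
  (forall j, (j < new_vertex m s)%N -> `|h j| <= M) ->
  `|cond_expect s g h| <= M.
Proof.
move=> hg hM; rewrite ler_norml -{1}(cond_expect_cst (- M) hg).
rewrite -{2}(cond_expect_cst M hg); apply/andP.
by split; apply: cond_expect_le => // j /hM; rewrite ler_norml => /andP[].
Qed.

Lemma expectD s F G : expect s (fun g => F g + G g) = expect s F + expect s G.
Proof. by rewrite /expect -big_split/=; apply: eq_bigr => g _; rewrite mulrDr. Qed.

Lemma expectB s F G : expect s (fun g => F g - G g) = expect s F - expect s G.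
Proof. by rewrite /expect -sumrB; apply: eq_bigr => g _; rewrite mulrBr. Qed.

Lemma expectZ s c F : expect s (fun g => c * F g) = c * expect s F.
Proof.
by rewrite /expect mulr_sumr; apply: eq_bigr => g _; rewrite mulrCA.
Qed.

Lemma expect_le s F G : (forall g, valid_net m s g -> F g <= G g) ->
  expect s F <= expect s G.
Proof.
move=> h; rewrite /expect !big_seq; apply: ler_sum => g hg.
by apply: ler_wpM2l; [exact: net_prob_ge0 | exact/h/nets_valid].
Qed.

Lemma expect_cst s c : expect s (fun=> c) = c.
Proof.
have h := prob_random_net s xpredT.
(* The probability of the full event says that the values of [net_prob] sum to one. *)
transitivity (c * expect s (fun g => (xpredT g)%:R)); last first.
  rewrite -h.
  rewrite (_ : [set _ | _] = setT) ?probability_setT ?mulr1//.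
  exact/seteqP.
by rewrite /expect mulr_sumr; apply: eq_bigr => g _; rewrite mulrC mulr1.
Qed.

Lemma expect0 F : expect 0 F = F (nseq m (1, 0)%N).
Proof.
rewrite -[RHS](expect_cst 0) /expect /= !big_cons !big_nil; congr (_ * _ + _).
Qed.

Lemma ler_norm_expect s F : `|expect s F| <= expect s (fun g => `|F g|).
Proof.
apply: (le_trans (ler_norm_sum _ _ _)); apply: ler_sum => g _.
by rewrite normrM ger0_norm// net_prob_ge0.
Qed.

Lemma markov_random_net s F e : 0 < e -> (forall g, 0 <= F g) ->
  fine (P [set w | e <= F (random_net s w)]) <= expect s F / e.
Proof.
move=> e0 F0; rewrite (prob_random_net s (fun g => e <= F g)).
rewrite ler_pdivlMr// mulrC -expectZ; apply: expect_le => g _.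
by case: (leP e (F g)) => h; rewrite ?mulr1 ?mulr0.
Qed.

End network_law.

(** * The limiting degree law *)

Section limit_tail.
Context {R : realType}.
Variables (m : nat) (delta : R) (p : nat -> R).
Hypothesis m_gt0 : (0 < m)%N.
Hypothesis delta_gt : -1 < delta.
Hypothesis p_law : limit_degree_law m delta p.

Let theta : R := 2 + delta / m%:R.

(* [limit_tail k] is the limiting fraction of vertices of degree [> k]. *)
Definition limit_tail (k : nat) : R :=
  if (k < m)%N then 1 else (k%:R + delta) / theta * p k.

Let m_ge1 : 1 <= m%:R :> R. Proof. by rewrite ler1n. Qed.

Let m_neq0 : m%:R != 0 :> R. Proof. by rewrite pnatr_eq0 -lt0n. Qed.

Let m_theta : m%:R * theta = 2 * m%:R + delta.
Proof. by rewrite /theta mulrDr [_ / _]mulrC mulrA mulfV// mul1r mulrC. Qed.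

Let theta_gt1 : 1 < theta.
Proof.
have h : 0 < m%:R :> R by rewrite ltr0n.
rewrite -(ltr_pM2l h) m_theta mulr1; move: delta_gt m_ge1; lra.
Qed.

Local Ltac slra := move: delta_gt m_ge1 theta_gt1; lra.

Lemma limit_degree_law_lt k : (k < m)%N -> p k = 0.
Proof.
elim: k => [|k IH] hk; first by case: p_law.
case: p_law => _ /(_ k.+1 isT); rewrite /= IH; last lia.
rewrite ltn_eqF// mulr0 add0r addr0 -/theta => e.
have : (theta + (k.+1%:R + delta)) * p k.+1 = 0.
  rewrite mulrDl; move: e; set q := p k.+1 => e.
  have t0 : theta != 0 by rewrite gt_eqF//; slra.
  by rewrite {1}e mulrN mulrA mulrCA mulfV// mulr1 addNr.
move/eqP; rewrite mulf_eq0 => /orP[|/eqP//].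
have : 0 <= k.+1%:R :> R by [].
have : 1 <= k.+1%:R :> R by rewrite ler1n.
slra.
Qed.

(** The recursion for [p] is a balance of flows: [(k + delta) / theta * p k] is the rate of leaving
    degree [k], hence the growth rate of the number of vertices above [k]. At [k = m] the source
    term stands for the inflow [1]. *)
Lemma limit_tailB k : (m <= k)%N -> p k = limit_tail k.-1 - limit_tail k.
Proof.
move=> mk; case: p_law => _ /(_ k); rewrite (leq_trans m_gt0 mk) => /(_ isT).
rewrite -/theta /limit_tail [(k < m)%N]ltnNge mk /= => {1}->.
have [km|km] := eqVneq k m.
  rewrite km prednK// leqnn limit_degree_law_lt ?prednK// mulr0 add0r addrC.
  by [].
rewrite ifF; last by lia.
rewrite addr0; congr (_ / _ * _ - _).
by rewrite -[in LHS](prednK (leq_trans m_gt0 mk)) -natr1; ring.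
Qed.

Lemma limit_tail_rec k : (m <= k)%N ->
  limit_tail k = (k%:R + delta) / theta * (limit_tail k.-1 - limit_tail k).
Proof.
by move=> mk; rewrite -limit_tailB// {1}/limit_tail ltnNge mk.
Qed.

Let kD_gt0 k : (m <= k)%N -> 0 < k%:R + delta.
Proof.
move=> mk; have : m%:R <= k%:R :> R by rewrite ler_nat.
slra.
Qed.

Let limit_tail_recM k : (m <= k)%N ->
  (theta + (k%:R + delta)) * limit_tail k = (k%:R + delta) * limit_tail k.-1.
Proof.
move=> mk; have e := limit_tail_rec mk; rewrite mulrDl {1}e.
have t0 : theta != 0 by rewrite gt_eqF//; slra.
by field.
Qed.

Lemma limit_tail_gt0 k : 0 < limit_tail k.
Proof.
elim: k => [|k IH]; first by rewrite /limit_tail m_gt0.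
have [km|mk] := ltnP k.+1 m; first by rewrite /limit_tail km.
have h := kD_gt0 mk.
rewrite -(pmulr_rgt0 (x := theta + (k.+1%:R + delta))); last slra.
by rewrite limit_tail_recM// mulr_gt0.
Qed.

Lemma limit_degree_law_gt0 k : (m <= k)%N -> 0 < p k.
Proof.
move=> mk; have := limit_tail_gt0 k; rewrite {1}/limit_tail ltnNge mk /=.
rewrite pmulr_rgt0// divr_gt0 ?kD_gt0//; slra.
Qed.

(** As [theta > 1], the recursion makes [(k + 1 + delta) * limit_tail k] nonincreasing, starting
    from [m + delta] at [k = m - 1]. *)
Lemma limit_tail_bound k : (m <= k)%N ->
  limit_tail k * (k.+1%:R + delta) <= m%:R + delta.
Proof.
elim: k => [|k IH] mk; first by have := m_gt0; lia.
have h : limit_tail k.+1 * (k.+2%:R + delta) <= (k.+1%:R + delta) * limit_tail k.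
  rewrite -[limit_tail k]/(limit_tail k.+1.-1) -limit_tail_recM// mulrC.
  rewrite ler_wpM2r ?ltW ?limit_tail_gt0// -[k.+2%:R]natr1; slra.
have [mk'|mk'] := leqP m k.
  by apply: (le_trans h); rewrite mulrC IH.
have e : k.+1 = m by lia.
by apply: (le_trans h); rewrite /limit_tail mk' mulr1 e.
Qed.

Lemma limit_tail_cvg0 : limit_tail @ \oo --> (0 : R).
Proof.
apply: (@squeeze_cvgr _ _ _ _ (fun=> 0) (fun k => (m%:R + delta) / k%:R)).
- near=> k; rewrite ltW ?limit_tail_gt0//=.
  have mk : (m <= k)%N by near: k; exists m.
  have k0 : 0 < k%:R :> R by rewrite ltr0n (leq_trans m_gt0).
  rewrite ler_pdivlMr//; apply: le_trans (limit_tail_bound mk).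
  by rewrite ler_wpM2l ?ltW ?limit_tail_gt0// -natr1; slra.
- exact: cvg_cst.
- rewrite -[X in _ --> X](mulr0 (m%:R + delta)); apply: cvgM; first exact: cvg_cst.
  apply/cvgrPdist_lt => e e0; near=> k.
  rewrite sub0r normrN ger0_norm ?invr_ge0//.
  have k0 : 0 < k%:R :> R by near: k; exists 1%N => //= j; rewrite ltr0n.
  rewrite invf_plt ?posrE//.
  by near: k; apply: nbhs_infty_gtr.
Unshelve. all: by end_near. Qed.

(** The recursion [(theta + k + delta) * r k = (k + delta) * r (k - 1)], with [r] the limiting tail,
    telescopes. *)
Lemma sum_limit_tail_eq n :
  (theta - 1) * \sum_(m <= k < m + n) limit_tail k +
  ((m + n)%:R + delta) * limit_tail (m + n).-1 = m%:R + delta.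
Proof.
elim: n => [|n IH].
  by rewrite addn0 big_geq// mulr0 add0r /limit_tail prednK// leqnn mulr1.
rewrite -IH addnS big_nat_recr ?leq_addr//= mulrDr -addrA; congr (_ + _).
rewrite -(limit_tail_recM (leq_addr n m)) -natr1; ring.
Qed.

(** Dropping the boundary term leaves [(m + delta) / (theta - 1)], which is exactly [m], the number
    of choices per vertex. *)
Lemma sum_limit_tail_le K : \sum_(m <= k < K) limit_tail k <= m%:R.
Proof.
have [Km|/ltnW mK] := leqP K m; first by rewrite big_geq.
rewrite -(subnKC mK); have := sum_limit_tail_eq (K - m).
move: (kD_gt0 (leq_addr (K - m) m)) (limit_tail_gt0 (m + (K - m)).-1).
set A := \sum_(_ <= _ < _) _; set x := (m + _)%:R + _; set y := limit_tail _.
move=> x0 y0 e; have : (theta - 1) * A <= (theta - 1) * m%:R.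
  have -> : (theta - 1) * m%:R = m%:R + delta.
    by rewrite mulrBl mul1r [theta * _]mulrC m_theta; ring.
  by have := mulr_gt0 x0 y0; slra.
by rewrite ler_pM2l//; slra.
Qed.

Lemma sum_limit_degree_law n :
  \sum_(m <= k < m + n) p k = 1 - limit_tail (m + n).-1.
Proof.
elim: n => [|n IH].
  by rewrite addn0 big_geq// /limit_tail prednK// leqnn subrr.
rewrite addnS big_nat_recr ?leq_addr//= IH limit_tailB ?leq_addr//=; ring.
Qed.

Lemma sum_mul_limit_degree_law n :
  \sum_(m <= k < m + n) k%:R * p k =
  m%:R + \sum_(m <= k < m + n) limit_tail k - (m + n)%:R * limit_tail (m + n).-1.
Proof.
elim: n => [|n IH].
  by rewrite addn0 !big_geq// /limit_tail prednK// leqnn mulr1 addr0 subrr.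
rewrite addnS !big_nat_recr ?leq_addr//= IH limit_tailB ?leq_addr//= -natr1; ring.
Qed.

(** From [m] on, [limit_tail k] is [m] times the size-biased weight of degree [k]; dividing by
    [k + delta] undoes the bias and leaves an average under [p]. *)
Let limit_tail_div k (x : R) : (m <= k)%N ->
  limit_tail k / (x * (k%:R + delta)) = m%:R / (2 * m%:R + delta) * (p k / x).
Proof.
move=> mk; have h := kD_gt0 mk; rewrite /limit_tail ltnNge mk /= -m_theta.
have t0 : theta != 0 by rewrite gt_eqF//; slra.
have k0 : k%:R + delta != 0 by rewrite gt_eqF.
rewrite !invfM; move: x^-1 => y.
by field; rewrite k0 m_neq0 t0.
Qed.

(* The gap in Jensen's inequality for [1/x] under the law [p], bounded below by
   its contribution at the atom [k = m]. *)
Lemma jensen_gap (x : R) n : -1 < x ->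
  m%:R / (2 * m%:R + delta) *
    (p m * m%:R ^+ 2 / ((m%:R + x) * (2 * m%:R + x) ^+ 2)
     - 3 * limit_tail (m + n)) <=
  \sum_(m <= k < m + n.+1) limit_tail k / ((k%:R + x) * (k%:R + delta))
  - m%:R / ((2 * m%:R + x) * (2 * m%:R + delta)).
Proof.
move=> x1.
under eq_big_nat => k /andP[mk _] do rewrite limit_tail_div//.
rewrite -mulr_sumr.
have -> : m%:R / ((2 * m%:R + x) * (2 * m%:R + delta)) =
    m%:R / (2 * m%:R + delta) * (2 * m%:R + x)^-1.
  by rewrite invfM; ring.
rewrite -mulrBr; apply: ler_wpM2l; first by apply: divr_ge0; slra.
set c := 2 * m%:R + x.
have c1 : 1 < c by rewrite /c; slra.
have c0 : c != 0 by rewrite gt_eqF//; slra.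
have kx k : (m <= k)%N -> 0 < k%:R + x.
  by move=> mk; have : m%:R <= k%:R :> R by [rewrite ler_nat]; slra.
(* Tangent line of [1 / y] at [c = 2 * m + x], its argument at the mean degree [2 * m], together
   with the exact remainder, which is nonnegative. *)
have tangent k : (m <= k)%N ->
    p k / (k%:R + x) = 2 / c * p k - (k%:R * p k + x * p k) / c ^+ 2 +
      p k * (k%:R - 2 * m%:R) ^+ 2 / ((k%:R + x) * c ^+ 2).
  move=> mk; have k0 : k%:R + x != 0 by rewrite gt_eqF ?kx.
  have cc : 2 * m%:R + x != 0 by [].
  by rewrite /c; field; rewrite k0 cc.
under [X in _ <= X - _]eq_big_nat => k /andP[mk _] do rewrite tangent//.
rewrite big_split/= sumrB -mulr_sumr -mulr_suml big_split /= -mulr_sumr.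
have atom : p m * m%:R ^+ 2 / ((m%:R + x) * c ^+ 2) <=
   \sum_(m <= k < m + n.+1)
     p k * (k%:R - 2 * m%:R) ^+ 2 / ((k%:R + x) * c ^+ 2).
  rewrite big_ltn; last by rewrite addnS ltnS leq_addr.
  rewrite (_ : (m%:R - 2 * m%:R) ^+ 2 = m%:R ^+ 2 :> R); last by ring.
  rewrite lerDl big_nat; apply: sumr_ge0 => k /andP[mk _].
  apply: divr_ge0; first by rewrite mulr_ge0 ?sqr_ge0 ?ltW ?limit_degree_law_gt0// ltnW.
  by rewrite mulr_ge0 ?sqr_ge0// ltW// kx// ltnW.
rewrite sum_limit_degree_law sum_mul_limit_degree_law addnS /=.
set K := (m + n)%N; set r := limit_tail K.
have r0 : 0 < r by exact: limit_tail_gt0.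
set A := \sum_(m <= k < K.+1) limit_tail k.
have Am : A <= m%:R by exact: sum_limit_tail_le.
(* Origin of the factor 3: the mass [r] lost by truncation costs at most [2 * r] in the constant
   term of the tangent line and [r] in its linear term, because [c > 1] and [x > -1]. *)
have step : (m%:R + A - K.+1%:R * r + x * (1 - r)) / c ^+ 2 <= (c + r) / c ^+ 2.
  apply: ler_wpM2r; first by rewrite invr_ge0 sqr_ge0.
  have : 0 <= K.+1%:R * r by rewrite mulr_ge0// ltW.
  have : - x * r <= 1 * r by rewrite ler_pM2r//; slra.
  rewrite /c; slra.
have i1 : c^-1 <= 1 by rewrite invf_le1//; slra.
have i0 : 0 < c^-1 by rewrite invr_gt0; slra.
move: step; set L := _ / c ^+ 2 => step.
have e : (c + r) / c ^+ 2 = c^-1 + r * (c^-1) ^+ 2.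
  by rewrite exprVn mulrDl expr2 invfM mulrA mulfV// mul1r.
rewrite e in step.
have h1 : r * (c^-1) ^+ 2 <= r * 1.
  by rewrite ler_pM2l// expr_le1 // ltW.
have h2 : 2 / c * r <= 2 * r by rewrite ler_pM2r//; slra.
move: atom; rewrite addnS -/K => atom.
move: atom step h1 h2; rewrite mulrBr mulr1; slra.
Qed.

Lemma nu_term_limit_tail k :
  nu_term m delta p k =
  (m <= k)%N%:R * (limit_tail k / ((k%:R + delta) * (k%:R + delta))).
Proof.
have [mk|km] := leqP m k; last first.
  by rewrite /nu_term /size_biased limit_degree_law_lt// mulr0 mul0r mulr0 mul0r mul0r.
have k0 : k%:R + delta != 0 by rewrite gt_eqF ?kD_gt0.
have t0 : 2 * m%:R + delta != 0 by rewrite gt_eqF//; slra.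
rewrite mul1r limit_tail_div// /nu_term /size_biased.
by field; rewrite k0 t0.
Qed.

Lemma sum_nu_term N : (m <= N)%N ->
  \sum_(1 <= k < N) nu_term m delta p k =
  \sum_(m <= k < N) limit_tail k / ((k%:R + delta) * (k%:R + delta)).
Proof.
move=> mN; under eq_bigr do rewrite nu_term_limit_tail.
rewrite (big_cat_nat m_gt0 mN) /= big1_seq ?add0r; last first.
  by move=> k /=; rewrite mem_index_iota => /andP[_ km]; rewrite leqNgt km mul0r.
by apply: eq_big_nat => k /andP[-> _]; rewrite mul1r.
Qed.

Lemma nu_term_ge0 k : 0 <= nu_term m delta p k.
Proof.
rewrite nu_term_limit_tail mulr_ge0//; apply: divr_ge0.
  exact/ltW/limit_tail_gt0.
by rewrite -expr2 sqr_ge0.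
Qed.

Lemma is_cvg_nu : cvgn (fun N => \sum_(1 <= k < N) nu_term m delta p k).
Proof.
apply: nondecreasing_is_cvgn.
  by apply/nondecreasing_seqP => -[|n]; [rewrite !big_geq|
    rewrite [leRHS]big_nat_recr//= lerDl nu_term_ge0].
exists (m%:R / (m%:R + delta) ^+ 2) => _ [N _ <-].
have md : 0 < m%:R + delta by slra.
apply: (@le_trans _ _ (\sum_(1 <= k < m + N) nu_term m delta p k)).
  have [N0|N1] := posnP N; first by rewrite N0 big_geq// sumr_ge0// => k _;
    exact: nu_term_ge0.
  rewrite (big_cat_nat N1 (leq_addl m N)) /= lerDl sumr_ge0// => k _.
  exact: nu_term_ge0.
rewrite sum_nu_term ?leq_addr//.
apply: (@le_trans _ _ (\sum_(m <= k < m + N) limit_tail k / (m%:R + delta) ^+ 2)).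
  rewrite big_nat [in leRHS]big_nat; apply: ler_sum => k /andP[mk _].
  apply: ler_wpM2l; first exact/ltW/limit_tail_gt0.
  rewrite lef_pV2 ?posrE ?mulr_gt0 ?exprn_gt0 ?kD_gt0//.
  have : m%:R <= k%:R :> R by rewrite ler_nat.
  by move=> h; rewrite expr2 ler_pM//; slra.
by rewrite -mulr_suml ler_wpM2r ?sum_limit_tail_le// invr_ge0 sqr_ge0.
Qed.

Lemma cvg_nu : (fun n => \sum_(m <= k < m + n.+1)
     limit_tail k / ((k%:R + delta) * (k%:R + delta))
     - m%:R / (2 * m%:R + delta) ^+ 2) @ \oo --> nu m delta p.
Proof.
apply: cvgB; last exact: cvg_cst.
have := is_cvg_nu; rewrite -(cvg_shiftn (m.+1)) => h.
apply: cvg_trans h; apply: near_eq_cvg; near=> n.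
by rewrite /= sum_nu_term addnC ?addSnnS// leq_addr.
Unshelve. all: by end_near. Qed.

(** Take [x = delta] in [jensen_gap] and let the truncation level grow: the contribution of the atom
    [k = m] survives and is positive. *)
Lemma nu_gt0 : 0 < nu m delta p.
Proof.
set g := m%:R / (2 * m%:R + delta) *
  (p m * m%:R ^+ 2 / ((m%:R + delta) * (2 * m%:R + delta) ^+ 2)).
have g0 : 0 < g.
  rewrite /g; have := limit_degree_law_gt0 (leqnn m) => pm.
  apply: mulr_gt0; first by apply: divr_gt0; slra.
  apply: divr_gt0; first by rewrite mulr_gt0// exprn_gt0//; slra.
  by apply: mulr_gt0; [|rewrite exprn_gt0//]; slra.
apply: (lt_le_trans g0).
have hg : (fun n => m%:R / (2 * m%:R + delta) *
    (p m * m%:R ^+ 2 / ((m%:R + delta) * (2 * m%:R + delta) ^+ 2)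
     - 3 * limit_tail (m + n))) @ \oo --> g.
  have -> : g = m%:R / (2 * m%:R + delta) *
    (p m * m%:R ^+ 2 / ((m%:R + delta) * (2 * m%:R + delta) ^+ 2) - 3 * 0).
    by rewrite mulr0 subr0.
  apply: cvgM; first exact: cvg_cst.
  apply: cvgB; first exact: cvg_cst.
  apply: cvgM; first exact: cvg_cst.
  have := limit_tail_cvg0; rewrite -(cvg_shiftn m).
  by under eq_fun do rewrite addnC.
apply: (ler_cvg_to hg cvg_nu); near=> n.
by have := jensen_gap n delta_gt; rewrite -[_ * (2 * m%:R + delta)]expr2.
Unshelve. all: by end_near. Qed.

End limit_tail.

(** * Law of large numbers for the degree counts *)

Section choice_sum_theory.
Context {R : realType}.
Variable m : nat.
Hypothesis m_gt0 : (0 < m)%N.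
Implicit Types (f : nat -> R) (g : network).

Definition num_gt (k s : nat) (g : network) : R :=
  \sum_(v < new_vertex m s) ((k < degree g v)%N)%:R.

Lemma choice_sumD s f1 f2 g :
  choice_sum m s (fun k => f1 k + f2 k) g = choice_sum m s f1 g + choice_sum m s f2 g.
Proof.
by rewrite /choice_sum -big_split; apply: eq_bigr => v _; rewrite big_split.
Qed.

Lemma choice_sumZ s c f g :
  choice_sum m s (fun k => c * f k) g = c * choice_sum m s f g.
Proof.
by rewrite /choice_sum mulr_sumr; apply: eq_bigr => v _; rewrite mulr_sumr.
Qed.

Lemma eq_choice_sum s f1 f2 g : (forall k, (m <= k)%N -> f1 k = f2 k) ->
  choice_sum m s f1 g = choice_sum m s f2 g.
Proof.
move=> h; apply: eq_bigr => v _; rewrite !big_nat; apply: eq_bigr => k.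
by case/andP => mk _; exact: h.
Qed.

Lemma le_choice_sum s f1 f2 g : (forall k, (m <= k)%N -> f1 k <= f2 k) ->
  choice_sum m s f1 g <= choice_sum m s f2 g.
Proof.
move=> h; apply: ler_sum => v _; rewrite !big_nat; apply: ler_sum => k.
by case/andP => mk _; exact: h.
Qed.

Lemma choice_sum1 s g : valid_net m s g -> choice_sum m s (fun=> 1) g = s%:R :> R.
Proof.
case=> h1 _ _ h2; rewrite /choice_sum.
under eq_bigr do rewrite sumr_const_nat.
rewrite -natr_sum; congr (_%:R); apply/eqP.
rewrite -(eqn_add2r (m * new_vertex m s)) -h2 mulnC -[in X in (_ + X)%N](card_ord (new_vertex m s)).
rewrite -sum_nat_const -big_split; apply/eqP/eq_bigr => v _ /=.
by rewrite subnK// h1.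
Qed.

Lemma norm_choice_sum_le s f e g : valid_net m s g ->
  (forall k, (m <= k)%N -> `|f k| <= e) -> `|choice_sum m s f g| <= e * s%:R.
Proof.
move=> hg h; rewrite -(choice_sum1 hg) -choice_sumZ ler_norml -mulN1r -choice_sumZ.
by apply/andP; split; apply: le_choice_sum => k /h; rewrite ler_norml => /andP[]; lra.
Qed.

(** Exchanging the two sums expresses a truncated choice sum by finitely many tail counts, to which
    the law of large numbers applies. *)
Lemma choice_sum_trunc s f K g :
  choice_sum m s (fun k => (k < K)%N%:R * f k) g =
  \sum_(m <= k < K) f k * num_gt k s g.
Proof.
rewrite /choice_sum /num_gt; under [RHS]eq_bigr do rewrite mulr_sumr.
rewrite exchange_big /=; apply: eq_bigr => v _.
set d := degree g v.
have e (a b : nat) (F : nat -> R) : \sum_(m <= k < a) (k < b)%N%:R * F k =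
    \sum_(m <= k < maxn a b | (k < a)%N && (k < b)%N) F k.
  rewrite (big_nat_widen m a (maxn a b)) ?leq_maxl// [RHS]big_mkcondr /=.
  by apply: eq_bigr => k _; case: (k < b)%N; rewrite ?mul1r ?mul0r.
rewrite e; under [RHS]eq_bigr do rewrite mulrC.
by rewrite e maxnC; apply: eq_bigl => k; rewrite andbC.
Qed.

Lemma num_gtE k s g : (m <= k)%N ->
  num_gt k s g = choice_sum m s (fun i => (i == k)%:R) g.
Proof.
move=> mk; transitivity (choice_sum (R := R) m s (fun i => (i < k.+1)%N%:R * (i == k)%:R) g).
  rewrite choice_sum_trunc big_nat_recr//= eqxx mul1r big1_seq ?add0r// => i /=.
  by rewrite mem_index_iota => /andP[_ ik]; rewrite ltn_eqF// mul0r.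
by apply: eq_choice_sum => i _; case: eqP => [->|_]; rewrite ?ltnSn ?mulr1 ?mulr0.
Qed.

Lemma num_gt_rcons k s g j : (m <= k)%N -> valid_net m s g ->
  (j < new_vertex m s)%N ->
  num_gt k s.+1 (rcons g (new_vertex m s, j)) = num_gt k s g + (degree g j == k)%:R.
Proof. by move=> mk hg hj; rewrite !num_gtE// choice_sum_rcons. Qed.

Lemma num_gt_ge0 k s g : 0 <= num_gt k s g.
Proof. exact: sumr_ge0. Qed.

Lemma num_gt_le k s g : num_gt k s g <= (new_vertex m s)%:R.
Proof.
rewrite -[leRHS](_ : \sum_(v < new_vertex m s) 1 = _).
  by apply: ler_sum => v _; case: (_ < _)%N.
by rewrite sumr_const card_ord.
Qed.

Lemma num_gt_predm s g : valid_net m s g -> num_gt m.-1 s g = (new_vertex m s)%:R.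
Proof.
case=> h _ _ _; rewrite /num_gt -[RHS](_ : \sum_(v < new_vertex m s) 1 = _).
  by apply: eq_bigr => v _; rewrite prednK ?h.
by rewrite sumr_const card_ord.
Qed.

Lemma sum_degree_eq k s g : (0 < k)%N ->
  \sum_(v < new_vertex m s) (degree g v == k)%:R =
  num_gt k.-1 s g - num_gt k s g.
Proof.
move=> k0; rewrite /num_gt -sumrB; apply: eq_bigr => v _; rewrite prednK//.
by case: ltngtP; rewrite /= ?subr0 ?subrr.
Qed.

Lemma new_vertex_bounds s :
  m%:R * ((new_vertex m s)%:R - 2) <= s%:R :> R /\
  s%:R + 1 <= m%:R * ((new_vertex m s)%:R - 1) :> R.
Proof.
have h := divn_eq s m; have h2 := ltn_pmod s m_gt0.
rewrite /new_vertex -addn2 natrD addrK; split.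
  by rewrite -natrM ler_nat; lia.
have -> : (s %/ m)%:R + 2 - 1 = (s %/ m).+1%:R :> R by rewrite -natr1; ring.
by rewrite natr1 -natrM ler_nat; nia.
Qed.

Lemma edge_weight_ge (delta : R) s :
  (m%:R + delta) * (new_vertex m s)%:R <= edge_weight m s delta.
Proof. by rewrite /edge_weight lerDr. Qed.

Lemma edge_weight_geS s (delta : R) : -1 < delta ->
  (m%:R + delta) * s.+1%:R <= m%:R * edge_weight m s delta.
Proof.
move=> d1; have m1 : 1 <= m%:R :> R by rewrite ler1n.
have md : 0 < m%:R + delta by lra.
have [_ h2] := new_vertex_bounds s.
rewrite /edge_weight -natr1.
have : (m%:R + delta) * (s%:R + 1) <=
   (m%:R + delta) * (m%:R * ((new_vertex m s)%:R - 1)) by rewrite ler_pM2l.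
have : 0 <= m%:R * s%:R :> R by rewrite mulr_ge0.
have : 0 <= (m%:R + delta) * m%:R by rewrite mulr_ge0// ltW.
by lra.
Qed.

End choice_sum_theory.

Section law_of_large_numbers.
Context {d : measure_display} {T : measurableType d} {R : realType}.
Variable P : probability T R.
Variables (m : nat) (delta0 : R) (J : nat -> nat -> {RV P >-> nat}).
Variable p : nat -> R.
Hypothesis m_gt0 : (0 < m)%N.
Hypothesis delta0_gt : -1 < delta0.
Hypothesis hJ : pref_attachment m delta0 J.
Hypothesis p_law : limit_degree_law m delta0 p.

Local Notation r := (limit_tail m delta0 p).
Local Notation E := (expect m J).

(** Centred with [s / m] instead of the number of vertices, so that the centre moves by the same
    constant [r k / m] at every step; the two differ by at most 2. *)
Definition tail_dev k s g : R := num_gt m k s g - r k * (s%:R / m%:R).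

Let m_ge1 : 1 <= m%:R :> R. Proof. by rewrite ler1n. Qed.

Lemma limit_tail_le1 k : r k <= 1.
Proof.
elim: k => [|k IH]; first by rewrite /limit_tail m_gt0.
have [km|mk] := ltnP k.+1 m; first by rewrite /limit_tail km.
have := limit_tailB m_gt0 delta0_gt p_law mk.
have := limit_degree_law_gt0 m_gt0 delta0_gt p_law mk => /=; lra.
Qed.

Lemma norm_tail_dev_le k s g : `|tail_dev k s g| <= (new_vertex m s)%:R.
Proof.
rewrite /tail_dev; have [h1 h2] := new_vertex_bounds (R := R) m_gt0 s.
have n0 := num_gt_ge0 (R := R) m k s g; have n1 := num_gt_le (R := R) m k s g.
have r0 := limit_tail_gt0 m_gt0 delta0_gt p_law k; have r1 := limit_tail_le1 k.
have sm0 : 0 <= s%:R / m%:R :> R by rewrite divr_ge0.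
have sm : s%:R / m%:R <= (new_vertex m s)%:R :> R.
  by rewrite ler_pdivrMr ?ltr0n//; move: m_ge1; lra.
have : r k * (s%:R / m%:R) <= 1 * (s%:R / m%:R) by rewrite ler_wpM2r.
have : 0 <= r k * (s%:R / m%:R) by rewrite mulr_ge0// ltW.
by move=> a1 a2; rewrite ler_norml; apply/andP; split; lra.
Qed.

Lemma cond_expect_degree_eq k s g : (m <= k)%N -> valid_net m s g ->
  cond_expect m delta0 s g (fun j => (degree g j == k)%:R) =
  (k%:R + delta0) / edge_weight m s delta0 * (num_gt m k.-1 s g - num_gt m k s g).
Proof.
move=> mk hg; rewrite -sum_degree_eq ?(leq_trans m_gt0)// mulr_sumr.
apply: eq_bigr => j _; case: eqP => [->//|_]; by rewrite !mulr0.
Qed.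

(* With [H_k = tail_dev k] and total weight [S], the conditional mean of the
   increment of [H_k] is [(k + delta0) / S * (H_{k-1} - H_k) + O(1 / S)], and
   [2 H_k (H_{k-1} - H_k) <= H_{k-1}^2 - H_k^2]; hence [E H_k^2 = O(s)] by
   induction on [k], with no need for the compensator martingale. *)
Lemma drift_tail_dev k s g : (m <= k)%N -> valid_net m s g ->
  cond_expect m delta0 s g
    (fun j => tail_dev k s.+1 (rcons g (new_vertex m s, j)) ^+ 2) <=
  tail_dev k s g ^+ 2 +
  (k%:R + delta0) / edge_weight m s delta0 * tail_dev k.-1 s g ^+ 2 + 5.
Proof.
move=> mk hg.
set w := edge_weight m s delta0; set H := tail_dev k s g; set H' := tail_dev k.-1 s g.
have w0 : 0 < w by exact: edge_weight_gt0.
have m0 : 0 < m%:R :> R by rewrite ltr0n.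
have mn0 : m%:R != 0 :> R by rewrite gt_eqF.
have r0 := limit_tail_gt0 m_gt0 delta0_gt p_law k; have r1 := limit_tail_le1 k.
set c := r k / m%:R.
have c0 : 0 <= c by rewrite divr_ge0// ltW.
have c1 : c <= 1 by rewrite ler_pdivrMr//; move: m_ge1; lra.
have kd : 0 < k%:R + delta0.
  have : m%:R <= k%:R :> R by rewrite ler_nat.
  by move: m_ge1 delta0_gt; lra.
apply: (@le_trans _ _ (cond_expect m delta0 s g
    (fun j => (H ^+ 2 - 2 * H * c + 1) + 2 * H * (degree g j == k)%:R))).
  apply: cond_expect_le => // j hj.
  rewrite /tail_dev num_gt_rcons//.
  have -> : num_gt m k s g + (degree g j == k)%:R - r k * (s.+1%:R / m%:R) =
     H + ((degree g j == k)%:R - c).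
    by rewrite /H /tail_dev /c -natr1; field.
  have : ((degree g j == k)%:R - c) ^+ 2 <= 1 by case: eqP => _ /=; nra.
  by move: (_ == k)%:R => x; nra.
rewrite cond_expectD cond_expect_cst// cond_expectZ cond_expect_degree_eq//.
rewrite -/w.
have [h1 h2] := new_vertex_bounds (R := R) m_gt0 s.
set t := (new_vertex m s)%:R : R.
have wE : w = s%:R + (m%:R + delta0) * t by [].
have rec := limit_tail_rec m_gt0 delta0_gt p_law mk.
have theta0 : 2 + delta0 / m%:R != 0.
  rewrite gt_eqF// -(pmulr_rgt0 _ m0) mulrDr mulrCA mulfV// mulr1.
  by move: m_ge1 delta0_gt; lra.
have rec' : (2 * m%:R + delta0) * c = (k%:R + delta0) * (r k.-1 - r k).
  rewrite /c {1}rec; move: (r k.-1) (r k) => x y.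
  by field; rewrite mn0 /=; move: theta0; rewrite -(mulrI_eq0 _ (lregP mn0)) mulrDr
    mulrCA mulfV// mulr1 mulrC.
have eq1 : num_gt m k.-1 s g - num_gt m k s g =
    (H' - H) + (r k.-1 - r k) * (s%:R / m%:R).
  by rewrite /H' /H /tail_dev; ring.
have nH : `|H| <= t by exact: norm_tail_dev_le.
(* By [rec'] the drift at the centre is the speed [c] of the centre itself. What remains is a
   contraction towards [H'] and an error from replacing the number of vertices by [s / m]. *)
have eq2 : 2 * H * ((k%:R + delta0) / w * (num_gt m k.-1 s g - num_gt m k s g)) =
   (k%:R + delta0) / w * (2 * H * H' - 2 * H ^+ 2) + 2 * H * c +
   2 * (H / w) * (c * (m%:R + delta0) * (s%:R / m%:R - t)).
  have wn : w != 0 by rewrite gt_eqF.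
  rewrite eq1.
  transitivity ((k%:R + delta0) / w * (2 * H * H' - 2 * H ^+ 2) +
    2 * (H / w) * ((k%:R + delta0) * (r k.-1 - r k)) * (s%:R / m%:R)).
    by ring.
  rewrite -rec'; rewrite -addrA; congr (_ + _).
  have -> : 2 * H * c = 2 * (H / w) * (c * w) by field.
  rewrite wE; field; rewrite mn0 -wE; exact: wn.
rewrite eq2.
have smt : `|s%:R / m%:R - t| <= 2.
  have a1 : m%:R * (s%:R / m%:R) = s%:R :> R by field.
  have a2 : t - 2 <= s%:R / m%:R by rewrite -(ler_pM2l m0) a1.
  have a3 : s%:R / m%:R <= t by rewrite -(ler_pM2l m0) a1 /t; lra.
  by rewrite ler_norml; apply/andP; split; lra.
have Hw : `|H / w| * (m%:R + delta0) <= 1.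
  rewrite normrM normfV (gtr0_norm w0) mulrAC ler_pdivrMr// mul1r.
  have md : 0 < m%:R + delta0 by move: m_ge1 delta0_gt; lra.
  apply: (@le_trans _ _ (t * (m%:R + delta0))); first by rewrite ler_pM2r.
  by rewrite wE mulrC lerDr.
clearbody c H H' w t.
(* The constant 5 of the lemma is this 4 plus the 1 that bounds the square of the centred
   increment. *)
have err : 2 * (H / w) * (c * (m%:R + delta0) * (s%:R / m%:R - t)) <= 4.
  apply: le_trans (ler_norm _) _.
  have md : 0 < m%:R + delta0 by move: m_ge1 delta0_gt; lra.
  rewrite !normrM (ger0_norm c0) (gtr0_norm md) normr_nat.
  move: Hw; rewrite normrM; set a := `|H| * `|w^-1|; move: smt; set b := `|_ - t|.
  move=> smt Hw.
  have -> : 2 * a * (c * (m%:R + delta0) * b) = 2 * ((a * (m%:R + delta0)) * (c * b)).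
    by ring.
  have b0 : 0 <= b by exact: normr_ge0.
  have am0 : 0 <= a * (m%:R + delta0) by apply: mulr_ge0;
    [apply: mulr_ge0 | exact: ltW].
  have cb : c * b <= 2 by rewrite -[leRHS]mul1r ler_pM.
  have cb0 : 0 <= c * b by rewrite mulr_ge0.
  have : a * (m%:R + delta0) * (c * b) <= 1 * 2 by rewrite ler_pM.
  lra.
have kw : 0 <= (k%:R + delta0) / w by rewrite divr_ge0 ?ltW.
have : (k%:R + delta0) / w * (2 * H * H' - 2 * H ^+ 2) <= (k%:R + delta0) / w * H' ^+ 2.
  by rewrite ler_wpM2l//; have := sqr_ge0 (H - H'); have := sqr_ge0 H; lra.
lra.
Qed.

Lemma expect_tail_dev_sqr n : exists2 C, 0 <= C & forall s,
  E s (fun g => tail_dev (m.-1 + n) s g ^+ 2) <= C * s.+1%:R.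
Proof.
elim: n => [|n [C C0 IH]].
  (* For [k = m - 1] all eligible vertices are counted, so the deviation is deterministic and lies
     between 0 and 2. *)
  exists 4 => // s; rewrite addn0 -(expect_cst m_gt0 hJ s (4 * s.+1%:R)).
  apply: expect_le => // g hg.
  rewrite /tail_dev num_gt_predm// /limit_tail prednK// leqnn mul1r.
  have [h1 h2] := new_vertex_bounds (R := R) m_gt0 s.
  have m0 : 0 < m%:R :> R by rewrite ltr0n.
  have e : m%:R * (s%:R / m%:R) = s%:R :> R by rewrite mulrCA mulfV ?mulr1// gt_eqF.
  have a1 : (new_vertex m s)%:R - s%:R / m%:R <= 2 :> R.
    by rewrite -(ler_pM2l m0); lra.
  have a2 : 0 <= (new_vertex m s)%:R - s%:R / m%:R :> R.
    by rewrite -(ler_pM2l m0) mulr0; move: m_ge1; lra.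
  have : 1 <= s.+1%:R :> R by rewrite ler1n.
  by nra.
rewrite addnS; set k := (m.-1 + n).+1.
have mk : (m <= k)%N by rewrite /k; lia.
have kd : 0 < k%:R + delta0.
  have : m%:R <= k%:R :> R by rewrite ler_nat.
  by move: m_ge1 delta0_gt; lra.
have md : 0 < m%:R + delta0 by move: m_ge1 delta0_gt; lra.
(* The drift coefficient [(k + delta0) / edge_weight] is [O(1 / s.+1)] by [edge_weight_geS]; against
   the bound [C * s.+1] for the previous [k] it adds a constant per step. *)
pose C' := (k%:R + delta0) * (m%:R / (m%:R + delta0)) * C + 5.
have C'0 : 0 <= C'.
  by rewrite addr_ge0// !mulr_ge0// ?ltW// invr_gt0.
exists C' => //; elim=> [|s IHs].
  rewrite (expect0 m_gt0 hJ) /tail_dev num_gtE// choice_sum0 mul0r mulr0 subr0 expr0n /=.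
  by rewrite mulr1.
rewrite (expectS m_gt0 hJ); apply: le_trans (expect_le J m_gt0 (fun g hg => drift_tail_dev mk hg)) _.
rewrite expectD expectD (expect_cst m_gt0 hJ) expectZ -[s.+2%:R]natr1 mulrDr mulr1.
rewrite -addrA; apply: lerD => //; rewrite lerD2r.
have w0 := edge_weight_gt0 s m_gt0 delta0_gt.
rewrite -[k.-1]/(m.-1 + n)%N -!mulrA; apply: ler_wpM2l; first exact: ltW.
rewrite mulrCA ler_pdivrMl//.
apply: le_trans (IH s) _.
rewrite (_ : _ * (_ * (_ * C)) = C * (edge_weight m s delta0 * m%:R / (m%:R + delta0)));
  last by ring.
apply: ler_wpM2l => //; rewrite ler_pdivlMr// mulrC [leRHS]mulrC.
exact: edge_weight_geS.
Qed.

Lemma expect_norm_tail_dev k : (m <= k)%N -> exists2 C, 0 <= C & forall s,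
  E s (fun g => `|tail_dev k s g|) <= C * Num.sqrt s.+1%:R.
Proof.
move=> mk; have [C C0 h] := expect_tail_dev_sqr (k - m.-1).
rewrite subnKC ?(leq_trans (leq_pred m))// in h.
exists (1 + C) => [|s]; first by rewrite addr_ge0.
set q := Num.sqrt _.
have q0 : 0 < q by rewrite sqrtr_gt0 ltr0n.
have q2 : q ^+ 2 = s.+1%:R by rewrite sqr_sqrtr.
(* The inequality [|h| <= q + h ^ 2 / q] takes the place of Cauchy-Schwarz. *)
apply: (@le_trans _ _ (E s (fun g => q + q^-1 * tail_dev k s g ^+ 2))).
  apply: expect_le => // g _.
  rewrite -(ler_pM2l q0) mulrDr mulrA mulfV ?gt_eqF// mul1r.
  rewrite -[X in _ <= _ + X]real_normK ?num_real//.
  by have := normr_ge0 (tail_dev k s g); nra.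
rewrite expectD (expect_cst m_gt0 hJ) expectZ mulrDl mul1r lerD2l.
by rewrite ler_pdivrMl// mulrCA -expr2 q2.
Qed.

Definition total_dev n s g : R := \sum_(m <= k < m + n) `|tail_dev k s g|.

Lemma total_dev_ge0 n s g : 0 <= total_dev n s g.
Proof. exact: sumr_ge0. Qed.

Lemma expect_total_dev n : exists2 C, 0 <= C & forall s,
  E s (total_dev n s) <= C * Num.sqrt s.+1%:R.
Proof.
elim: n => [|n [C C0 IH]].
  exists 0 => // s; rewrite mul0r -[leRHS](expect_cst m_gt0 hJ s 0).
  by apply: expect_le => // g _; rewrite /total_dev addn0 big_geq.
have [C' C'0 h] := expect_norm_tail_dev (leq_addr n m).
exists (C + C') => [|s]; first exact: addr_ge0.
rewrite mulrDl; apply: le_trans (lerD (IH s) (h s)); rewrite -expectD.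
apply: expect_le => // g _.
by rewrite /total_dev addnS big_nat_recr ?leq_addr.
Qed.

(** A bound for each single network: randomness enters only through [total_dev], and degrees from
    [m + n] on cost at most [e] for each of the [s] choices. It serves both the conditional variance
    and the curvature, the latter uniformly in the parameter. *)
Lemma choice_sum_approx n s (f : nat -> R) (B e : R) g : valid_net m s g ->
  (forall k, (m <= k < m + n)%N -> `|f k| <= B) ->
  (forall k, (m + n <= k)%N -> `|f k| <= e) -> 0 <= e ->
  `|choice_sum m s f g - s%:R / m%:R * \sum_(m <= k < m + n) f k * r k| <=
  B * total_dev n s g + e * s%:R.
Proof.
move=> hg fB fe e0.
have -> : choice_sum m s f g =
  choice_sum m s (fun k => (k < m + n)%N%:R * f k) g +
  choice_sum m s (fun k => (m + n <= k)%N%:R * f k) g.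
  rewrite -choice_sumD; apply: eq_choice_sum => k _.
  by case: ltnP; rewrite ?mul1r ?mul0r ?addr0 ?add0r.
rewrite choice_sum_trunc addrAC; apply: le_trans (ler_normD _ _) _; apply: lerD;
  last first.
  apply: norm_choice_sum_le => // k _.
  by case: leqP => [/fe|]; rewrite ?mul1r ?mul0r ?normr0.
rewrite mulr_sumr -sumrB /total_dev mulr_sumr.
apply: le_trans (ler_norm_sum _ _ _) _.
rewrite big_nat [leRHS]big_nat; apply: ler_sum => k hk.
have -> : f k * num_gt m k s g - s%:R / m%:R * (f k * r k) = f k * tail_dev k s g.
  by rewrite /tail_dev; ring.
by rewrite normrM ler_wpM2r// fB.
Qed.

End law_of_large_numbers.

(** * Central limit theorem for the score *)

Section taylor.
Context {R : realType}.
Implicit Types a b x y : R.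

Lemma mean_value (G G' : R -> R) a b : a <= b ->
  (forall x, a <= x <= b -> is_derive x 1 G (G' x)) ->
  exists2 c, a <= c <= b & G b - G a = G' c * (b - a).
Proof.
move=> ab h; have [||c] := @MVT_segment R G G' a b ab.
- by move=> x; rewrite in_itv /= => /andP[/ltW ax /ltW xb]; apply: h; rewrite ax.
- apply: derivable_within_continuous => x; rewrite in_itv /= => xab.
  by have [] := h _ xab.
- by rewrite in_itv /= => cab e; exists c.
Qed.

Lemma mean_value_between (G G' : R -> R) a b :
  (forall x, Num.min a b <= x <= Num.max a b -> is_derive x 1 G (G' x)) ->
  exists2 c, Num.min a b <= c <= Num.max a b & G b - G a = G' c * (b - a).
Proof.
case: (leP a b) => [ab|/ltW ba] h.
  exact: mean_value.
have [c hc e] := mean_value ba h.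
by exists c => //; rewrite -opprB e -mulrN opprB.
Qed.

(** Integrates a power bound on the derivative. The factorials of a Taylor remainder are given up,
    as only the order matters. *)
Lemma mean_value_pow (G G' : R -> R) C n : G 0 = 0 ->
  (forall x, is_derive x 1 G (G' x)) -> (forall x, `|G' x| <= C * `|x| ^+ n) ->
  forall x, `|G x| <= C * `|x| ^+ n.+1.
Proof.
move=> G0 dG hG x.
have [c hc] := @mean_value_between G G' 0 x (fun y _ => dG y).
rewrite G0 !subr0 => ->; rewrite normrM exprS mulrCA mulrC ler_wpM2l//.
apply: le_trans (hG c) _.
have C0 : 0 <= C.
  by have := le_trans (normr_ge0 _) (hG 1); rewrite normr1 expr1n mulr1.
apply: ler_wpM2l => //; apply: lerXn2r; rewrite ?nnegrE//.
move: hc; case: (leP 0 x) => [x0 /andP[c0 cx]|x0 /andP[xc c0]].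
  by rewrite !ger0_norm.
by rewrite !ler0_norm ?lerN2// ltW.
Qed.

Lemma lipschitz_of_deriv (G G' : R -> R) C a b :
  (forall x, Num.min a b <= x <= Num.max a b -> is_derive x 1 G (G' x)) ->
  (forall x, Num.min a b <= x <= Num.max a b -> `|G' x| <= C) ->
  `|G b - G a| <= C * `|b - a|.
Proof.
move=> dG hG; have [c hc ->] := mean_value_between dG.
by rewrite normrM ler_wpM2r// hG.
Qed.

End taylor.

Section gaussian_step.
Context {R : realType}.
Implicit Types a b x y z k u v w e tau h : R.
Variables (F f : R -> R) (kappa B : R).
Hypothesis kappa_gt0 : 0 < kappa.
Hypothesis dF : forall x, is_derive x 1 F (f x).
Hypothesis df : forall x, is_derive x 1 f (- kappa * (x * f x)).
Hypothesis f_ge0 : forall x, 0 <= f x.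
Hypothesis f_decay : forall x, (1 + x ^+ 4) * f x <= B.

(** The second derivative of [F] is [- kappa * eta], and [eta'] is the derivative of [eta]. Here [f]
    behaves as a centred Gaussian density of variance [1 / kappa]. *)
Let eta x := x * f x.
Let eta' x := f x - kappa * (x ^+ 2 * f x).

Let B_ge0 : 0 <= B.
Proof. by apply: le_trans (f_decay 0); rewrite mulr_ge0// expr0n addr0. Qed.

Let decay n x : (n <= 4)%N -> `|x ^+ n * f x| <= B.
Proof.
move=> n4; apply: le_trans (f_decay x).
rewrite normrM (ger0_norm (f_ge0 x)) ler_wpM2r// normrX.
have -> : x ^+ 4 = `|x| ^+ 4 by rewrite -normrX ger0_norm// exprn_even_ge0.
have [x1|/ltW x1] := leP `|x| 1.
  by apply: (@le_trans _ _ 1); rewrite ?exprn_ile1// lerDl exprn_ge0.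
by apply: (@le_trans _ _ (`|x| ^+ 4)); rewrite ?ler_weXn2l// lerDr.
Qed.

Let deta x : is_derive x 1 eta (eta' x).
Proof.
have := dF x; have := df x => h1 h2.
apply: is_derive_eq.
rewrite /eta' /GRing.scale /=; ring.
Qed.

Let eta_bound x : `|eta x| <= B.
Proof. by have := @decay 1 x isT; rewrite expr1. Qed.

Let eta'_bound x : `|eta' x| <= (1 + kappa) * B.
Proof.
apply: le_trans (ler_normB _ _) _; rewrite mulrDl mul1r lerD//.
  by have := @decay 0 x isT; rewrite expr0 mul1r.
rewrite normrM (gtr0_norm kappa_gt0) ler_pM2l//; exact: decay.
Qed.

Let eta_lip x y : `|eta y - eta x| <= (1 + kappa) * B * `|y - x|.
Proof.
by apply: (@lipschitz_of_deriv _ eta eta') => z _; [exact: deta | exact: eta'_bound].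
Qed.

Let taylor3 z k :
  `|F (z + k) - F z - k * f z + 2^-1 * kappa * eta z * k ^+ 2| <=
  kappa * ((1 + kappa) * B) * `|k| ^+ 3.
Proof.
(* [G1] and [G2] are the first two derivatives of [G]. All three vanish at [0] and [G2] is
   Lipschitz, so two uses of [mean_value_pow] give the cubic bound. *)
pose G k := F (z + k) - F z - k * f z + 2^-1 * kappa * eta z * k ^+ 2.
pose G1 k := f (z + k) - f z + kappa * eta z * k.
pose G2 k := - kappa * eta (z + k) + kappa * eta z.
have dshift (x : R) : is_derive x 1 (fun k => z + k) 1.
  by apply: is_derive_eq; rewrite add0r mulr1.
have dG x : is_derive x 1 G (G1 x).
  have := @is_derive1_comp R F (fun k => z + k) x (f (z + x)) 1 (dF _) (dshift x).
  rewrite mulr1 => h; apply: is_derive_eq.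
  by rewrite /G1 /GRing.scale /=; field.
have dG1 x : is_derive x 1 G1 (G2 x).
  have := @is_derive1_comp R f (fun k => z + k) x _ 1 (df (z + x)) (dshift x).
  rewrite mulr1 => h; apply: is_derive_eq.
  by rewrite /G2 /eta /GRing.scale /=; ring.
apply: (@mean_value_pow _ G G1 _ 2 _ dG) => [|{}k].
  by rewrite /G addr0 subrr mul0r expr0n mulr0 subr0 addr0.
apply: (@mean_value_pow _ G1 G2 _ 1 _ dG1) => [|{}k].
  by rewrite /G1 addr0 subrr mulr0 addr0.
rewrite /G2 expr1 mulNr addrC -mulrBr normrM (gtr0_norm kappa_gt0) -mulrA.
rewrite ler_pM2l//; apply: le_trans (eta_lip _ _) _.
by rewrite opprD addrA subrr sub0r normrN.
Qed.

Let dscale (x u : R) : 0 < u ->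
  is_derive u 1 (fun u => x / Num.sqrt u) (- 2^-1 * (x / Num.sqrt u) / u).
Proof.
move=> u0; have s0 : 0 < Num.sqrt u by rewrite sqrtr_gt0.
have h := is_derive1_sqrt u0.
have sn0 : Num.sqrt u != 0 by rewrite gt_eqF.
have := is_deriveV sn0 h => h'.
apply: is_derive_eq.
rewrite /GRing.scale /= -{4}(sqr_sqrtr (ltW u0)); field.
by rewrite sn0.
Qed.

Let dF_scale (x u : R) : 0 < u ->
  is_derive u 1 (fun u => F (x / Num.sqrt u)) (- 2^-1 * (eta (x / Num.sqrt u) / u)).
Proof.
move=> u0.
have := @is_derive1_comp R F (fun u => x / Num.sqrt u) u _ _ (dF _) (dscale x u0).
by move=> h; apply: is_derive_eq; rewrite /eta; ring.
Qed.

Let deta_scale (x u : R) : 0 < u ->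
  is_derive u 1 (fun u => eta (x / Num.sqrt u) / u)
   (- (2^-1 * (x / Num.sqrt u * eta' (x / Num.sqrt u)) + eta (x / Num.sqrt u)) / u ^+ 2).
Proof.
move=> u0; have un0 : u != 0 by rewrite gt_eqF.
have h := @is_derive1_comp R eta (fun u => x / Num.sqrt u) u _ _ (deta _) (dscale x u0).
have h2 := @is_deriveV R id u 1 1 un0 (is_derive_id u 1).
apply: is_derive_eq.
by rewrite /GRing.scale /=; field; rewrite un0 gt_eqF// sqrtr_gt0.
Qed.

Let eta_scale_lip (e x u v : R) : 0 < e -> e <= u -> e <= v ->
  `|eta (x / Num.sqrt v) / v - eta (x / Num.sqrt u) / u| <=
  (2^-1 * ((1 + kappa) * B) + B) / e ^+ 2 * `|v - u|.
Proof.
move=> e0 eu ev.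
have ge w : Num.min u v <= w <= Num.max u v -> e <= w.
  by case/andP => + _; apply: le_trans; rewrite le_min eu.
apply: (@lipschitz_of_deriv _ (fun u => eta (x / Num.sqrt u) / u)
  (fun u => - (2^-1 * (x / Num.sqrt u * eta' (x / Num.sqrt u)) +
    eta (x / Num.sqrt u)) / u ^+ 2) _ u v).
  by move=> w /ge ew; apply: deta_scale; exact: lt_le_trans ew.
move=> w /ge ew; have w0 : 0 < w by exact: lt_le_trans ew.
rewrite normrM normrN; apply: ler_pM => //.
  apply: le_trans (ler_normD _ _) _; apply: lerD => //.
  rewrite normrM ger0_norm// ler_wpM2l//.
  set z := x / _; rewrite /eta' mulrBr mulrDl mul1r;
    apply: le_trans (ler_normB _ _) _.
  apply: lerD; first exact: (eta_bound z).
  have -> : z * (kappa * (z ^+ 2 * f z)) = kappa * (z ^+ 3 * f z) by ring.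
  by rewrite normrM (gtr0_norm kappa_gt0) ler_pM2l//; exact: decay.
rewrite normfV gtr0_norm ?exprn_gt0// lef_pV2 ?posrE ?exprn_gt0//.
by apply: lerXn2r => //; rewrite nnegrE ltW.
Qed.

(* [(v, x) |-> F (x / sqrt v)] solves a heat equation, so that a decrease [tau]
   of [v] compensates a conditional variance [tau / kappa] of the increment. *)
Lemma lindeberg_step (e : R) : 0 < e -> exists2 C, 0 <= C &
  forall v tau x h, 0 <= tau -> e <= v - tau ->
  `|F ((x - h) / Num.sqrt (v - tau)) - F (x / Num.sqrt v)
    + h * (f (x / Num.sqrt v) / Num.sqrt v)
    - 2^-1 * (eta (x / Num.sqrt v) / v) * (tau - kappa * h ^+ 2)| <=
  C * (`|h| ^+ 3 + tau * `|h| + tau ^+ 2).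
Proof.
move=> e0; pose q := Num.sqrt e.
have q0 : 0 < q by rewrite sqrtr_gt0.
pose L := (1 + kappa) * B.
have L0 : 0 <= L by rewrite mulr_ge0// addr_ge0// ltW.
pose C1 := kappa * L / q ^+ 3.
pose C2 := 2^-1 * ((2^-1 * L + B) / e ^+ 2).
pose C3 := 2^-1 * (L / q / e).
have C10 : 0 <= C1 by apply: divr_ge0; [apply: mulr_ge0|apply: exprn_ge0];
  rewrite ?(ltW q0) ?(ltW kappa_gt0).
have C20 : 0 <= C2.
  apply: mulr_ge0 => //; apply: divr_ge0; last exact/exprn_ge0/ltW.
  by apply: addr_ge0 => //; exact: mulr_ge0.
have C30 : 0 <= C3.
  apply: mulr_ge0 => //; apply: divr_ge0; last exact/ltW.
  by apply: divr_ge0 => //; exact/ltW.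
exists (C1 + C2 + C3); first by rewrite !addr_ge0.
move=> v tau x h tau0 ev.
have evv : e <= v by lra.
have v0 : 0 < v by lra.
set s := Num.sqrt v.
have s0 : 0 < s by rewrite sqrtr_gt0.
have sn0 : s != 0 by rewrite gt_eqF.
have s2 : s ^+ 2 = v by rewrite sqr_sqrtr// ltW.
have qs : q <= s by rewrite ler_sqrt// ltW.
have T1 := taylor3 (x / s) (- h / s).
(* Three errors: the step in space at frozen variance [v], the decrease of the variance at the
   shifted point [x - h], and the evaluation of the time derivative at [x] instead of [x - h]. They
   yield [C1], [C2] and [C3] respectively. *)
have -> : F ((x - h) / Num.sqrt (v - tau)) - F (x / s) + h * (f (x / s) / s)
    - 2^-1 * (eta (x / s) / v) * (tau - kappa * h ^+ 2) =
  (F (x / s + - h / s) - F (x / s) - - h / s * f (x / s) +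
    2^-1 * kappa * eta (x / s) * (- h / s) ^+ 2) +
  (F ((x - h) / Num.sqrt (v - tau)) - F ((x - h) / s) -
    2^-1 * tau * (eta ((x - h) / s) / v)) +
  2^-1 * tau * ((eta ((x - h) / s) - eta (x / s)) / v).
  rewrite -mulrDl -s2; move: (F _) (F _) (F _) (eta _) (eta _) (f _) => a b c a' b' c'.
  by field.
rewrite -/s.
apply: le_trans (ler_normD _ _) _; rewrite [leRHS]mulrDl; apply: lerD.
  apply: le_trans (ler_normD _ _) _; rewrite [leRHS]mulrDl; apply: lerD.
    apply: le_trans T1 _; rewrite normrM normfV normrN (gtr0_norm s0).
    apply: (@le_trans _ _ (C1 * `|h| ^+ 3)); last first.
      by apply: ler_wpM2l => //; rewrite -addrA lerDl addr_ge0 ?mulr_ge0 ?exprn_ge0.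
    rewrite /C1 [leRHS]mulrAC -[leRHS]mulrA -/L; apply: ler_wpM2l.
      by apply: mulr_ge0 => //; exact: ltW.
    rewrite expr_div_n; apply: ler_wpM2l; first exact: exprn_ge0.
    rewrite lef_pV2 ?posrE ?exprn_gt0//.
    by apply: lerXn2r => //; rewrite nnegrE ltW.
  apply: (@le_trans _ _ (C2 * tau ^+ 2)); last first.
    by apply: ler_wpM2l => //; rewrite lerDr addr_ge0 ?mulr_ge0 ?exprn_ge0.
  have vt : v - tau <= v by lra.
  have [c /andP[c1 c2]] := @mean_value _ (fun u => F ((x - h) / Num.sqrt u))
    (fun u => - 2^-1 * (eta ((x - h) / Num.sqrt u) / u)) _ _ vt
    (fun u hu => dF_scale (x - h) (lt_le_trans e0 (le_trans ev (andP hu).1))).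
  rewrite -/s => eq.
  have -> : F ((x - h) / Num.sqrt (v - tau)) - F ((x - h) / s) -
    2^-1 * tau * (eta ((x - h) / s) / v) =
    2^-1 * tau * (eta ((x - h) / Num.sqrt c) / c - eta ((x - h) / s) / v).
    by rewrite -(opprB (F ((x - h) / s))) eq; ring.
  rewrite normrM (ger0_norm (_ : 0 <= 2^-1 * tau)) ?mulr_ge0//.
  have := @eta_scale_lip e (x - h) v c e0 evv (le_trans ev c1); rewrite -/s -/L => hl.
  have hc : `|c - v| <= tau by rewrite ler_norml; apply/andP; split; lra.
  rewrite [leRHS](_ : _ = 2^-1 * tau * ((2^-1 * L + B) / e ^+ 2 * tau)); last first.
    by rewrite /C2; ring.
  apply: ler_wpM2l; first exact: mulr_ge0.
  apply: le_trans hl _; apply: ler_wpM2l => //.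
  apply: divr_ge0; last exact/exprn_ge0/ltW.
  by apply: addr_ge0 => //; exact: mulr_ge0.
apply: (@le_trans _ _ (C3 * (tau * `|h|))); last first.
  apply: ler_wpM2l => //; rewrite addrAC lerDr addr_ge0 ?exprn_ge0//.
rewrite normrM (ger0_norm (_ : 0 <= 2^-1 * tau)) ?mulr_ge0//.
rewrite [leRHS](_ : _ = 2^-1 * tau * (L * (q^-1 * `|h|) * e^-1)); last first.
  by rewrite /C3; ring.
apply: ler_wpM2l; first exact: mulr_ge0.
rewrite normrM; apply: ler_pM => //.
  apply: le_trans (eta_lip _ _) _; apply: ler_wpM2l => //.
  rewrite -mulrBl addrAC subrr sub0r normrM normrN mulrC ler_wpM2r//.
  by rewrite normfV gtr0_norm// lef_pV2.
by rewrite normfV gtr0_norm// lef_pV2.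
Qed.

End gaussian_step.

(** * The Gaussian distribution function *)

Section normal_cdf.
Context {R : realType}.
Implicit Types s x y : R.

Definition normal_cdf s x : R := fine (normal_prob 0 s `]-oo, x]).

Lemma normal_cdfE s x : normal_prob 0 s `]-oo, x] = (normal_cdf s x)%:E.
Proof. by rewrite /normal_cdf fineK// fin_num_measure. Qed.

Lemma normal_cdf_ge0 s x : 0 <= normal_cdf s x.
Proof. exact: fine_ge0. Qed.

Lemma normal_cdf_le1 s x : normal_cdf s x <= 1.
Proof. by rewrite -lee_fin -normal_cdfE probability_le1. Qed.

Lemma normal_cdf_nd s x y : x <= y -> normal_cdf s x <= normal_cdf s y.
Proof.
move=> xy; rewrite -lee_fin -!normal_cdfE; apply: le_measure; rewrite ?inE//.
by apply: subset_itvl; rewrite bnd_simp.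
Qed.

(** The identity seen as a random variable under the normal law: its distribution function is
    [normal_cdf], which gives the limits at both infinities. *)
Let idTR : measurableTypeR R -> R := idfun.

#[local] HB.instance Definition _ :=
  @isMeasurableFun.Build _ _ _ _ idTR (@measurable_id _ _ setT).

Lemma cvg_normal_cdfy s : normal_cdf s x @[x --> +oo] --> (1 : R).
Proof.
by apply: fine_cvg; exact: (cvg_cdfy1 (idTR : {RV (normal_prob 0 s) >-> R})).
Qed.

Lemma cvg_normal_cdfNy s : normal_cdf s x @[x --> -oo] --> (0 : R).
Proof.
by apply: fine_cvg; exact: (cvg_cdfNy0 (idTR : {RV (normal_prob 0 s) >-> R})).
Qed.

Lemma normal_pdf0E s x : s != 0 ->
  normal_pdf 0 s x = normal_peak s * expR (- (x ^+ 2 / (s ^+ 2 *+ 2))).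
Proof. by move=> s0; rewrite normal_pdfE//= /normal_fun subr0 mulNr. Qed.

Lemma is_derive_normal_cdf s x : s != 0 ->
  is_derive x 1 (normal_cdf s) (normal_pdf 0 s x).
Proof.
move=> s0.
have xx1 : x < x + 1 by rewrite ltrDl.
have int : lebesgue_measure.-integrable `]-oo, (x + 1)]
    (EFin \o normal_pdf 0 s).
  by apply: (integrableS _ _ (@subsetT _ _)) => //; exact: integrable_normal_pdf.
have [h1 h2] : derivable (normal_cdf s) x 1 /\ derive1 (normal_cdf s) x = normal_pdf 0 s x.
  exact: (continuous_FTC1 xx1 int (ltNyr _) (@continuous_normal_pdf R 0 s s0 x)).
by rewrite derive1E in h2; exact: (DeriveDef h1 h2).
Qed.

Lemma is_derive_normal_pdf s x : s != 0 ->
  is_derive x 1 (normal_pdf 0 s) (- (s ^+ 2)^-1 * (x * normal_pdf 0 s x)).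
Proof.
move=> s0; rewrite (_ : normal_pdf 0 s =
  fun x => normal_peak s * expR (- (x ^+ 2 / (s ^+ 2 *+ 2)))); last first.
  by apply/funext => y; rewrite normal_pdf0E.
have h : is_derive x 1 (fun x => - (x ^+ 2 / (s ^+ 2 *+ 2)))
    (- (x / s ^+ 2)).
  by apply: is_derive_eq; rewrite /GRing.scale /=; field.
have h2 := @is_derive1_comp R expR _ x _ _ (is_derive_expR _) h.
by apply: is_derive_eq; rewrite /GRing.scale /=; field.
Qed.

Lemma normal_pdf_decay s x : s != 0 ->
  (1 + x ^+ 4) * normal_pdf 0 s x <= normal_peak s * (1 + 8 * s ^+ 4).
Proof.
move=> s0; rewrite normal_pdf0E// mulrCA ler_wpM2l ?normal_peak_ge0//.
set u := x ^+ 2 / _.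
have u0 : 0 <= u by rewrite divr_ge0 ?sqr_ge0// mulrn_wge0 ?sqr_ge0.
have e1 : expR (- u) <= 1 by rewrite -expR0 ler_expR oppr_le0.
have e2 : 1 + u ^+ 2 / 2 <= expR u by have := @expR_ge1Dxn R u 1 u0.
have e3 : u ^+ 2 / 2 * expR (- u) <= 1.
  by rewrite expRN ler_pdivrMr ?expR_gt0// mul1r; lra.
rewrite mulrDl mul1r lerD//.
(* Since [u = x ^ 2 / (2 * s ^ 2)], the fourth power of [x] is [8 * s ^ 4] times [u ^ 2 / 2], a term
   of the exponential series. *)
have -> : x ^+ 4 * expR (- u) = 8 * s ^+ 4 * (u ^+ 2 / 2 * expR (- u)).
  by move: (expR _) => z; rewrite /u; field.
by rewrite ler_piMr// mulr_ge0// exprn_even_ge0.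
Qed.

End normal_cdf.

(** * The score and its conditional variance *)

Section score.
Context {R : realType}.
Variables (m : nat) (delta0 : R) (p : nat -> R).
Hypothesis m_gt0 : (0 < m)%N.
Hypothesis delta0_gt : -1 < delta0.
Hypothesis p_law : limit_degree_law m delta0 p.
Implicit Types (g : network) (s j n k : nat).

Local Notation r := (limit_tail m delta0 p).
Local Notation tt s := ((new_vertex m s)%:R : R).

Definition score s g : R :=
  choice_sum m s (fun k => (k%:R + delta0)^-1) g -
  \sum_(l < s) tt l / edge_weight m l delta0.

Definition score_diff s g j : R :=
  ((degree g j)%:R + delta0)^-1 - tt s / edge_weight m s delta0.

(** In the second moment one power of [degree + delta0] cancels against the attachment weight; in
    the mean both cancel, which leaves the number of vertices over the total weight. *)
Definition cond_var s g : R :=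
  (\sum_(v < new_vertex m s) ((degree g v)%:R + delta0)^-1) /
    edge_weight m s delta0 - (tt s / edge_weight m s delta0) ^+ 2.

Let m_ge1 : 1 <= m%:R :> R. Proof. by rewrite ler1n. Qed.

Let md_gt0 : 0 < m%:R + delta0.
Proof. by move: m_ge1 delta0_gt; lra. Qed.

Lemma score0 : score 0 (nseq m (1, 0)%N) = 0.
Proof. by rewrite /score choice_sum0 big_ord0 subrr. Qed.

Lemma score_rcons s g j : valid_net m s g -> (j < new_vertex m s)%N ->
  score s.+1 (rcons g (new_vertex m s, j)) = score s g + score_diff s g j.
Proof.
move=> hg hj; rewrite /score choice_sum_rcons// big_ord_recr /= /score_diff.
ring.
Qed.

Lemma norm_score_diff s g j : valid_net m s g -> (j < new_vertex m s)%N ->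
  `|score_diff s g j| <= (m%:R + delta0)^-1.
Proof.
move=> hg hj; rewrite /score_diff.
have w0 := edge_weight_gt0 s m_gt0 delta0_gt.
have md : m%:R <= (degree g j)%:R :> R by rewrite ler_nat; case: hg => + _ _ _; apply.
have d0 : 0 < (degree g j)%:R + delta0 by exact: (degreeD_gt0 m_gt0 delta0_gt hg hj).
have a1 : ((degree g j)%:R + delta0)^-1 <= (m%:R + delta0)^-1.
  by rewrite lef_pV2 ?posrE// lerD2r.
have a0 : 0 < ((degree g j)%:R + delta0)^-1 by rewrite invr_gt0.
have b0 : 0 <= tt s / edge_weight m s delta0 by rewrite divr_ge0// ltW.
have b1 : tt s / edge_weight m s delta0 <= (m%:R + delta0)^-1.
  by rewrite ler_pdivrMr// ler_pdivlMl//; exact: edge_weight_ge.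
by rewrite ler_norml; apply/andP; split; lra.
Qed.

Lemma cond_expect_score_diff s g : valid_net m s g ->
  cond_expect m delta0 s g (score_diff s g) = 0.
Proof.
move=> hg; rewrite /score_diff cond_expectD cond_expect_cst//.
rewrite /cond_expect (_ : \sum_(_ < _) _ =
  \sum_(j < new_vertex m s) (edge_weight m s delta0)^-1); last first.
  apply: eq_bigr => j _; rewrite mulrAC divff ?mul1r// gt_eqF//.
  exact: (degreeD_gt0 m_gt0 delta0_gt hg).
by rewrite sumr_const card_ord -[_ *+ new_vertex _ _]mulr_natl subrr.
Qed.

Lemma cond_expect_score_diff_sqr s g : valid_net m s g ->
  cond_expect m delta0 s g (fun j => score_diff s g j ^+ 2) = cond_var s g.
Proof.
move=> hg; set c := tt s / edge_weight m s delta0.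
have e j : (j < new_vertex m s)%N -> score_diff s g j ^+ 2 =
    ((degree g j)%:R + delta0)^-1 ^+ 2 + (- (2 * c) * score_diff s g j - c ^+ 2).
  by move=> _; rewrite /score_diff -/c; ring.
rewrite (eq_cond_expect _ _ e) cond_expectD cond_expectD cond_expectZ.
rewrite cond_expect_score_diff// mulr0 add0r cond_expect_cst//.
rewrite /cond_var -/c; congr (_ - _).
rewrite /cond_expect mulr_suml; apply: eq_bigr => j _.
rewrite mulrAC; congr (_ / _); rewrite expr2 mulrA divff ?mul1r// gt_eqF//.
exact: (degreeD_gt0 m_gt0 delta0_gt hg).
Qed.

(** With [V] vertices and total weight [w], [(2 * m + delta) * V - w = m * V - s], which stays
    between 0 and [2 * m]. *)
Lemma new_vertex_div_weight (delta : R) s : -1 < delta ->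
  `|tt s / edge_weight m s delta - (2 * m%:R + delta)^-1| <=
  2 * m%:R ^+ 2 / (m%:R + delta) / s.+1%:R.
Proof.
move=> d1; have w0 := edge_weight_gt0 s m_gt0 d1.
have c0 : 1 <= 2 * m%:R + delta by move: m_ge1; lra.
have c00 : 0 < 2 * m%:R + delta by lra.
have cn0 : 2 * m%:R + delta != 0 by rewrite gt_eqF.
have md : 0 < m%:R + delta by move: m_ge1; lra.
have [h1 h2] := new_vertex_bounds (R := R) m_gt0 s.
have -> : tt s / edge_weight m s delta - (2 * m%:R + delta)^-1 =
  (m%:R * tt s - s%:R) / (edge_weight m s delta * (2 * m%:R + delta)).
  have wn0 : edge_weight m s delta != 0 by rewrite gt_eqF.
  transitivity (((2 * m%:R + delta) * tt s - edge_weight m s delta) /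
     (edge_weight m s delta * (2 * m%:R + delta))).
    by field; rewrite wn0 cn0.
  by congr (_ / _); rewrite /edge_weight; ring.
have m0 : 0 < m%:R :> R by rewrite ltr0n.
have n0 : 0 <= m%:R * tt s - s%:R by lra.
rewrite ger0_norm; last by rewrite divr_ge0// mulr_ge0// ltW.
rewrite ler_pdivrMr ?mulr_gt0//.
apply: (@le_trans _ _ (2 * m%:R)); first lra.
have hw := edge_weight_geS m_gt0 s d1.
have s0 : 0 < s.+1%:R :> R by rewrite ltr0n.
have X1 : 1 <= m%:R * edge_weight m s delta / ((m%:R + delta) * s.+1%:R).
  by rewrite ler_pdivlMr ?mulr_gt0// mul1r.
rewrite [leRHS](_ : _ = 2 * m%:R *
  (m%:R * edge_weight m s delta / ((m%:R + delta) * s.+1%:R) * (2 * m%:R + delta))).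
  rewrite ler_peMr ?mulr_ge0//; apply: (le_trans X1); rewrite ler_peMr//.
  exact: le_trans X1.
by field; rewrite !gt_eqF.
Qed.

(** Telescoping from degree [m] to the current degree turns a sum over vertices into a choice sum,
    so [choice_sum_approx] covers it. *)
Lemma sum_inv_degree s g : valid_net m s g ->
  \sum_(v < new_vertex m s) ((degree g v)%:R + delta0)^-1 =
  choice_sum m s (fun k => (k.+1%:R + delta0)^-1 - (k%:R + delta0)^-1) g
  + tt s * (m%:R + delta0)^-1.
Proof.
move=> hg; have -> : tt s * (m%:R + delta0)^-1 =
    \sum_(v < new_vertex m s) (m%:R + delta0)^-1.
  by rewrite sumr_const card_ord mulr_natl.
rewrite /choice_sum -big_split; apply: eq_bigr => v _ /=.
rewrite (telescope_sumr (fun k => (k%:R + delta0)^-1)) ?subrK//.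
by case: hg => + _ _ _; apply.
Qed.

(** Abel summation: the recursion gives [r (k - 1) - r k = theta * r k / (k + delta0)], which
    produces the series defining [nu]. *)
Lemma sum_by_parts n :
  \sum_(m <= k < m + n) ((k.+1%:R + delta0)^-1 - (k%:R + delta0)^-1) * r k =
  r (m + n).-1 / ((m + n)%:R + delta0) - (m%:R + delta0)^-1 +
  (2 * m%:R + delta0) / m%:R *
  \sum_(m <= k < m + n) r k / ((k%:R + delta0) * (k%:R + delta0)).
Proof.
have mn0 : m%:R != 0 :> R by rewrite pnatr_eq0 -lt0n.
elim: n => [|n IH].
  rewrite addn0 !big_geq// mulr0 addr0 /limit_tail prednK// leqnn mul1r subrr//.
rewrite addnS !big_nat_recr ?leq_addr//= IH mulrDr.
have mk := leq_addr n m.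
have k0 : 0 < (m + n)%:R + delta0.
  have : m%:R <= (m + n)%:R :> R by rewrite ler_nat.
  by move: md_gt0; lra.
have kn0 : (m + n)%:R + delta0 != 0 by rewrite gt_eqF.
have k1 : (m + n).+1%:R + delta0 != 0 by rewrite gt_eqF// -natr1; lra.
have rec := limit_tail_rec m_gt0 delta0_gt p_law mk.
have theta0 : 2 * m%:R + delta0 != 0 by rewrite gt_eqF//; move: m_ge1 delta0_gt; lra.
have e : r (m + n).-1 = r (m + n) + (2 + delta0 / m%:R) * r (m + n) / ((m + n)%:R + delta0).
  have key (x y z th : R) : x != 0 -> th != 0 -> z = x / th * (y - z) ->
      y = z + th * z / x.
    move=> x0 t0 h; have -> : th * z = x * (y - z) by rewrite {1}h; field.
    by field.
  apply: key => //.
  by rewrite -(mulrI_eq0 _ (lregP mn0)) mulrDr mulrCA mulfV// mulr1 mulrC.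
rewrite e; move: k1 kn0; move: ((m + n).+1%:R + delta0) ((m + n)%:R + delta0) => x y x0 y0.
move: (r _) (\sum_(_ <= _ < _) _) (m%:R + delta0)^-1 => a A B; field.
by rewrite mn0 x0 y0.
Qed.

Lemma cond_var_approx (e : R) : 0 < e -> exists n, exists2 C, 0 <= C &
  forall s g, valid_net m s g ->
  `|cond_var s g - nu m delta0 p / m%:R| <=
  e + C * (total_dev m delta0 p n s g + 1) / s.+1%:R.
Proof.
move=> e0.
have m0 : 0 < m%:R :> R by rewrite ltr0n.
have mn0 : m%:R != 0 :> R by rewrite gt_eqF.
have c1 : 1 <= 2 * m%:R + delta0 by move: m_ge1 delta0_gt; lra.
have c0 : 0 < 2 * m%:R + delta0 by lra.
have cn0 : 2 * m%:R + delta0 != 0 by rewrite gt_eqF.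
set c := 2 * m%:R + delta0 in c0 c1 cn0 *.
pose V n := \sum_(m <= k < m + n) r k / ((k%:R + delta0) * (k%:R + delta0)).
pose e4 := e / 4; have e40 : 0 < e4 by rewrite divr_gt0.
have kd k : (m <= k)%N -> 0 < k%:R + delta0.
  move=> mk; have : m%:R <= k%:R :> R by rewrite ler_nat.
  by move: md_gt0; lra.
pose f k : R := (k.+1%:R + delta0)^-1 - (k%:R + delta0)^-1.
have fb k : (m <= k)%N -> `|f k| <= (k%:R + delta0)^-1.
  move=> mk; have k0 := kd k mk; have k1 := kd k.+1 (leqW mk).
  have : (k.+1%:R + delta0)^-1 <= (k%:R + delta0)^-1.
    by rewrite lef_pV2 ?posrE// lerD2r ler_nat.
  have : 0 < (k.+1%:R + delta0)^-1 by rewrite invr_gt0.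
  by move=> u1 u2; rewrite /f ler_norml; apply/andP; split; lra.
pose e5 := e4 * (m%:R + delta0) / m%:R.
have e50 : 0 < e5 by rewrite divr_gt0// mulr_gt0.
have [n [hn1 hn2 hn3]] : exists n, [/\ `|nu m delta0 p - (V n - m%:R / c ^+ 2)| < e4,
    r (m + n).-1 < e4 * (m%:R + delta0) & (m%:R + n%:R + delta0)^-1 <= e5].
  have h1 := cvg_nu m_gt0 delta0_gt p_law; rewrite -/c in h1.
  have {h1} := h1; move/cvgrPdist_lt => /(_ _ e40) h1.
  have h2 := limit_tail_cvg0 m_gt0 delta0_gt p_law; rewrite -(cvg_shiftn m) in h2.
  have e4m : 0 < e4 * (m%:R + delta0) by rewrite mulr_gt0.
  have {h2} := h2; move/cvgrPdist_lt => /(_ _ e4m) h2.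
  near \oo => n; exists n.+1; split.
  - by near: n.
  - rewrite addnS addnC /=; have : `|0 - r (n + m)%N| < e4 * (m%:R + delta0) by near: n.
    by rewrite sub0r normrN => /ltr_normlW.
  - rewrite invf_ple ?posrE//; last by rewrite -natrD; exact: kd (leq_addr _ _).
    have : e5^-1 <= n%:R by near: n; exact: nbhs_infty_ger.
    by rewrite -natr1; move: md_gt0; lra.
exists n.
(* Limit, truncated at [m + n], of the sum of inverse weights per vertex; the boundary terms
   [(m + delta0)^-1] of [sum_inv_degree] and [sum_by_parts] cancel. *)
pose a := r (m + n).-1 / ((m + n)%:R + delta0) + c / m%:R * V n.
pose B := (m%:R + delta0)^-1.
have B0 : 0 <= B by rewrite invr_ge0 ltW.
pose K := m%:R / (m%:R + delta0).
have K0 : 0 <= K by rewrite divr_ge0// ltW.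
pose Ct := 2 * m%:R ^+ 2 / (m%:R + delta0).
have Ct0 : 0 <= Ct by rewrite divr_ge0 ?mulr_ge0 ?exprn_ge0 // ltW.
exists (B * K + 2 * B * K + `|a| * (Ct + 2 * K) + Ct * (B + B)).
  by rewrite !addr_ge0 ?mulr_ge0 ?addr_ge0 ?mulr_ge0.
move=> s g hg.
set D := total_dev _ _ _ _ _ _.
have D0 : 0 <= D by exact: total_dev_ge0.
set w := edge_weight m s delta0.
have w0 : 0 < w by exact: edge_weight_gt0.
have wn0 : w != 0 by rewrite gt_eqF.
set i := s.+1%:R^-1 : R.
have i0 : 0 < i by rewrite invr_gt0 ltr0n.
have sn0 : s.+1%:R != 0 :> R by [].
have wi : w^-1 <= K * i.
  rewrite -[leLHS]mul1r ler_pdivrMr// /i /K mulrAC ler_pdivlMr ?ltr0n// mul1r.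
  by rewrite mulrAC ler_pdivlMr// mulrC; exact: edge_weight_geS.
have wi0 : 0 < w^-1 by rewrite invr_gt0.
set A := \sum_(v < new_vertex m s) ((degree g v)%:R + delta0)^-1.
have [h1 h2] := new_vertex_bounds (R := R) m_gt0 s.
have hsm : `|tt s - s%:R / m%:R| <= 2.
  have q1 : m%:R * (s%:R / m%:R) = s%:R :> R by field.
  have q2 : tt s - 2 <= s%:R / m%:R by rewrite -(ler_pM2l m0) q1.
  have q3 : s%:R / m%:R <= tt s by rewrite -(ler_pM2l m0) q1; move: m_ge1; lra.
  by rewrite ler_norml; apply/andP; split; lra.
have hA : `|A - s%:R / m%:R * a| <= B * D + e5 * s%:R + 2 * B.
  have hap := @choice_sum_approx R m delta0 p n s f B e5 g hg.
  have : `|choice_sum m s f g - s%:R / m%:R * \sum_(m <= k < m + n) f k * r k|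
     <= B * D + e5 * s%:R.
    apply: hap; last exact: ltW.
      move=> k /andP[mk _]; apply: le_trans (fb k mk) _.
      by rewrite lef_pV2 ?posrE ?kd// lerD2r ler_nat.
    move=> k mk; apply: le_trans (fb k (leq_trans (leq_addr _ _) mk)) _.
    apply: le_trans hn3; rewrite lef_pV2 ?posrE ?kd//.
    - by rewrite -natrD lerD2r ler_nat.
    - exact: leq_trans (leq_addr _ _) mk.
    - by rewrite -natrD; apply: kd; exact: leq_addr.
  rewrite sum_by_parts -/(V n) -/c => hap'.
  rewrite /A (sum_inv_degree hg) -/f.
  have -> : choice_sum m s f g + tt s * (m%:R + delta0)^-1 - s%:R / m%:R * a =
     (choice_sum m s f g - s%:R / m%:R *
        (r (m + n).-1 / ((m + n)%:R + delta0) - (m%:R + delta0)^-1 + c / m%:R * V n))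
      + (tt s - s%:R / m%:R) * B.
    by rewrite /a /B; ring.
  apply: le_trans (ler_normD _ _) _; apply: lerD => //.
  by rewrite normrM (ger0_norm B0) ler_wpM2r.
have ht : `|tt s / w - c^-1| <= Ct * i by exact: new_vertex_div_weight.
have htw0 : 0 <= tt s / w by rewrite divr_ge0// ltW.
have htB : tt s / w <= B.
  by rewrite /B ler_pdivrMr// ler_pdivlMl//; exact: edge_weight_ge.
have hcB : c^-1 <= B by rewrite lef_pV2 ?posrE// /c; move: m_ge1; lra.
have ci0 : 0 < c^-1 by rewrite invr_gt0.
have hs : `|s%:R / m%:R / w - c^-1| <= (Ct + 2 * K) * i.
  have -> : s%:R / m%:R / w - c^-1 = (tt s / w - c^-1) - (tt s - s%:R / m%:R) / w.
    by ring.
  apply: le_trans (ler_normB _ _) _; rewrite [leRHS]mulrDl; apply: lerD => //.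
  rewrite normrM (gtr0_norm wi0) -mulrA; apply: ler_pM => //; exact: ltW.
(* In this order: fluctuation of the degrees, fluctuation of the total weight, deterministic
   truncation error, and the squared conditional mean against its limit [c ^- 2]. *)
have -> : cond_var s g - nu m delta0 p / m%:R =
  (A - s%:R / m%:R * a) / w + a * (s%:R / m%:R / w - c^-1) +
  (r (m + n).-1 / ((m + n)%:R + delta0) / c -
   (nu m delta0 p - (V n - m%:R / c ^+ 2)) / m%:R) -
  (tt s / w - c^-1) * (tt s / w + c^-1).
  rewrite /cond_var -/A -/w /a.
  move: (nu _ _ _) (V n) (r _) ((m + n)%:R + delta0)^-1 => x y z z'.
  by clearbody c; field; rewrite wn0 mn0 cn0.
have p1 : `|(A - s%:R / m%:R * a) / w| <= (B * K * D + 2 * B * K) * i + e4.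
  rewrite normrM (gtr0_norm wi0).
  apply: (@le_trans _ _ ((B * D + e5 * s%:R + 2 * B) / w)); first by rewrite ler_pM2r.
  have u1 : (B * D + 2 * B) / w <= (B * D + 2 * B) * (K * i).
    by apply: ler_wpM2l => //; rewrite addr_ge0 ?mulr_ge0.
  have u2 : e5 * s%:R / w <= e4.
    rewrite ler_pdivrMr// [leLHS](_ : _ = e4 * ((m%:R + delta0) * s%:R) / m%:R);
      last by rewrite /e5; ring.
    rewrite ler_pdivrMr// -(mulrA e4); apply: (ler_wpM2l (ltW e40)).
    rewrite [leRHS]mulrC; apply: (le_trans _ (edge_weight_geS m_gt0 s delta0_gt)).
    by rewrite ler_pM2l// ler_nat.
  have -> : (B * D + e5 * s%:R + 2 * B) / w = (B * D + 2 * B) / w + e5 * s%:R / w by ring.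
  have -> : (B * K * D + 2 * B * K) * i = (B * D + 2 * B) * (K * i) by ring.
  lra.
have p2 : `|a * (s%:R / m%:R / w - c^-1)| <= `|a| * (Ct + 2 * K) * i.
  by rewrite normrM -[leRHS]mulrA; apply: ler_wpM2l.
have p3 : `|r (m + n).-1 / ((m + n)%:R + delta0) / c -
   (nu m delta0 p - (V n - m%:R / c ^+ 2)) / m%:R| <= e4 + e4.
  apply: le_trans (ler_normB _ _) _; apply: lerD.
    have rr := limit_tail_gt0 m_gt0 delta0_gt p_law (m + n).-1.
    have kk := kd (m + n)%N (leq_addr _ _).
    rewrite ger0_norm; last by rewrite !divr_ge0// ltW.
    rewrite ler_pdivrMr// ler_pdivrMr//.
    apply: le_trans (ltW hn2) _; rewrite -mulrA ler_pM2l//.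
    rewrite -[leLHS]mul1r; apply: ler_pM => //; first exact: ltW.
    by rewrite lerD2r ler_nat leq_addr.
  rewrite normrM normfV (gtr0_norm m0) ler_pdivrMr//.
  by apply: le_trans (ltW hn1) _; rewrite ler_pMr.
have p4 : `|(tt s / w - c^-1) * (tt s / w + c^-1)| <= Ct * (B + B) * i.
  rewrite normrM mulrAC; apply: ler_pM => //.
  by rewrite ger0_norm ?addr_ge0 ?lerD// ltW.
apply: le_trans (ler_normB _ _) _.
apply: le_trans (lerD (le_trans (ler_normD _ _) (lerD (ler_normD _ _) (lexx _))) (lexx _)) _.
have q1 : 0 <= B * K * i by rewrite !mulr_ge0// ltW.
have q2 : 0 <= `|a| * (Ct + 2 * K) * i * D.
  by rewrite !mulr_ge0// ?addr_ge0 ?mulr_ge0// ltW.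
have q3 : 0 <= Ct * (B + B) * i * D.
  by rewrite !mulr_ge0// ?addr_ge0// ltW.
have q4 : 0 <= B * K * i * D by rewrite mulr_ge0.
have e4E : e = e4 + e4 + e4 + e4 by rewrite /e4; field.
rewrite e4E -/i.
set X1 := `|_| in p1 *; set X2 := `|_| in p2 *; set X3 := `|_| in p3 *;
  set X4 := `|_| in p4 *.
have -> : (B * K + 2 * B * K + `|a| * (Ct + 2 * K) + Ct * (B + B)) * (D + 1) * i =
  (B * K * D + 2 * B * K) * i + B * K * i + 2 * (B * K * i * D) +
  (`|a| * (Ct + 2 * K) * i) + `|a| * (Ct + 2 * K) * i * D +
  Ct * (B + B) * i + Ct * (B + B) * i * D by ring.
lra.
Unshelve. all: by end_near. Qed.

End score.

Section inverse_sqrt.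
Context {R : realType}.

Lemma inv_sqrt_small (e : R) : 0 < e -> exists N0, forall N, (N0 <= N)%N ->
  (0 < N)%N /\ (Num.sqrt N%:R)^-1 <= e.
Proof.
move=> e0; exists (Num.bound (e ^- 2)).+1 => N hN.
have N0 : (0 < N)%N by exact: leq_trans hN.
split=> //; have s0 : 0 < Num.sqrt N%:R :> R by rewrite sqrtr_gt0 ltr0n.
rewrite invf_ple ?posrE// -(ler_sqr (x := e^-1)) ?nnegrE ?invr_ge0 ?(ltW e0)// ?(ltW s0)//.
rewrite sqr_sqrtr// exprVn.
apply: (@le_trans _ _ (Num.bound (e ^- 2))%:R); last by rewrite ler_nat ltnW.
by apply/ltW/archi_boundP; rewrite invr_ge0 exprn_ge0// ltW.
Qed.

Lemma sum_inv_sqrt N :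
  \sum_(l < N) (Num.sqrt l.+1%:R)^-1 <= 2 * Num.sqrt N%:R :> R.
Proof.
elim: N => [|N IH]; first by rewrite big_ord0 mulr_ge0.
rewrite big_ord_recr /=; apply: le_trans (lerD IH (lexx _)) _.
set x := Num.sqrt N%:R; set y := Num.sqrt N.+1%:R.
have x0 : 0 <= x by exact: sqrtr_ge0.
have y0 : 0 < y by rewrite sqrtr_gt0 ltr0n.
have xy : x <= y by rewrite ler_sqrt ?ler_nat.
have e : y ^+ 2 = x ^+ 2 + 1 by rewrite !sqr_sqrtr// natr1.
rewrite -(ler_pM2r y0) mulrDl mulVf ?gt_eqF//.
have := sqr_ge0 (x - y); rewrite -mulrA; nra.
Qed.

End inverse_sqrt.

(** * Lindeberg telescoping *)

Section central_limit_theorem.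
Context {d : measure_display} {T : measurableType d} {R : realType}.
Variable P : probability T R.
Variables (m : nat) (delta0 : R) (J : nat -> nat -> {RV P >-> nat}).
Variable p : nat -> R.
Hypothesis m_gt0 : (0 < m)%N.
Hypothesis delta0_gt : -1 < delta0.
Hypothesis hJ : pref_attachment m delta0 J.
Hypothesis p_law : limit_degree_law m delta0 p.

Local Notation E := (expect m J).
Local Notation nu0 := (nu m delta0 p).
Local Notation F := (normal_cdf (Num.sqrt nu0^-1)).
Local Notation f := (normal_pdf 0 (Num.sqrt nu0^-1)).
Local Notation Z := (score m delta0).

(** For [N = n * m] edges, [clt_scale / sqrt N] equals [1 / (nu0 * sqrt n)]. It brings the score
    directly to the limit variance [1 / nu0] of the estimator. *)
Definition clt_scale : R := Num.sqrt m%:R / nu0.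
Local Notation lambda := clt_scale.

Let nu0_gt0 : 0 < nu0. Proof. exact: nu_gt0. Qed.

Let m_pos : 0 < m%:R :> R. Proof. by rewrite ltr0n. Qed.

Let sd_neq0 : Num.sqrt nu0^-1 != 0.
Proof. by rewrite gt_eqF// sqrtr_gt0 invr_gt0. Qed.

Let sd_sqr : (Num.sqrt nu0^-1 ^+ 2)^-1 = nu0.
Proof. by rewrite sqr_sqrtr ?invrK// invr_ge0 ltW. Qed.

Let lambda_gt0 : 0 < lambda.
Proof. by rewrite divr_gt0// sqrtr_gt0. Qed.

Let lambda_sqr : nu0 * lambda ^+ 2 = m%:R / nu0.
Proof.
by rewrite /lambda expr_div_n sqr_sqrtr//; field; rewrite gt_eqF.
Qed.

Let B : R := normal_peak (Num.sqrt nu0^-1) * (1 + 8 * Num.sqrt nu0^-1 ^+ 4).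

Let f_decay x : (1 + x ^+ 4) * f x <= B.
Proof. exact: normal_pdf_decay. Qed.

Let f_le x : f x <= B.
Proof.
apply: le_trans (f_decay x); rewrite ler_peMl ?normal_pdf_ge0//.
by rewrite lerDl exprn_even_ge0.
Qed.

Let xf_le x : `|x * f x| <= B.
Proof.
apply: le_trans (f_decay x); rewrite normrM (ger0_norm (normal_pdf_ge0 _ _ _)).
rewrite ler_wpM2r ?normal_pdf_ge0//.
have -> : x ^+ 4 = `|x| ^+ 4 by rewrite -normrX ger0_norm// exprn_even_ge0.
have [x1|/ltW x1] := leP `|x| 1.
  by apply: (@le_trans _ _ 1) => //; rewrite lerDl exprn_ge0.
apply: (@le_trans _ _ (`|x| ^+ 4)); last by rewrite lerDr.
by rewrite -[leLHS]expr1 ler_weXn2l.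
Qed.

Let B_ge0 : 0 <= B.
Proof. by apply: le_trans (xf_le 0). Qed.

(* The probability that the score, completed by an independent Gaussian variable
   accounting for the choices still to come and for a smoothing of variance
   proportional to [e], ends up below [y]. *)
Let smoothed (e y w : R) l g : R :=
  F ((y - lambda * w * Z l g) / Num.sqrt (e + 1 - l%:R * w ^+ 2)).

Let c := (m%:R + delta0)^-1.

Let c_ge0 : 0 <= c.
Proof.
have : 1 <= m%:R :> R by rewrite ler1n.
by move=> h; rewrite invr_ge0; move: delta0_gt; lra.
Qed.

Let smoothed_step (e : R) : 0 < e -> exists2 C, 0 <= C &
  forall y w l g, valid_net m l g -> 0 < w -> w <= 1 -> l.+1%:R * w ^+ 2 <= 1 ->
  `|cond_expect m delta0 l g
      (fun j => smoothed e y w l.+1 (rcons g (new_vertex m l, j)))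
    - smoothed e y w l g| <=
  C * w ^+ 3 + B / e * (w ^+ 2 * (m%:R / nu0 * `|cond_var m delta0 l g - nu0 / m%:R|)).
Proof.
move=> e0.
have df (x : R) : is_derive x 1 f (- nu0 * (x * f x)).
  by have := is_derive_normal_pdf x sd_neq0; rewrite sd_sqr.
have [C C0 hC] := lindeberg_step nu0_gt0 (fun x => is_derive_normal_cdf x sd_neq0)
  df (fun x => normal_pdf_ge0 0 _ x) f_decay e0.
pose K := (lambda * c) ^+ 3 + lambda * c + 1.
have lc0 : 0 <= lambda * c by rewrite mulr_ge0// ltW.
have K0 : 0 <= K by rewrite !addr_ge0// exprn_ge0.
exists (C * K); first exact: mulr_ge0.
move=> y w l g hg w0 w1 lw.
set x := y - lambda * w * Z l g; set v := e + 1 - l%:R * w ^+ 2; set tau := w ^+ 2.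
have tau0 : 0 <= tau by rewrite exprn_ge0// ltW.
have vtau : v - tau = e + 1 - l.+1%:R * w ^+ 2.
  by rewrite /v /tau -natr1; ring.
have ev : e <= v - tau by rewrite vtau; lra.
have v0 : 0 < v by lra.
pose H := 2^-1 * (x / Num.sqrt v * f (x / Num.sqrt v) / v).
pose a := f (x / Num.sqrt v) / Num.sqrt v.
pose X := score_diff m delta0 l g.
pose U j := smoothed e y w l.+1 (rcons g (new_vertex m l, j)).
have UE j : (j < new_vertex m l)%N ->
    U j = F ((x - lambda * w * X j) / Num.sqrt (v - tau)).
  move=> hj; rewrite /U /smoothed vtau (score_rcons _ m_gt0 hg hj).
  by rewrite (mulrDr (lambda * w)) opprD addrA.
(* The remainder of [lindeberg_step], ordered by powers of [X j]. Under the conditional expectation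
   the linear term vanishes and the quadratic one becomes [cond_var]. *)
pose t0 j := U j + (lambda * w * a * X j + (H * nu0 * (lambda * w) ^+ 2 * X j ^+ 2 +
   - (F (x / Num.sqrt v) + H * tau))).
have t0E j : (j < new_vertex m l)%N -> `|t0 j| <= C * K * w ^+ 3.
  move=> hj; have -> : t0 j = F ((x - lambda * w * X j) / Num.sqrt (v - tau)) -
      F (x / Num.sqrt v) + lambda * w * X j * a -
      H * (tau - nu0 * (lambda * w * X j) ^+ 2).
    by rewrite /t0 UE//; ring.
  apply: le_trans (hC v tau x (lambda * w * X j) tau0 ev) _.
  rewrite -[leRHS]mulrA; apply: ler_wpM2l => //.
  have hX : `|lambda * w * X j| <= lambda * c * w.
    have lw0 : 0 <= lambda * w by apply: mulr_ge0; exact: ltW.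
    rewrite normrM (ger0_norm lw0) [leRHS]mulrAC; apply: ler_wpM2l => //.
    exact: norm_score_diff.
  set hh := `|_| in hX *.
  have hh0 : 0 <= hh by exact: normr_ge0.
  have b1 : hh ^+ 3 <= (lambda * c * w) ^+ 3.
    by apply: lerXn2r; rewrite ?nnegrE// mulr_ge0// ltW.
  have b2 : tau * hh <= tau * (lambda * c * w) by rewrite ler_wpM2l.
  have b3 : tau ^+ 2 <= w ^+ 3.
    rewrite /tau -exprM (exprS w 3) -[leRHS]mul1r ler_wpM2r ?exprn_ge0//.
    exact: ltW.
  have -> : K * w ^+ 3 = (lambda * c * w) ^+ 3 + tau * (lambda * c * w) + w ^+ 3.
    by rewrite /K /tau; ring.
  lra.
have := norm_cond_expect_le m_gt0 delta0_gt hg t0E.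
rewrite /t0 cond_expectD cond_expectD cond_expectZ cond_expect_score_diff// mulr0 add0r.
rewrite cond_expectD cond_expectZ cond_expect_score_diff_sqr// cond_expect_cst//.
set EU := cond_expect _ _ _ _ U; move=> hEU.
rewrite -/U -/EU -[smoothed e y w l g]/(F (x / Num.sqrt v)).
set V := cond_var m delta0 l g.
have -> : EU - F (x / Num.sqrt v) =
   (EU + (H * nu0 * (lambda * w) ^+ 2 * V + - (F (x / Num.sqrt v) + H * tau)))
   - H * (tau * (nu0 * lambda ^+ 2 * V - 1)) by rewrite /tau; ring.
apply: le_trans (ler_normB _ _) _; apply: lerD; first exact: hEU.
rewrite lambda_sqr normrM; apply: ler_pM => //.
  rewrite /H normrM (ger0_norm (_ : 0 <= 2^-1))// [X in _ * X]normrM.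
  rewrite (gtr0_norm (_ : 0 < v^-1)) ?invr_gt0//.
  rewrite mulrCA; apply: ler_pM; first exact: normr_ge0.
  - by rewrite mulr_ge0// invr_ge0 ltW.
  - exact: (xf_le (x / Num.sqrt v)).
  rewrite -[leRHS]mul1r; apply: ler_pM; rewrite ?invr_ge0 ?(ltW v0)//.
    by rewrite invf_le1// ler1n.
  by rewrite lef_pV2 ?posrE//; lra.
rewrite normrM (ger0_norm tau0); apply: ler_wpM2l => //.
have -> : m%:R / nu0 * V - 1 = m%:R / nu0 * (V - nu0 / m%:R).
  by field; rewrite !gt_eqF.
by rewrite normrM ger0_norm// divr_ge0// ltW.
Qed.

Let smoothed_telescope (e y w C : R) (u : nat -> R) N :
  (forall l g, (l < N)%N -> valid_net m l g ->
    `|cond_expect m delta0 l g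
      (fun j => smoothed e y w l.+1 (rcons g (new_vertex m l, j)))
    - smoothed e y w l g| <= C + u l * `|cond_var m delta0 l g - nu0 / m%:R|) ->
  `|E N (smoothed e y w N) - smoothed e y w 0 (nseq m (1, 0)%N)| <=
  \sum_(l < N) (C + u l * E l (fun g => `|cond_var m delta0 l g - nu0 / m%:R|)).
Proof.
elim: N => [|N IH] h.
  by rewrite big_ord0 (expect0 m_gt0 hJ) subrr normr0.
rewrite big_ord_recr /=; apply: le_trans (ler_distD (E N (smoothed e y w N)) _ _) _.
rewrite [leLHS]addrC; apply: lerD; first by apply: IH => l g lN; apply: h;
  exact: ltnW.
rewrite (expectS m_gt0 hJ) -expectB.
apply: le_trans (ler_norm_expect _ _ _ _) _.
rewrite -[X in _ <= X + _](expect_cst m_gt0 hJ N) -expectZ -expectD.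
by apply: expect_le => // g hg; exact: h.
Qed.

(** With [w = 1 / sqrt N] the cubic errors of [N] steps add up to [C * w]. The mean variance
    mismatch at step [l] is [e1 + O(1 / sqrt (l + 1))], which with weight [w ^ 2] adds up to
    [M * e1 + O(w)]. *)
Lemma clt_smooth (e y eps : R) : 0 < e -> 0 < eps -> exists N0, forall N, (N0 <= N)%N ->
  `|E N (fun g => F ((y - lambda * (Num.sqrt N%:R)^-1 * Z N g) / Num.sqrt e))
    - F (y / Num.sqrt (e + 1))| <= eps.
Proof.
move=> e0 eps0.
have [C C0 step] := smoothed_step e0.
have [M M0 ME] : exists2 M : R, 0 <= M & M = B / e * (m%:R / nu0).
  exists (B / e * (m%:R / nu0)) => //.
  by apply: mulr_ge0; apply: divr_ge0 => //; exact: ltW.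
have [e1 e10 e1E] : exists2 e1, 0 < e1 & e1 = eps / (2 * (M + 1)).
  by exists (eps / (2 * (M + 1))) => //; rewrite divr_gt0// mulr_gt0// ltr_wpDl.
have [n [C1 C10 hvar]] := cond_var_approx m_gt0 delta0_gt p_law e10.
have [C2 C20 hdev] := expect_total_dev m_gt0 delta0_gt hJ p_law n.
pose C3 := C1 * (C2 + 1).
have C30 : 0 <= C3 by rewrite mulr_ge0// addr_ge0.
have hE l : E l (fun g => `|cond_var m delta0 l g - nu0 / m%:R|) <=
    e1 + C3 * (Num.sqrt l.+1%:R)^-1.
  set q := Num.sqrt l.+1%:R.
  have q0 : 0 < q by rewrite sqrtr_gt0 ltr0n.
  have q2 : q ^+ 2 = l.+1%:R by rewrite sqr_sqrtr.
  have q1 : 1 <= q by rewrite -[leLHS]sqrtr1 ler_sqrt ?ler1n.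
  apply: (@le_trans _ _ (E l (fun g =>
      (e1 + C1 / q ^+ 2) + C1 / q ^+ 2 * total_dev m delta0 p n l g))).
    apply: expect_le => // g hg; apply: le_trans (hvar l g hg) _.
    by rewrite q2 le_eqVlt; apply/orP; left; apply/eqP; ring.
  rewrite expectD (expect_cst m_gt0 hJ) expectZ -addrA lerD2l.
  have := hdev l; rewrite -/q => hd.
  apply: (@le_trans _ _ (C1 / q ^+ 2 * q + C1 / q ^+ 2 * (C2 * q))).
    apply: lerD; last by rewrite ler_wpM2l// divr_ge0// exprn_ge0// ltW.
    by rewrite ler_peMr// divr_ge0// exprn_ge0// ltW.
  rewrite le_eqVlt; apply/orP; left; apply/eqP; rewrite /C3; field.
  by rewrite gt_eqF.
clearbody C3; pose K := C + 2 * M * C3.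
have K0 : 0 <= K by rewrite addr_ge0// !mulr_ge0.
have [|N0 hN0] := @inv_sqrt_small R (Num.min 1 (eps / (2 * (K + 1)))).
  by rewrite lt_min ltr01 divr_gt0// mulr_gt0// ltr_wpDl.
exists N0 => N /hN0[N_gt0]; set w := (Num.sqrt N%:R)^-1.
rewrite le_min => /andP[w1 w2].
have q0 : 0 < Num.sqrt N%:R :> R by rewrite sqrtr_gt0 ltr0n.
have w0 : 0 < w by rewrite invr_gt0.
have Nw : N%:R * w ^+ 2 = 1.
  by rewrite exprVn sqr_sqrtr// mulfV// pnatr_eq0 -lt0n.
have := @smoothed_telescope e y w (C * w ^+ 3) (fun=> M * w ^+ 2) N.
rewrite /smoothed Nw score0 mulr0 subr0 mul0r subr0 addrK => H.
apply: le_trans (H _) _.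
  move=> l g lN hg; apply: le_trans (step y w l g hg w0 w1 _) _.
    apply: (@le_trans _ _ (N%:R * w ^+ 2)); last by rewrite Nw.
    by apply: ler_wpM2r; [exact/exprn_ge0/ltW | rewrite ler_nat].
  rewrite lerD2l le_eqVlt; apply/orP; left; apply/eqP; rewrite ME; ring.
apply: (@le_trans _ _ (\sum_(l < N) ((C * w ^+ 3 + M * w ^+ 2 * e1) +
    M * w ^+ 2 * C3 * (Num.sqrt l.+1%:R)^-1))).
  apply: ler_sum => l _; rewrite -addrA; apply: lerD => //.
  rewrite -[X in _ + X]mulrA -mulrDr; apply: ler_wpM2l => //.
  by rewrite mulr_ge0// exprn_ge0// ltW.
rewrite big_split /= sumr_const card_ord -mulr_sumr -[_ *+ N]mulr_natl.
have Nw1 : N%:R * w ^+ 3 = w by rewrite exprSr mulrA Nw mul1r.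
have s1 : M * w ^+ 2 * C3 * (\sum_(l < N) (Num.sqrt l.+1%:R)^-1) <= 2 * M * C3 * w.
  apply: (@le_trans _ _ (M * w ^+ 2 * C3 * (2 * Num.sqrt N%:R))).
    apply: ler_wpM2l; last exact: sum_inv_sqrt.
    by rewrite !mulr_ge0// ltW.
  rewrite le_eqVlt; apply/orP; left; apply/eqP; rewrite /w; field.
  by rewrite gt_eqF.
apply: (@le_trans _ _ (K * w + M * e1)).
  have -> : N%:R * (C * w ^+ 3 + M * w ^+ 2 * e1) = C * w + M * e1.
    transitivity (C * (N%:R * w ^+ 3) + M * e1 * (N%:R * w ^+ 2)); first by ring.
    by rewrite Nw1 Nw mulr1.
  by rewrite /K; lra.
have k1 : K * w <= eps / 2.
  apply: (@le_trans _ _ ((K + 1) * (eps / (2 * (K + 1))))).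
    by apply: ler_pM => //; [exact: ltW | rewrite lerDl].
  rewrite le_eqVlt; apply/orP; left; apply/eqP; field.
  by rewrite gt_eqF// ltr_wpDl.
have k2 : M * e1 <= eps / 2.
  apply: (@le_trans _ _ ((M + 1) * e1)); first by rewrite ler_pM2r// lerDl.
  rewrite le_eqVlt; apply/orP; left; apply/eqP; rewrite e1E; field.
  by rewrite gt_eqF// ltr_wpDl.
lra.
Qed.

Lemma normal_cdf_lipschitz x y : `|F y - F x| <= B * `|y - x|.
Proof.
apply: (@lipschitz_of_deriv _ F f).
  by move=> z _; exact: is_derive_normal_cdf.
by move=> z _; rewrite ger0_norm ?normal_pdf_ge0.
Qed.

(** The smoothing is removed by a sandwich: the indicator of [score <= x], after normalization, is
    compared with the smoothed indicators at [x + eta] and [x - eta]. *)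
Lemma clt_score (x eps : R) : 0 < eps -> exists N0, forall N, (N0 <= N)%N ->
  `|fine (P [set w | lambda * (Num.sqrt N%:R)^-1 * Z N (random_net m J N w) <= x])
    - F x| <= eps.
Proof.
move=> eps0; pose rho := eps / 4.
have rho0 : 0 < rho by rewrite divr_gt0.
have [A A0 [hA1 hA2]] : exists2 A : R, 0 < A & 1 - rho <= F A /\ F (- A) <= rho.
  have h1 := cvg_normal_cdfy (Num.sqrt nu0^-1);
    have h2 := cvg_normal_cdfNy (Num.sqrt nu0^-1).
  have h3 : F (- t) @[t --> +oo] --> (0 : R).
    by apply: (cvg_comp _ _ _ h2); rewrite ninfty.
  move/cvgrPdist_lt : h1 => /(_ _ rho0) h1.
  move/cvgrPdist_lt : h3 => /(_ _ rho0) h3.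
  near (pinfty_nbhs R) => A; exists A.
    by near: A; exact: nbhs_pinfty_gt.
  split.
    have : `|1 - F A| < rho by near: A.
    by move/ltr_normlW; lra.
  have : `|0 - F (- A)| < rho by near: A.
  by rewrite sub0r normrN => /ltr_normlW /ltW.
pose eta := Num.min 1 (Num.min A^-1 (rho / (B * (1 + `|x|) + 1))).
have eta0 : 0 < eta.
  by rewrite !lt_min ltr01 invr_gt0 A0 divr_gt0// ltr_wpDl// mulr_ge0// addr_ge0.
have eta1 : eta <= 1 by rewrite ge_min lexx.
have etaA : A <= eta^-1.
  by rewrite -[A]invrK lef_pV2 ?posrE ?invr_gt0// ge_min ge_min lexx orbT.
have etaB : B * (eta * (1 + `|x|)) <= rho.
  have : eta <= rho / (B * (1 + `|x|) + 1) by rewrite ge_min ge_min lexx !orbT.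
  have q0 : 0 <= B * (1 + `|x|) by rewrite mulr_ge0// addr_ge0.
  rewrite ler_pdivlMr; last by rewrite ltr_wpDl.
  by rewrite mulrCA mulrDr mulr1; lra.
pose e := eta ^+ 4.
have e0 : 0 < e by rewrite exprn_gt0.
have sqe : Num.sqrt e = eta ^+ 2.
  by rewrite /e (exprM eta 2 2) sqrtr_sqr ger0_norm// exprn_ge0// ltW.
have shift (t : R) : `|t| = eta -> `|F ((x + t) / Num.sqrt (e + 1)) - F x| <= rho.
  move=> ht; apply: le_trans (normal_cdf_lipschitz _ _) _; apply: le_trans etaB.
  apply: ler_wpM2l => //.
  set s := Num.sqrt (e + 1).
  have s1 : 1 <= s by rewrite -[leLHS]sqrtr1 ler_sqrt// ?lerDr ?addr_ge0// ltW.
  have s2 : s ^+ 2 = e + 1 by rewrite sqr_sqrtr// addr_ge0// ltW.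
  have se : s - 1 <= eta.
    apply: (@le_trans _ _ e); first by have := ler_pM (ler01) (ler01) s1 s1; nra.
    by rewrite /e exprS ler_piMr ?exprn_ile1// ltW.
  have s0 : 0 < s by lra.
  have -> : (x + t) / s - x = (t - x * (s - 1)) / s by field; rewrite gt_eqF.
  rewrite normrM normfV (gtr0_norm s0) ler_pdivrMr//.
  apply: le_trans (ler_normB _ _) _; rewrite ht normrM.
  have -> : `|s - 1| = s - 1 by rewrite ger0_norm// subr_ge0.
  have h1 : `|x| * (s - 1) <= `|x| * eta by rewrite ler_wpM2l.
  have h2 : 0 <= eta * (1 + `|x|) by rewrite mulr_ge0 ?addr_ge0// ltW.
  have h3 : eta * (1 + `|x|) <= eta * (1 + `|x|) * s by rewrite ler_peMr.
  by lra.
have [N1 hN1] := clt_smooth (x + eta) e0 rho0.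
have [N2 hN2] := clt_smooth (x - eta) e0 rho0.
exists (maxn N1 N2) => N; rewrite geq_max => /andP[/hN1 h1 /hN2 h2] {hN1 hN2}.
rewrite (prob_random_net m_gt0 hJ N
  (fun g => lambda * (Num.sqrt N%:R)^-1 * Z N g <= x)).
set Pr := expect _ _ _ _.
have etan : eta != 0 by rewrite gt_eqF.
have h3 := shift eta (ger0_norm (ltW eta0)).
have h4 := shift (- eta); rewrite normrN (ger0_norm (ltW eta0)) in h4.
have {h4} h4 := h4 erefl.
have up : (1 - rho) * Pr <= E N (fun g => F ((x + eta - lambda * (Num.sqrt N%:R)^-1 * Z N g)
    / Num.sqrt e)).
  rewrite /Pr -expectZ; apply: expect_le => // g _.
  case: (leP (lambda * (Num.sqrt N%:R)^-1 * Z N g) x) => h;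
    rewrite ?mulr1 ?mulr0 ?normal_cdf_ge0//.
  apply: le_trans hA1 _; apply: normal_cdf_nd; apply: le_trans etaA _.
  by rewrite sqe ler_pdivlMr ?exprn_gt0// expr2 mulrA mulVf// mul1r; lra.
have lo : E N (fun g => F ((x - eta - lambda * (Num.sqrt N%:R)^-1 * Z N g)
    / Num.sqrt e)) <= Pr + rho.
  rewrite /Pr -(expect_cst m_gt0 hJ N rho) -expectD; apply: expect_le => // g _.
  case: (leP (lambda * (Num.sqrt N%:R)^-1 * Z N g) x) => h; rewrite /= ?mulr0n ?add0r.
    by apply: (@le_trans _ _ 1); [exact: normal_cdf_le1 | rewrite lerDl ltW].
  apply: (le_trans _ hA2); apply: normal_cdf_nd.
  apply: (@le_trans _ _ (- eta^-1)); last by rewrite lerN2.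
  rewrite sqe ler_pdivrMr ?exprn_gt0// mulNr expr2 mulrA mulVf// mul1r; lra.
have Pr1 : Pr <= 1.
  rewrite -(expect_cst m_gt0 hJ N 1); apply: expect_le => // g _.
  by rewrite lern1 leq_b1.
move: h1 h2 h3 h4; rewrite !ler_distl => /andP[a1 a2] /andP[b1 b2] /andP[c1 c2] /andP[d1 d2].
have rE : eps = rho + rho + rho + rho by rewrite /rho; field.
have : rho * Pr <= rho * 1 by rewrite ler_pM2l.
by move=> hr; apply/andP; split; lra.
Unshelve. all: by end_near. Qed.

End central_limit_theorem.

(** * Linearization of the estimator *)

Section argmax.
Context {R : realType}.
Variables (m : nat) (delta0 : R) (p : nat -> R).
Hypothesis m_gt0 : (0 < m)%N.
Hypothesis delta0_gt : -1 < delta0.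
Hypothesis p_law : limit_degree_law m delta0 p.
Implicit Types (g : network) (s j n k : nat) (delta x y : R).

Local Notation r := (limit_tail m delta0 p).
Local Notation tt s := ((new_vertex m s)%:R : R).
Local Notation L := (net_log_likelihood m).

Definition slope s g delta : R :=
  choice_sum m s (fun k => (k%:R + delta)^-1) g -
  \sum_(l < s) tt l / edge_weight m l delta.

(** Minus the divided difference of [slope] between [delta0] and [delta], with the factor
    [delta - delta0] cancelled; hence it is also defined at [delta0], where it is minus the
    derivative of [slope]. *)
Definition curvature s g delta : R :=
  choice_sum m s (fun k => ((k%:R + delta) * (k%:R + delta0))^-1) g -
  \sum_(l < s) (tt l / edge_weight m l delta) * (tt l / edge_weight m l delta0).

Let m_ge1 : 1 <= m%:R :> R. Proof. by rewrite ler1n. Qed.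

Let m_pos : 0 < m%:R :> R. Proof. by rewrite ltr0n. Qed.

Let kD_gt0 k delta : -1 < delta -> (m <= k)%N -> 0 < k%:R + delta.
Proof.
move=> d1 mk; have : m%:R <= k%:R :> R by rewrite ler_nat.
by move: m_ge1; lra.
Qed.

(* This identity is exact: it replaces a Taylor expansion of the slope at
   [delta0], and positivity of the curvature over the whole parameter set gives
   consistency of the estimator together with its rate. *)
Lemma slopeE s g delta : -1 < delta ->
  slope s g delta = score m delta0 s g - (delta - delta0) * curvature s g delta.
Proof.
move=> d1; rewrite /slope /score /curvature mulrBr opprB.
rewrite -choice_sumZ mulr_sumr.
have -> : choice_sum m s (fun k => (k%:R + delta)^-1) g =
  choice_sum m s (fun k => (k%:R + delta0)^-1) g -
  choice_sum m s (fun k => (delta - delta0) * ((k%:R + delta) * (k%:R + delta0))^-1) g.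
  rewrite -[X in _ = _ + X]mulN1r -choice_sumZ -choice_sumD.
  apply: eq_choice_sum => k mk.
  have a1 := kD_gt0 d1 mk; have a2 := kD_gt0 delta0_gt mk.
  by field; rewrite !gt_eqF.
have -> : \sum_(l < s) tt l / edge_weight m l delta =
  \sum_(l < s) tt l / edge_weight m l delta0 -
  \sum_(l < s) (delta - delta0) * (tt l / edge_weight m l delta *
     (tt l / edge_weight m l delta0)).
  rewrite -sumrB; apply: eq_bigr => l _.
  have a1 := edge_weight_gt0 l m_gt0 d1; have a2 := edge_weight_gt0 l m_gt0 delta0_gt.
  have -> : delta - delta0 =
     (edge_weight m l delta - edge_weight m l delta0) / tt l.
    rewrite /edge_weight; field; by rewrite pnatr_eq0.
  have t0 : tt l != 0 by rewrite pnatr_eq0.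
  by field; rewrite t0 !gt_eqF.
ring.
Qed.

Lemma ln_sub_ge x y : 0 < x -> 0 < y -> (y - x) / y <= ln y - ln x.
Proof.
move=> x0 y0; have h : x / y = 1 + (x / y - 1) by rewrite addrC subrK.
have xy0 : 0 < x / y by rewrite divr_gt0.
have := @le_ln1Dx R (x / y - 1); rewrite -h ln_div ?posrE// => /(_ _) H.
have {}H : ln x - ln y <= x / y - 1 by apply: H; lra.
have -> : (y - x) / y = 1 - x / y by field; rewrite gt_eqF.
lra.
Qed.

Lemma ln_sub_le x y : 0 < x -> 0 < y -> ln y - ln x <= (y - x) / x.
Proof.
move=> x0 y0; have := ln_sub_ge y0 x0.
by rewrite -(opprB y) mulNr; lra.
Qed.

(** Concavity of [ln] is used in opposite ways: the subtracted weight terms lie below their tangents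
    at [x], while [ln (k + y) - ln (k + x)] is at least [(y - x) / (k + y)], which equals the
    tangent increment minus the quadratic term. *)
Lemma net_log_likelihood_sub_ge s g x y : -1 < x -> -1 < y -> valid_net m s g ->
  (y - x) * slope s g x -
    (y - x) ^+ 2 * choice_sum m s (fun k => ((k%:R + x) * (k%:R + y))^-1) g
  <= L s g y - L s g x.
Proof.
move=> x1 y1 hg; rewrite /net_log_likelihood /slope.
have h1 : choice_sum m s (fun k => (y - x) * (k%:R + x)^-1 -
     (y - x) ^+ 2 * ((k%:R + x) * (k%:R + y))^-1) g <=
   choice_sum m s (fun k => ln (k%:R + y) - ln (k%:R + x)) g.
  apply: le_choice_sum => k mk.
  have a1 := kD_gt0 x1 mk; have a2 := kD_gt0 y1 mk.
  apply: le_trans (ln_sub_ge a1 a2).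
  rewrite le_eqVlt; apply/orP; left; apply/eqP.
  by field; rewrite !gt_eqF.
have subE (f1 f2 : nat -> R) : choice_sum m s (fun k => f1 k - f2 k) g =
   choice_sum m s f1 g - choice_sum m s f2 g.
  rewrite -[- choice_sum _ _ f2 _]mulN1r -choice_sumZ -choice_sumD.
  by apply: eq_choice_sum => k _; rewrite mulN1r.
move: h1; rewrite !subE !choice_sumZ => h1.
have h2 : \sum_(l < s) ln (total_weight m (new_vertex m l) (l %% m) y) -
    \sum_(l < s) ln (total_weight m (new_vertex m l) (l %% m) x) <=
    (y - x) * \sum_(l < s) tt l / edge_weight m l x.
  rewrite -sumrB mulr_sumr; apply: ler_sum => l _; rewrite !total_weightE.
  have a1 := edge_weight_gt0 l m_gt0 x1; have a2 := edge_weight_gt0 l m_gt0 y1.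
  apply: le_trans (ln_sub_le a1 a2) _.
  rewrite le_eqVlt; apply/orP; left; apply/eqP; rewrite mulrA; congr (_ / _).
  by rewrite /edge_weight; ring.
rewrite mulrBr; lra.
Qed.

(** First-order condition on an interval, valid also at an endpoint: if the product were positive, a
    small move from [x] towards [y] would increase the likelihood. *)
Lemma argmax_slope (al be : R) s g x y : -1 < al -> valid_net m s g ->
  is_argmax (L s g) `[al, be] x -> al <= y <= be -> (y - x) * slope s g x <= 0.
Proof.
move=> al1 hg [+ xmax] yD; rewrite /= in_itv /= => xD.
rewrite leNgt; apply/negP => A0; set A := (y - x) * _ in A0.
pose C := s%:R / (m%:R + al) ^+ 2.
have ma : 0 < m%:R + al by exact: kD_gt0.
have C0 : 0 <= C by rewrite divr_ge0// exprn_ge0// ltW.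
pose Q := (y - x) ^+ 2 * C.
have Q0 : 0 <= Q by rewrite mulr_ge0// sqr_ge0.
(* The gain [t * A] of the move then exceeds the quadratic loss, which is at most
   [t * (t * Q) <= t * A / 2]. *)
pose t := Num.min 1 (A / (2 * (Q + 1))).
have t0 : 0 < t.
  by rewrite lt_min ltr01 divr_gt0// mulr_gt0// ltr_wpDl.
have t1 : t <= 1 by rewrite ge_min lexx.
have t2 : t * Q <= A / 2.
  apply: (@le_trans _ _ (A / (2 * (Q + 1)) * (Q + 1))).
    by apply: ler_pM => //; [exact: ltW | rewrite ge_min lexx orbT | rewrite lerDl].
  rewrite le_eqVlt; apply/orP; left; apply/eqP; field.
  by rewrite gt_eqF// ltr_wpDl.
pose z := x + t * (y - x).
have zD : al <= z <= be by rewrite /z; apply/andP; split; nra.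
have hz := xmax z; rewrite /= in_itv /= zD in hz; have {}hz := hz isT.
have x1 : -1 < x by case/andP: xD => xD _; exact: lt_le_trans xD.
have z1 : -1 < z by case/andP: zD => zD _; exact: lt_le_trans zD.
have := net_log_likelihood_sub_ge x1 z1 hg.
have zx : z - x = t * (y - x) by rewrite /z; ring.
set cs := choice_sum _ _ _ _.
have hcs : cs <= C.
  rewrite /C mulrC; apply: le_trans (ler_norm _) _.
  apply: norm_choice_sum_le => // k mk.
  have a1 := kD_gt0 x1 mk; have a2 := kD_gt0 z1 mk.
  have mk' : m%:R <= k%:R :> R by rewrite ler_nat.
  rewrite ger0_norm ?invr_ge0 ?mulr_ge0 ?(ltW a1) ?(ltW a2)//.
  rewrite lef_pV2 ?posrE ?mulr_gt0 ?exprn_gt0// expr2.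
  by apply: ler_pM; rewrite ?(ltW ma)//; move: xD zD => /andP[? ?] /andP[? ?]; lra.
rewrite zx => H.
have h2 : (t * (y - x)) ^+ 2 * cs <= t * (t * Q).
  have -> : t * (t * Q) = (t * (y - x)) ^+ 2 * C by rewrite /Q; ring.
  by rewrite ler_wpM2l// sqr_ge0.
have h3 : t * (t * Q) <= t * (A / 2) by rewrite ler_pM2l.
have h4 : t * (y - x) * slope s g x = t * A by rewrite /A mulrA.
have h5 : 0 < t * A by rewrite mulr_gt0.
have h6 : t * (A / 2) = t * A / 2 by rewrite mulrA.
by lra.
Qed.

(** Curvature per vertex, that is per [m] choices, in the limit and truncated at [m + n]; at
    [delta0] it is the truncation of [nu]. *)
Definition curvature_limit n delta : R :=
  \sum_(m <= k < m + n) r k / ((k%:R + delta) * (k%:R + delta0)) -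
  m%:R / ((2 * m%:R + delta) * (2 * m%:R + delta0)).

Lemma curvature_approx (al : R) : -1 < al -> exists2 C, 0 <= C &
  forall n s g delta, valid_net m s g -> al <= delta ->
  `|curvature s g delta - s%:R / m%:R * curvature_limit n delta| <=
  C * (total_dev m delta0 p n s g + Num.sqrt s%:R)
  + ((m + n)%:R + al)^-1 * (m%:R + delta0)^-1 * s%:R.
Proof.
move=> al1.
have ma : 0 < m%:R + al by exact: kD_gt0.
have md : 0 < m%:R + delta0 by exact: kD_gt0.
pose B := (m%:R + al)^-1 * (m%:R + delta0)^-1.
have B0 : 0 <= B by rewrite mulr_ge0// invr_ge0 ltW.
pose C1 := 2 * m%:R ^+ 2 / (m%:R + al) * (m%:R + delta0)^-1 +
  2 * m%:R ^+ 2 / (m%:R + delta0).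
have C10 : 0 <= C1.
  by rewrite addr_ge0 ?mulr_ge0 ?invr_ge0 ?exprn_ge0 ?(ltW ma) ?(ltW md).
exists (B + 2 * C1) => [|n s g delta hg ald]; first by apply: addr_ge0 => //;
  exact: mulr_ge0.
have d1 : -1 < delta by exact: lt_le_trans ald.
have fb j k : (m <= j)%N -> (j <= k)%N ->
   `|((k%:R + delta) * (k%:R + delta0))^-1| <= (j%:R + al)^-1 * (m%:R + delta0)^-1.
  move=> mj jk; have mk := leq_trans mj jk.
  have a1 := kD_gt0 d1 mk; have a2 := kD_gt0 delta0_gt mk; have a3 := kD_gt0 al1 mj.
  have jk' : j%:R <= k%:R :> R by rewrite ler_nat.
  have mk' : m%:R <= k%:R :> R by rewrite ler_nat.
  rewrite ger0_norm; last by rewrite invr_ge0 mulr_ge0// ltW.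
  rewrite -invfM lef_pV2 ?posrE ?mulr_gt0//.
  by apply: ler_pM; rewrite ?(ltW a3) ?(ltW md)//; lra.
(* Each summand is [O(1 / (l + 1))]; the weaker order [1 / sqrt (l + 1)] suffices and allows
   [sum_inv_sqrt]. *)
have hsum : `|\sum_(l < s) (tt l / edge_weight m l delta * (tt l / edge_weight m l delta0)
    - ((2 * m%:R + delta) * (2 * m%:R + delta0))^-1)| <= C1 * (2 * Num.sqrt s%:R).
  apply: le_trans (ler_norm_sum _ _ _) _.
  apply: (@le_trans _ _ (\sum_(l < s) C1 * (Num.sqrt l.+1%:R)^-1)); last first.
    by rewrite -mulr_sumr ler_wpM2l// sum_inv_sqrt.
  apply: ler_sum => l _.
  have u1 := new_vertex_div_weight m_gt0 l d1.
  have u2 := new_vertex_div_weight m_gt0 l delta0_gt.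
  have w1 := edge_weight_gt0 l m_gt0 d1; have w2 := edge_weight_gt0 l m_gt0 delta0_gt.
  have v0 : 0 <= tt l / edge_weight m l delta0 by rewrite divr_ge0// ltW.
  have v1 : tt l / edge_weight m l delta0 <= (m%:R + delta0)^-1.
    by rewrite ler_pdivrMr// ler_pdivlMl//; exact: edge_weight_ge.
  have c1 : 0 < 2 * m%:R + delta by move: m_ge1; lra.
  have c2 : (2 * m%:R + delta)^-1 <= 1 by rewrite invf_le1//; move: m_ge1; lra.
  have q0 : 0 < Num.sqrt l.+1%:R :> R by rewrite sqrtr_gt0 ltr0n.
  have q1 : 1 <= Num.sqrt l.+1%:R :> R by rewrite -[leLHS]sqrtr1 ler_sqrt ?ler1n.
  have q2 : l.+1%:R^-1 <= (Num.sqrt l.+1%:R)^-1 :> R.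
    rewrite lef_pV2 ?posrE ?ltr0n// -[leRHS](sqr_sqrtr (ler0n _ _)) expr2.
    by rewrite ler_peMl// ltW.
  rewrite invfM; set u := tt l / _ in u1 *; set u0 := tt l / _ in u2 v0 v1 *.
  set c := _^-1 in u1 c2 *; set c0 := (2 * m%:R + delta0)^-1 in u2 *.
  have -> : u * u0 - c * c0 = (u - c) * u0 + c * (u0 - c0) by ring.
  apply: le_trans (ler_normD _ _) _; rewrite [leRHS]mulrDl; apply: lerD.
    rewrite normrM (ger0_norm v0) mulrAC; apply: ler_pM => //.
    apply: le_trans u1 _; apply: ler_pM => //.
    - by rewrite divr_ge0 ?mulr_ge0 ?exprn_ge0// ltW// (kD_gt0 d1).
    - rewrite ler_wpM2l ?mulr_ge0 ?exprn_ge0// lef_pV2 ?posrE ?(kD_gt0 d1)//.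
      by rewrite lerD2l.
  rewrite normrM -[leRHS]mul1r; apply: ler_pM => //.
    by rewrite gtr0_norm ?invr_gt0.
  apply: le_trans u2 _; apply: ler_wpM2l => //.
  by rewrite divr_ge0 ?mulr_ge0 ?exprn_ge0// ltW.
have happ := @choice_sum_approx R m delta0 p n s
  (fun k => ((k%:R + delta) * (k%:R + delta0))^-1) B
  (((m + n)%:R + al)^-1 * (m%:R + delta0)^-1) g hg.
have {happ} happ : `|choice_sum m s (fun k => ((k%:R + delta) * (k%:R + delta0))^-1) g -
   s%:R / m%:R * \sum_(m <= k < m + n) ((k%:R + delta) * (k%:R + delta0))^-1 * r k| <=
   B * total_dev m delta0 p n s g + ((m + n)%:R + al)^-1 * (m%:R + delta0)^-1 * s%:R.
  apply: happ.
  - by move=> k /andP[mk _]; exact: fb.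
  - by move=> k mk; apply: fb => //; exact: leq_addr.
  - by rewrite mulr_ge0// invr_ge0 ltW// (kD_gt0 al1)// leq_addr.
rewrite /curvature /curvature_limit.
under [X in _ * (X - _)]eq_bigr do rewrite mulrC.
have -> : \sum_(l < s) tt l / edge_weight m l delta * (tt l / edge_weight m l delta0) =
  \sum_(l < s) (tt l / edge_weight m l delta * (tt l / edge_weight m l delta0)
    - ((2 * m%:R + delta) * (2 * m%:R + delta0))^-1) +
  s%:R * ((2 * m%:R + delta) * (2 * m%:R + delta0))^-1.
  by rewrite sumrB sumr_const card_ord [s%:R * _]mulr_natl subrK.
move: hsum happ; set S1 := \sum_(l < s) _; set S2 := choice_sum _ _ _ _.
set S3 := \sum_(m <= k < m + n) _.
set c := ((2 * m%:R + delta) * (2 * m%:R + delta0))^-1.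
move=> hsum happ.
have -> : S2 - (S1 + s%:R * c) - s%:R / m%:R * (S3 - m%:R * c) =
    (S2 - s%:R / m%:R * S3) - S1 by field; rewrite gt_eqF.
apply: le_trans (ler_normB _ _) _.
have D0 : 0 <= total_dev m delta0 p n s g by exact: total_dev_ge0.
have e1 : 0 <= C1 * total_dev m delta0 p n s g by rewrite mulr_ge0.
have e2 : 0 <= B * Num.sqrt s%:R by rewrite mulr_ge0.
move: hsum happ; lra.
Qed.

Lemma curvature_limit_near (al : R) : -1 < al -> exists2 C, 0 <= C &
  forall n delta, al <= delta ->
  `|curvature_limit n delta - curvature_limit n delta0| <= C * `|delta - delta0|.
Proof.
move=> al1.
have ma : 0 < m%:R + al by exact: kD_gt0.
have md : 0 < m%:R + delta0 by exact: kD_gt0.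
pose B := (m%:R + al)^-1 * (m%:R + delta0)^-1 ^+ 2.
have B0 : 0 <= B by rewrite mulr_ge0 ?exprn_ge0// invr_ge0 ltW.
exists (B * m%:R + m%:R) => [|n delta ald]; first by apply: addr_ge0 => //;
  exact: mulr_ge0.
have d1 : -1 < delta by exact: lt_le_trans ald.
rewrite /curvature_limit.
have -> (a b a' b' : R) : a - b - (a' - b') = (a - a') - (b - b') by ring.
apply: le_trans (ler_normB _ _) _; rewrite [leRHS]mulrDl; apply: lerD.
  rewrite -sumrB; apply: le_trans (ler_norm_sum _ _ _) _.
  apply: (@le_trans _ _ (\sum_(m <= k < m + n) B * `|delta - delta0| * r k));
    last first.
    rewrite -mulr_sumr [leRHS]mulrAC; apply: ler_wpM2l; first exact: mulr_ge0.
    exact: sum_limit_tail_le.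
  rewrite big_nat [leRHS]big_nat; apply: ler_sum => k /andP[mk _].
  have r0 := limit_tail_gt0 m_gt0 delta0_gt p_law k.
  have a1 := kD_gt0 d1 mk; have a2 := kD_gt0 delta0_gt mk.
  have -> : r k / ((k%:R + delta) * (k%:R + delta0)) -
     r k / ((k%:R + delta0) * (k%:R + delta0)) =
     (delta0 - delta) * ((k%:R + delta)^-1 * (k%:R + delta0)^-1 ^+ 2) * r k.
    by field; rewrite !gt_eqF.
  rewrite normrM (gtr0_norm r0) normrM distrC; apply: ler_wpM2r; first exact: ltW.
  rewrite mulrC; apply: ler_wpM2r => //.
  have mk' : m%:R <= k%:R :> R by rewrite ler_nat.
  rewrite ger0_norm; last first.
    by apply: mulr_ge0; rewrite ?exprn_ge0// invr_ge0 ltW.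
  rewrite /B; apply: ler_pM; rewrite ?invr_ge0 ?exprn_ge0 ?invr_ge0 ?(ltW a1) ?(ltW a2)//.
    by rewrite lef_pV2 ?posrE//; lra.
  apply: lerXn2r; rewrite ?nnegrE ?invr_ge0 ?(ltW a2) ?(ltW md)//.
  by rewrite lef_pV2 ?posrE//; lra.
have c1 : 1 <= 2 * m%:R + delta by move: m_ge1; lra.
have c2 : 1 <= 2 * m%:R + delta0 by move: m_ge1 delta0_gt; lra.
have -> : m%:R / ((2 * m%:R + delta) * (2 * m%:R + delta0)) -
    m%:R / ((2 * m%:R + delta0) * (2 * m%:R + delta0)) =
    m%:R * ((delta0 - delta) * ((2 * m%:R + delta)^-1 * (2 * m%:R + delta0)^-1 ^+ 2)).
  by field; rewrite !gt_eqF//; lra.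
rewrite normrM (gtr0_norm m_pos); apply: ler_wpM2l => //.
rewrite normrM distrC ler_piMr// ger0_norm; last first.
  by rewrite !mulr_ge0 ?invr_ge0 ?exprn_ge0//; lra.
apply: mulr_ile1; rewrite ?invr_ge0 ?exprn_ge0 ?invr_ge0//; try lra.
  by rewrite invf_le1//; lra.
by apply: exprn_ile1; rewrite ?invr_ge0 ?invf_le1//; lra.
Qed.

End argmax.

(** The deterministic core, stated for one network whose deviations and score are small; [q] is the
    curvature per edge at the maximizer. *)
Lemma mle_linear (R : realType) (m : nat) (delta0 : R) (p : nat -> R)
    (al be eps : R) :
  (0 < m)%N -> -1 < delta0 -> limit_degree_law m delta0 p ->
  -1 < al -> al < delta0 < be -> 0 < eps ->
  exists n, exists2 rho, 0 < rho & forall s g x, valid_net m s g -> (0 < s)%N ->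
    is_argmax (net_log_likelihood m s g) `[al, be] x ->
    total_dev m delta0 p n s g <= rho * s%:R ->
    `|score m delta0 s g| <= rho * s%:R ->
    Num.sqrt s%:R <= rho * s%:R ->
  exists2 q, score m delta0 s g = (x - delta0) * s%:R * q
    & `|q - nu m delta0 p / m%:R| <= eps.
Proof.
move=> m_gt0 delta0_gt p_law al1 /andP[ald dbe] eps0.
have m_ge1 : 1 <= m%:R :> R by rewrite ler1n.
have m_pos : 0 < m%:R :> R by rewrite ltr0n.
have ma : 0 < m%:R + al by move: m_ge1 al1; clear; lra.
have md : 0 < m%:R + delta0 by move: m_ge1 delta0_gt; lra.
have mb : 0 < m%:R + be by lra.
have c0 : 0 < 2 * m%:R + delta0 by move: m_ge1 delta0_gt; lra.
have cb : 0 < 2 * m%:R + be by move: m_ge1; lra.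
have [C C0 happ] := curvature_approx p m_gt0 delta0_gt al1.
have [C' C'0 hnear] := curvature_limit_near m_gt0 delta0_gt p_law al1.
have pm := limit_degree_law_gt0 m_gt0 delta0_gt p_law (leqnn m).
(* The atom term of [jensen_gap] decreases in [x], so its value at the right endpoint [be] bounds it
   below over the whole interval. *)
have [kb kb0 kbE] : exists2 kb : R, 0 < kb &
    kb = p m * m%:R ^+ 2 / ((m%:R + be) * (2 * m%:R + be) ^+ 2).
  exists (p m * m%:R ^+ 2 / ((m%:R + be) * (2 * m%:R + be) ^+ 2)) => //.
  by apply: divr_gt0; apply: mulr_gt0 => //; exact: exprn_gt0.
have [k1 k10 k1E] : exists2 k1 : R, 0 < k1 & k1 = m%:R / (2 * m%:R + delta0) * (kb / 2).
  exists (m%:R / (2 * m%:R + delta0) * (kb / 2)) => //.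
  by apply: mulr_gt0; apply: divr_gt0.
pose k := k1 / (2 * m%:R).
have k0 : 0 < k by rewrite divr_gt0// mulr_gt0.
(* The fluctuation and truncation errors of the curvature are each at most [e1] per edge. Together
   they use at most half of [k1 / m], which leaves [k]. *)
pose e1 := Num.min (k1 / (4 * m%:R)) (eps / 4).
have e10 : 0 < e1 by rewrite lt_min !divr_gt0// mulr_gt0.
have e1k : e1 <= k1 / (4 * m%:R) by rewrite ge_min lexx.
have e1e : e1 <= eps / 4 by rewrite ge_min lexx orbT.
have eps4 : 0 < eps / 4 by rewrite divr_gt0.
(* The bound [kb / 6] makes the loss of three tails in [jensen_gap] at most [kb / 2], whence the
   factor [kb / 2] in [k1]. *)
have [n [hn1 hn2 hn3]] : exists n, [/\ limit_tail m delta0 p (m + n) <= kb / 6,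
    ((m + n.+1)%:R + al)^-1 * (m%:R + delta0)^-1 <= e1 &
    `|nu m delta0 p - curvature_limit m delta0 p n.+1 delta0| <= eps / 4].
  have h1 := limit_tail_cvg0 m_gt0 delta0_gt p_law; rewrite -(cvg_shiftn m) in h1.
  have kb6 : 0 < kb / 6 by rewrite divr_gt0.
  move/cvgrPdist_lt : h1 => /(_ _ kb6) h1.
  have h2 := cvg_nu m_gt0 delta0_gt p_law.
  move/cvgrPdist_lt : h2 => /(_ _ eps4) h2.
  near \oo => n; exists n; split.
  - have : `|0 - limit_tail m delta0 p (n + m)%N| < kb / 6 by near: n.
    by rewrite sub0r normrN addnC => /ltr_normlW /ltW.
  - rewrite ler_pdivrMr// invf_ple ?posrE ?mulr_gt0//; last first.
      have : 0 <= n.+1%:R :> R by [].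
      by rewrite natrD; move: ma; clear; lra.
    have : (e1 * (m%:R + delta0))^-1 <= n%:R by near: n; exact: nbhs_infty_ger.
    by rewrite natrD -natr1; move: m_ge1 al1; clear; lra.
  - apply/ltW; rewrite /curvature_limit -[(2 * m%:R + delta0) * _]expr2.
    by near: n.
pose gap := Num.min (delta0 - al) (be - delta0).
have gap0 : 0 < gap by rewrite lt_min !subr_gt0 ald.
have gap1 : gap <= delta0 - al by rewrite ge_min lexx.
have gap2 : gap <= be - delta0 by rewrite ge_min lexx orbT.
(* The three bounds control the curvature error, force [rho / k < gap] so that the maximizer is
   interior, and keep the change of [curvature_limit] between [delta0] and [x] below [eps / 4]. *)
pose rho := Num.min (e1 / (2 * C + 1)) (Num.min (k * gap / 2) (k * eps / (4 * (C' + 1)))).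
have rho0 : 0 < rho.
  rewrite !lt_min; apply/and3P; split; apply: divr_gt0 => //.
  - by rewrite ltr_wpDl ?mulr_ge0.
  - exact: mulr_gt0.
  - exact: mulr_gt0.
  - by rewrite mulr_gt0// ltr_wpDl.
have rho1 : 2 * C * rho <= e1.
  have : rho <= e1 / (2 * C + 1) by rewrite ge_min lexx.
  rewrite ler_pdivlMr; last by rewrite ltr_wpDl ?mulr_ge0.
  by move: (ltW rho0); clear; lra.
have rho2 : rho <= k * gap / 2 by rewrite !ge_min lexx !orbT.
have rho3 : C' * rho <= k * eps / 4.
  have : rho <= k * eps / (4 * (C' + 1)) by rewrite !ge_min lexx !orbT.
  rewrite ler_pdivlMr; last by rewrite mulr_gt0// ltr_wpDl.
  by move: (ltW rho0); clear; lra.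
clearbody rho gap e1.
exists n.+1, rho => // s g x hg s_gt0 xmax hD hZ hs.
have s0 : 0 < s%:R :> R by rewrite ltr0n.
have sn0 : s%:R != 0 :> R by rewrite gt_eqF.
have mn0 : m%:R != 0 :> R by rewrite gt_eqF.
have [xal xbe] : al <= x /\ x <= be.
  by case: xmax => + _; rewrite /= in_itv /= => /andP[].
have x1 : -1 < x by exact: lt_le_trans xal.
set cv := curvature m delta0 s g x; set cl := curvature_limit m delta0 p n.+1 x.
set Z := score m delta0 s g in hZ *.
have cvE : `|cv - s%:R / m%:R * cl| <= (2 * C * rho + e1) * s%:R.
  apply: le_trans (happ n.+1 s g x hg xal) _; rewrite mulrDl; apply: lerD.
    rewrite -!mulrA mulrCA; apply: ler_wpM2l => //; move: hD hs; clear; lra.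
  by rewrite ler_pM2r.
have clk : k1 <= cl.
  have := jensen_gap m_gt0 delta0_gt p_law n x1;
    rewrite -/(curvature_limit m delta0 p n.+1 x).
  apply: le_trans; rewrite k1E; apply: ler_wpM2l; first by rewrite divr_ge0 ?ltW.
  have : kb <= p m * m%:R ^+ 2 / ((m%:R + x) * (2 * m%:R + x) ^+ 2).
    have mx : 0 < m%:R + x by move: m_ge1 x1; clear; lra.
    have m2x : 0 < 2 * m%:R + x by move: m_ge1 x1; clear; lra.
    rewrite kbE; apply: ler_wpM2l; first by rewrite mulr_ge0 ?exprn_ge0 ?ltW.
    rewrite lef_pV2 ?posrE ?mulr_gt0 ?exprn_gt0//.
    apply: ler_pM; rewrite ?exprn_ge0 ?(ltW mx) ?(ltW m2x)// ?lerD2l//.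
    by apply: lerXn2r; rewrite ?nnegrE ?(ltW m2x) ?(ltW cb)// lerD2l.
  by move: hn1; clear; lra.
have cvk : k * s%:R <= cv.
  have h1 : k1 / m%:R * s%:R <= s%:R / m%:R * cl.
    by rewrite mulrAC -mulrA mulrC ler_wpM2l// divr_ge0// ltW.
  have h2 : (2 * C * rho + e1) * s%:R <= (k1 / (2 * m%:R)) * s%:R.
    rewrite ler_pM2r//; have -> : k1 / (2 * m%:R) = k1 / (4 * m%:R) + k1 / (4 * m%:R).
      by field.
    by move: rho1 e1k; clear; lra.
  have h3 : k1 / m%:R * s%:R = k * s%:R + k1 / (2 * m%:R) * s%:R by rewrite /k; field.
  move: cvE; rewrite ler_distl => /andP[cv1 cv2]; move: cv1 h1 h2 h3; clear; lra.
have slx := slopeE m_gt0 delta0_gt s g x1; rewrite -/Z -/cv in slx.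
have key := argmax_slope m_gt0 al1 hg xmax.
(* At [y = delta0] the first-order inequality reads [(x - delta0) ^ 2 * cv <= (x - delta0) * Z], and
   [cv] is at least [k * s]. *)
have hxd : `|x - delta0| <= rho / k.
  have := key delta0; rewrite (ltW ald) (ltW dbe) slx => /(_ isT) h.
  have h1 : (x - delta0) ^+ 2 * (k * s%:R) <= (x - delta0) ^+ 2 * cv.
    by rewrite ler_wpM2l// sqr_ge0.
  have h2 : (x - delta0) * Z <= `|x - delta0| * (rho * s%:R).
    by apply: le_trans (ler_norm _) _; rewrite normrM ler_wpM2l.
  have h3 : `|x - delta0| * (`|x - delta0| * (k * s%:R)) <= `|x - delta0| * (rho * s%:R).
    rewrite mulrA -expr2 real_normK ?num_real//; move: h h1 h2; clear; lra.
  have [-> | xn0] := eqVneq x delta0; first by rewrite subrr normr0 divr_ge0// ltW.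
  have : `|x - delta0| * (k * s%:R) <= rho * s%:R.
    by move: h3; rewrite ler_pM2l// normr_gt0 subr_eq0.
  by rewrite mulrA ler_pM2r// ler_pdivlMr.
have hgap : `|x - delta0| < gap.
  apply: le_lt_trans hxd _; rewrite ltr_pdivrMr//.
  by apply: le_lt_trans rho2 _; move: (mulr_gt0 k0 gap0); clear; lra.
have [g1 g2] : al < x /\ x < be.
  by move: hgap; rewrite ltr_norml => /andP[]; move: gap1 gap2; clear => *; split;
    lra.
(* As [x] is interior, testing the first-order inequality at the two endpoints gives both signs. *)
have sl0 : slope m s g x = 0.
  have a1 := key al; rewrite lexx (ltW (lt_trans ald dbe)) in a1; have {}a1 := a1 isT.
  have a2 := key be; rewrite lexx (ltW (lt_trans ald dbe)) in a2; have {}a2 := a2 isT.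
  apply/eqP; rewrite eq_le; apply/andP; split.
    by move: a2; rewrite pmulr_rle0// subr_gt0.
  by move: a1; rewrite nmulr_rle0// subr_lt0.
exists (cv / s%:R).
  have -> : Z = (x - delta0) * cv by move: slx; rewrite sl0; clear; lra.
  by field.
have -> : cv / s%:R - nu m delta0 p / m%:R = (cv - s%:R / m%:R * cl) / s%:R +
  (cl - curvature_limit m delta0 p n.+1 delta0) / m%:R -
  (nu m delta0 p - curvature_limit m delta0 p n.+1 delta0) / m%:R.
  by clearbody cv cl; field; rewrite mn0.
apply: le_trans (ler_normB _ _) _.
have b1 : `|(cv - s%:R / m%:R * cl) / s%:R| <= eps / 2.
  rewrite normrM normfV (gtr0_norm s0) ler_pdivrMr//; apply: le_trans cvE _.
  by rewrite ler_pM2r//; move: rho1 e1e; clear; lra.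
have divm (u : R) : 0 <= u -> u / m%:R <= u.
  by move=> u0; rewrite ler_pdivrMr// ler_peMr.
have b2 : `|(cl - curvature_limit m delta0 p n.+1 delta0) / m%:R| <= eps / 4.
  rewrite normrM normfV (gtr0_norm m_pos); apply: le_trans (divm _ (normr_ge0 _)) _.
  apply: le_trans (hnear n.+1 x xal) _.
  apply: (@le_trans _ _ (C' * (rho / k))); first by rewrite ler_wpM2l.
  rewrite mulrA ler_pdivrMr//; apply: le_trans rho3 _.
  by rewrite [leRHS]mulrC mulrA.
have b3 : `|(nu m delta0 p - curvature_limit m delta0 p n.+1 delta0) / m%:R| <= eps / 4.
  rewrite normrM normfV (gtr0_norm m_pos); apply: le_trans (divm _ (normr_ge0 _)) _.
  exact: hn3.
have := ler_normD ((cv - s%:R / m%:R * cl) / s%:R)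
  ((cl - curvature_limit m delta0 p n.+1 delta0) / m%:R).
by move: b1 b2 b3; clear; lra.
Unshelve. all: by end_near. Qed.

(** * Probability of the exceptional event *)

Section good_event.
Context {d : measure_display} {T : measurableType d} {R : realType}.
Variable P : probability T R.
Variables (m : nat) (delta0 : R) (J : nat -> nat -> {RV P >-> nat}).
Variable p : nat -> R.
Hypothesis m_gt0 : (0 < m)%N.
Hypothesis delta0_gt : -1 < delta0.
Hypothesis hJ : pref_attachment m delta0 J.
Hypothesis p_law : limit_degree_law m delta0 p.

Local Notation E := (expect m J).

Lemma expect_score_sqr s :
  E s (fun g => score m delta0 s g ^+ 2) <= (m%:R + delta0)^-1 ^+ 2 * s%:R.
Proof.
set c := _^-1; elim: s => [|s IH].
  by rewrite (expect0 m_gt0 hJ) score0 expr0n mulr0.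
rewrite (expectS m_gt0 hJ) -natr1 mulrDr mulr1.
apply: (@le_trans _ _ (E s (fun g => score m delta0 s g ^+ 2 + c ^+ 2))); last first.
  by rewrite expectD (expect_cst m_gt0 hJ) lerD2r.
apply: expect_le => // g hg.
set Z := score m delta0 s g.
apply: (@le_trans _ _ (cond_expect m delta0 s g (fun j =>
   (Z ^+ 2 + c ^+ 2) + 2 * Z * score_diff m delta0 s g j))).
  apply: cond_expect_le => // j hj.
  rewrite (score_rcons _ m_gt0 hg hj) -/Z.
  have : score_diff m delta0 s g j ^+ 2 <= c ^+ 2.
    rewrite -[leLHS]real_normK ?num_real//; apply: lerXn2r; rewrite ?nnegrE//.
      exact: le_trans (norm_score_diff m_gt0 delta0_gt hg hj).
    exact: norm_score_diff.
  by move: (score_diff _ _ _ _ _) => X; rewrite sqrrD -mulr_natl; lra.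
rewrite cond_expectD cond_expect_cst// cond_expectZ cond_expect_score_diff//.
by rewrite mulr0 addr0.
Qed.

Lemma prob_le_add (A B C : set T) : measurable A -> measurable B -> measurable C ->
  A `<=` B `|` C -> fine (P A) <= fine (P B) + fine (P C).
Proof.
move=> mA mB mC sub; rewrite -fineD ?fin_num_measure//.
apply: fine_le; rewrite ?fin_numD ?fin_num_measure//.
apply: (@le_trans _ _ (P (B `|` C))).
  by apply: le_measure; rewrite ?inE//; exact: measurableU.
exact: measureU2.
Qed.

(* Away from this event the estimator is an interior critical point. *)
Definition bad_net n rho s g : Prop :=
  rho * s%:R <= total_dev m delta0 p n s g \/ rho * s%:R <= `|score m delta0 s g|.

(** Markov's inequality, in mean for the deviations and in mean square for the score, gives
    [O(1 / sqrt s)] and [O(1 / s)] against thresholds linear in [s]. *)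
Lemma prob_bad_net n (rho eta : R) : 0 < rho -> 0 < eta -> exists N0, forall s, (N0 <= s)%N ->
  fine (P [set w | bad_net n rho s (random_net m J s w)]) <= eta.
Proof.
move=> rho0 eta0; have [C C0 hC] := expect_total_dev m_gt0 delta0_gt hJ p_law n.
pose c := (m%:R + delta0)^-1.
have [K K0 KE] : exists2 K : R, 0 <= K & K = 2 * C / rho + c ^+ 2 / rho ^+ 2.
  exists (2 * C / rho + c ^+ 2 / rho ^+ 2) => //.
  apply: addr_ge0; apply: divr_ge0; rewrite ?sqr_ge0 ?mulr_ge0//; exact: ltW.
have [|N0 hN0] := @inv_sqrt_small R (eta / (K + 1)).
  by rewrite divr_gt0// ltr_wpDl.
exists N0 => s /hN0 [s_gt0 hs].
have s0 : 0 < s%:R :> R by rewrite ltr0n.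
have rs0 : 0 < rho * s%:R by rewrite mulr_gt0.
have mD : measurable [set w | rho * s%:R <= total_dev m delta0 p n s (random_net m J s w)].
  exact: (measurable_random_net m J s (fun g => rho * s%:R <= total_dev m delta0 p n s g)).
have mZ : measurable [set w | (rho * s%:R) ^+ 2 <= score m delta0 s (random_net m J s w) ^+ 2].
  exact: (measurable_random_net m J s (fun g => (rho * s%:R) ^+ 2 <= score m delta0 s g ^+ 2)).
have mB : measurable [set w | bad_net n rho s (random_net m J s w)].
  exact: (measurable_random_net m J s (bad_net n rho s)).
apply: le_trans (prob_le_add mB mD mZ _) _.
  move=> w /= [h|h]; [by left | right => /=].
  rewrite -[leRHS]real_normK ?num_real//.
  by apply: lerXn2r; rewrite ?nnegrE// ltW.
have h1 := markov_random_net m_gt0 hJ s rs0 (total_dev_ge0 m delta0 p n s).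
have rs2 : 0 < (rho * s%:R) ^+ 2 by rewrite exprn_gt0.
have h2 := markov_random_net m_gt0 hJ s rs2 (fun g => sqr_ge0 (score m delta0 s g)).
have h3 := hC s; have h4 := expect_score_sqr s; rewrite -/c in h4.
set q := Num.sqrt s%:R in hs.
have q0 : 0 < q by rewrite sqrtr_gt0.
have q2 : q ^+ 2 = s%:R by rewrite sqr_sqrtr// ltW.
have q1 : 1 <= q by rewrite -[leLHS]sqrtr1 ler_sqrt ?ler1n.
have h5 : Num.sqrt s.+1%:R <= 2 * q.
  rewrite -[leRHS]ger0_norm; last by rewrite mulr_ge0// ltW.
  rewrite -sqrtr_sqr ler_sqrt ?sqr_ge0// exprMn q2 -natr1.
  by have : 1 <= s%:R :> R; [rewrite ler1n | lra].
apply: le_trans (lerD h1 h2) _.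
apply: (@le_trans _ _ (C * (2 * q) / (rho * s%:R) + c ^+ 2 * s%:R / (rho * s%:R) ^+ 2)).
  apply: lerD; rewrite ler_pM2r ?invr_gt0//.
  by apply: le_trans h3 _; rewrite ler_wpM2l.
have -> : C * (2 * q) / (rho * s%:R) + c ^+ 2 * s%:R / (rho * s%:R) ^+ 2 =
   2 * C / rho * q^-1 + c ^+ 2 / rho ^+ 2 * (q^-1 * q^-1).
  by rewrite -q2; field; rewrite !gt_eqF.
apply: (@le_trans _ _ (K * q^-1)).
  rewrite KE [leRHS]mulrDl lerD2l; apply: ler_wpM2l.
    by apply: divr_ge0; rewrite ?sqr_ge0.
  by rewrite ler_piMl ?invr_ge0 ?(ltW q0)// invf_le1.
apply: (@le_trans _ _ ((K + 1) * (eta / (K + 1)))).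
  by apply: ler_pM => //; rewrite ?invr_ge0 ?(ltW q0)// lerDl.
by rewrite mulrCA mulfV ?mulr1// gt_eqF// ltr_wpDl.
Qed.

End good_event.

(** * Limit law of the estimator *)

(** Slutsky's argument with a multiplicative error: off the bad event [Z = u * X] with [u] within
    [e] of 1. Comparing with a fixed [x], this places the event [X <= x] between [Z <= x - e * |x|]
    and [Z <= x + e * |x|]. *)
Lemma mle_cdf_approx (R : realType) (d : measure_display) (T : measurableType d)
    (P : probability T R) (m : nat) (al be delta0 : R)
    (J : nat -> nat -> {RV P >-> nat}) (delta_hat : nat -> {RV P >-> R})
    (p : nat -> R) (x eps : R) :
  (0 < m)%N -> -1 < al -> al < delta0 < be -> pref_attachment m delta0 J ->
  (forall (n : nat) (w : T), (1 <= n)%N ->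
    is_argmax (log_likelihood m n (PA m (fun t i => J t i w) n))
              `[al, be] (delta_hat n w)) ->
  limit_degree_law m delta0 p -> 0 < eps ->
  \forall n \near \oo,
    `|fine (P [set w | Num.sqrt n%:R * (delta_hat n w - delta0) <= x])
      - normal_cdf (Num.sqrt (nu m delta0 p)^-1) x| <= eps.
Proof.
move=> m_gt0 al1 dD hJ hmle p_law eps0.
have delta0_gt : -1 < delta0 by case/andP: dD => h _; exact: lt_trans h.
set nu0 := nu m delta0 p; set F := normal_cdf _.
have nu0_gt0 : 0 < nu0 by exact: nu_gt0.
have m0 : 0 < m%:R :> R by rewrite ltr0n.
have eps4 : 0 < eps / 4 by rewrite divr_gt0.
have lip := normal_cdf_lipschitz m_gt0 delta0_gt p_law; rewrite -/nu0 -/F in lip.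
move: lip; set B := normal_peak _ * _ => lip.
have B0 : 0 <= B.
  by have := le_trans (normr_ge0 _) (lip 0 1); rewrite subr0 normr1 mulr1.
have Bx : 0 <= B * `|x| by rewrite mulr_ge0.
have [e [e0 e12 eB]] : exists e : R, [/\ 0 < e, e <= 2^-1 & B * (e * `|x|) <= eps / 4].
  exists (Num.min 2^-1 (eps / (4 * (B * `|x| + 1)))); split.
  - by rewrite lt_min invr_gt0 ltr0n divr_gt0// mulr_gt0// ltr_wpDl.
  - by rewrite ge_min lexx.
  - apply: (@le_trans _ _ (eps / (4 * (B * `|x| + 1)) * (B * `|x|))).
      rewrite mulrCA; apply: ler_wpM2r => //.
      by rewrite ge_min lexx orbT.
    apply: (@le_trans _ _ (eps / (4 * (B * `|x| + 1)) * (B * `|x| + 1))).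
      by rewrite ler_pM2l ?lerDl// divr_gt0// mulr_gt0// ltr_wpDl.
    rewrite le_eqVlt; apply/orP; left; apply/eqP; field.
    by rewrite gt_eqF// ltr_wpDl.
(* Multiplied by [m / nu0] this tolerance becomes [e / 2]; the other half absorbs the ratio
   [sqrt n / sqrt (n + 1)]. *)
have epsq0 : 0 < e / 2 * (nu0 / m%:R) by rewrite mulr_gt0// divr_gt0.
have [k [rho rho0 hlin]] := mle_linear m_gt0 delta0_gt p_law al1 dD epsq0.
have [N1 hN1] := prob_bad_net m_gt0 delta0_gt hJ p_law k rho0 eps4.
have [N2 hN2] := clt_score m_gt0 delta0_gt hJ p_law (x + e * `|x|) eps4.
have [N3 hN3] := clt_score m_gt0 delta0_gt hJ p_law (x - e * `|x|) eps4.
have [N4 hN4] := inv_sqrt_small rho0.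
have [|N5 hN5] := @inv_sqrt_small R (e / 2); first by rewrite divr_gt0.
exists (maxn N1 (maxn N2 (maxn N3 (maxn N4 N5)))).+1 => // -[//|n] /=.
rewrite ltnS !geq_max => /andP[n1 /andP[n2 /andP[n3 /andP[n4 n5]]]].
set s := (n * m)%N.
have ns : (n <= s)%N by rewrite leq_pmulr.
have {hN1} hN1 := hN1 s (leq_trans n1 ns).
have {hN2} hN2 := hN2 s (leq_trans n2 ns).
have {hN3} hN3 := hN3 s (leq_trans n3 ns).
have [s_gt0 {hN4} hN4] := hN4 s (leq_trans n4 ns).
have [n_gt0 {hN5} hN5] := hN5 n n5.
have n0 : 0 < n%:R :> R by rewrite ltr0n.
have s0 : 0 < s%:R :> R by rewrite ltr0n.
pose G w := random_net m J s w.
pose X w := Num.sqrt n.+1%:R * (delta_hat n.+1 w - delta0).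
pose Z w := clt_scale m delta0 p * (Num.sqrt s%:R)^-1 * score m delta0 s (G w).
have hGX w : ~ bad_net m delta0 p k rho s (G w) ->
    exists2 u, Z w = u * X w & `|u - 1| <= e.
  rewrite /bad_net => /not_orP[/negP + /negP]; rewrite -!ltNge => /ltW hD /ltW hZ.
  have hg : valid_net m s (G w).
    by apply: nets_valid => //; exact: (random_net_nets m_gt0 hJ).
  have hmax : is_argmax (net_log_likelihood m s (G w)) `[al, be] (delta_hat n.+1 w).
    have [h1 h2] := hmle n.+1 w isT; split=> // y /h2.
    have GE : PA m (fun t i => J t i w) n.+1 = G w by rewrite PA_net.
    by rewrite GE !log_likelihood_net// ler_pM2l// invr_gt0 ltr0n.
  have hs : Num.sqrt s%:R <= rho * s%:R.
    have q0 : 0 < Num.sqrt s%:R :> R by rewrite sqrtr_gt0.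
    rewrite -[s%:R in leRHS](sqr_sqrtr (ltW s0)) expr2 mulrA ler_peMl ?(ltW q0)//.
    by rewrite -ler_pdivrMr// mul1r.
  have [q qE hq] := hlin s (G w) _ hg s_gt0 hmax hD hZ hs.
  have sn : 0 < Num.sqrt n%:R :> R by rewrite sqrtr_gt0.
  have sn1 : 0 < Num.sqrt n.+1%:R :> R by rewrite sqrtr_gt0.
  have sm : 0 < Num.sqrt m%:R :> R by rewrite sqrtr_gt0.
  (* The last ratio occurs because only [n * m] choices have been made at time [n + 1]. *)
  exists (m%:R / nu0 * q * (Num.sqrt n%:R / Num.sqrt n.+1%:R)).
    rewrite /Z /X qE /clt_scale -/nu0 /s natrM sqrtrM//.
    rewrite -[n%:R in X in X * q](sqr_sqrtr (ltW n0)).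
    rewrite -[m%:R in X in X * q](sqr_sqrtr (ltW m0)).
    rewrite -[m%:R in RHS](sqr_sqrtr (ltW m0)).
    by field; rewrite !gt_eqF.
  set t := Num.sqrt _ / _.
  have t0 : 0 < t by rewrite divr_gt0.
  have t1 : t <= 1 by rewrite ler_pdivrMr// mul1r ler_sqrt// ler_nat.
  have t2 : 1 - e / 2 <= t.
    apply: (@le_trans _ _ (t ^+ 2)); last first.
      by rewrite expr2 ler_piMl// ltW.
    rewrite expr_div_n !sqr_sqrtr// ler_pdivlMr// mulrBl mul1r.
    have h : 1 <= e / 2 * n.+1%:R.
      rewrite -ler_pdivrMr// mul1r; apply: le_trans hN5.
      rewrite lef_pV2 ?posrE//.
      have q1 : 1 <= Num.sqrt n%:R :> R by rewrite -[leLHS]sqrtr1 ler_sqrt// ler1n.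
      apply: (@le_trans _ _ n%:R); last by rewrite ler_nat.
      by rewrite -[leRHS](sqr_sqrtr (ltW n0)) expr2 ler_peMl// ltW.
    by move: h; rewrite -natr1; clear; lra.
  have hv : `|m%:R / nu0 * q - 1| <= e / 2.
    have -> : m%:R / nu0 * q - 1 = m%:R / nu0 * (q - nu0 / m%:R).
      by field; rewrite !gt_eqF.
    have mn : 0 < m%:R / nu0 by rewrite divr_gt0.
    rewrite normrM (gtr0_norm mn).
    apply: (@le_trans _ _ (m%:R / nu0 * (e / 2 * (nu0 / m%:R)))).
      by rewrite ler_pM2l.
    rewrite le_eqVlt; apply/orP; left; apply/eqP.
    by field; rewrite !gt_eqF.
  move: hv; rewrite !ler_norml => /andP[v1 v2].
  move: t0 t1 t2 v1 v2 e0 e12; clear; set v := m%:R / nu0 * q; clearbody v t => *.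
  apply/andP; split; nra.
have bound u y : `|u - 1| <= e -> `|u * y - y| <= e * `|y|.
  move=> h; have -> : u * y - y = (u - 1) * y by ring.
  by rewrite normrM ler_wpM2r.
have mX : measurable [set w | X w <= x].
  have mf : measurable_fun setT X.
    by apply: measurable_realfun.measurable_funM => //;
      exact: measurable_realfun.measurable_funB.
  rewrite (_ : [set _ | _] = setT `&` X @^-1` `]-oo, x]).
    exact: mf.
  by apply/seteqP; split => w /=; rewrite in_itv //= => -[].
have mZ y : measurable [set w | Z w <= y].
  exact: (measurable_random_net m J s
    (fun g => clt_scale m delta0 p * (Num.sqrt s%:R)^-1 * score m delta0 s g <= y)).
have mbad : measurable [set w | bad_net m delta0 p k rho s (G w)].
  exact: (measurable_random_net m J s (bad_net m delta0 p k rho s)).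
have up := prob_le_add P mX (mZ (x + e * `|x|)) mbad.
have lo := prob_le_add P (mZ (x - e * `|x|)) mX mbad.
have {}up : fine (P [set w | X w <= x]) <= fine (P [set w | Z w <= x + e * `|x|]) +
    fine (P [set w | bad_net m delta0 p k rho s (G w)]).
  apply: up => w /= Xx; have [hb|hb] := pselect (bad_net m delta0 p k rho s (G w)).
    by right.
  left; have [u -> hu] := hGX w hb.
  have u0 : 0 <= u by move: hu; rewrite ler_norml => /andP[+ _]; move: e12; clear;
    lra.
  have := bound u x hu; rewrite ler_norml => /andP[_ h].
  by move: (ler_wpM2l u0 Xx) h; clear; lra.
have {}lo : fine (P [set w | Z w <= x - e * `|x|]) <= fine (P [set w | X w <= x]) +
    fine (P [set w | bad_net m delta0 p k rho s (G w)]).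
  apply: lo => w /= Zx; have [hb|hb] := pselect (bad_net m delta0 p k rho s (G w)).
    by right.
  left; have [u uE hu] := hGX w hb; rewrite /= leNgt; apply/negP => xX.
  have u0 : 0 < u by move: hu; rewrite ler_norml => /andP[+ _]; move: e12; clear; lra.
  have := bound u x hu; rewrite ler_norml => /andP[h _].
  have : u * x < u * X w by rewrite ltr_pM2l.
  by move: h Zx; rewrite uE; clear; lra.
have l1 := lip x (x + e * `|x|); have l2 := lip x (x - e * `|x|).
rewrite addrAC subrr add0r in l1; rewrite addrAC subrr add0r normrN in l2.
have ex0 : 0 <= e * `|x| by rewrite mulr_ge0// ltW.
rewrite (ger0_norm ex0) in l1 l2.
have {}l1 := le_trans l1 eB; have {}l2 := le_trans l2 eB.
have {}hN1 : fine (P [set w | bad_net m delta0 p k rho s (G w)]) <= eps / 4 by [].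
have {}hN2 : `|fine (P [set w | Z w <= x + e * `|x|]) - F (x + e * `|x|)| <= eps / 4 by [].
have {}hN3 : `|fine (P [set w | Z w <= x - e * `|x|]) - F (x - e * `|x|)| <= eps / 4 by [].
suff : `|fine (P [set w | X w <= x]) - F x| <= eps by [].
move: hN1 hN2 hN3 l1 l2 up lo; rewrite !ler_distl.
move: (fine (P [set w | X w <= x])) (fine (P [set w | Z w <= x + e * `|x|]))
  (fine (P [set w | Z w <= x - e * `|x|]))
  (fine (P [set w | bad_net m delta0 p k rho s (G w)]))
  (F x) (F (x + e * `|x|)) (F (x - e * `|x|)); clear.
move=> P1 P2 P3 P4 f1 f2 f3 h1 /andP[a1 a2] /andP[b1 b2] /andP[c1 c2] /andP[d1 d2] up lo.
by apply/andP; split; lra.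
Qed.

(** The first two conclusions certify that [nu] is the value of a convergent series and that the
    normal law is nondegenerate, since the limit and the square root are total functions with
    default values. *)
Theorem proposition4 (R : realType) (d : measure_display) (T : measurableType d)
    (P : probability T R) (m : nat) (a b delta0 : R)
    (J : nat -> nat -> {RV P >-> nat}) (delta_hat : nat -> {RV P >-> R})
    (p : nat -> R)
    (hm : (1 <= m)%N) (ha : -1 < - a) (hab : - a < b)
    (hdelta0 : - a < delta0 < b)
    (hJ : pref_attachment m delta0 J)
    (hmle : forall (n : nat) (w : T), (1 <= n)%N ->
       is_argmax (log_likelihood m n (PA m (fun t i => J t i w) n))
                 `[- a, b] (delta_hat n w))
    (hp : limit_degree_law m delta0 p) :
  [/\ cvgn (fun N => \sum_(1 <= k < N) nu_term m delta0 p k),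
      0 < nu m delta0 p
    & cvg_in_distribution P
        (fun n w => Num.sqrt n%:R * (delta_hat n w - delta0))
        (normal_prob 0 (Num.sqrt (nu m delta0 p)^-1))].
Proof.
have delta0_gt : -1 < delta0 by case/andP: hdelta0 => h _; exact: lt_trans h.
split; [exact: is_cvg_nu | exact: nu_gt0 | move=> x _].
suff : P [set w | Num.sqrt n%:R * (delta_hat n w - delta0) <= x] @[n --> \oo] -->
    (normal_cdf (Num.sqrt (nu m delta0 p)^-1) x)%:E by rewrite -normal_cdfE.
apply/fine_cvgP; split.
  near=> n; rewrite fin_num_measure//.
  have mf : measurable_fun setT
      (fun w => Num.sqrt n%:R * (delta_hat n w - delta0)).
    apply: measurable_realfun.measurable_funM => //.
    exact: measurable_realfun.measurable_funB.
  rewrite (_ : [set _ | _] = setT `&`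
      (fun w => Num.sqrt n%:R * (delta_hat n w - delta0)) @^-1` `]-oo, x]).
    exact: mf.
  by apply/seteqP; split => w /=; rewrite in_itv //= => -[].
apply/cvgrPdist_le => eps eps0.
have := mle_cdf_approx x hm ha hdelta0 hJ hmle hp eps0.
by apply: filterS => n; rewrite distrC.
Unshelve. all: by end_near. Qed.
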